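(* Let $G$ be an amenable locally compact group. If $G$ has an element $x$ such that the conjugacy class $x^G = \{gxg^{-1} : g\in G\}$ is not precompact, then $\operatorname{TLIM}(G)\neq\operatorname{TIM}(G)$.
   Context: $L_\infty(G)$ is the dual of $L_1(G)$ (left Haar measure). $\mathcal P_1(G) = \{f\in L_1(G) : f\ge 0, \|f\|_1 = 1\}$. For $T\in L_\infty(G)$ and $f,g\in L_1(G)$, define $fT, Tf\in L_\infty(G)$ by $\langle fT,g\rangle = \langle T, f*g\rangle$ and $\langle Tf,g\rangle = \langle T,g*f\rangle$. A mean is a positive unital linear functional on $L_\infty(G)$. A mean $m$ is topologically left invariant if $\langle m,fT\rangle = \langle m,T\rangle$ for all $f\in\mathcal P_1(G)$, $T\in L_\infty(G)$; topologically right invariant if $\langle m,Tf\rangle = \langle m,T\rangle$ for all such $f,T$; topologically two-sided invariant if both. $\operatorname{TLIM}(G)$ and $\operatorname{TIM}(G)$ denote the sets of topologically left invariant and topologically two-sided invariant means on $L_\infty(G)$. *)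

(* Defs.v *)
From HB Require Import structures.
From mathcomp Require Import all_boot all_order all_algebra.
From mathcomp Require Import all_classical all_reals all_analysis.
From mathcomp Require Import measurable_realfun complex ring.

Set Implicit Arguments.
Unset Strict Implicit.
Unset Printing Implicit Defensive.

Import Order.TTheory GRing.Theory Num.Theory.
Import numFieldNormedType.Exports.

Local Open Scope classical_set_scope.
Local Open Scope ring_scope.
Local Open Scope complex_scope.

HB.mixin Record isTopologicalGroup G of Group G & Topological G := {
  mulg_continuous : continuous (fun p : G * G => (p.1 * p.2)%g) ;
  invg_continuous : continuous (fun x : G => x^-1%g)
}.

#[short(type="topGroupType")]
HB.structure Definition TopologicalGroup :=
  {G of Group G & Topological G & isTopologicalGroup G}.

(* A measurableType must be pointed; we point G at its identity element. *)
Definition pointed_group (G : Type) : Type := G.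
HB.instance Definition _ (G : topGroupType) :=
  TopologicalGroup.on (pointed_group G).
HB.instance Definition _ (G : topGroupType) :=
  isPointed.Build (pointed_group G) (1%g : G).

(* G with its Borel sigma-algebra. *)
Notation borel G := (g_sigma_algebraType (@open (pointed_group G))).

(* Radon in the usual sense for Haar measure: outer regular on Borel sets,
   inner regular on open sets (and not on all Borel sets). *)
Definition left_haar (R : realType) (G : topGroupType)
    (mu : {measure set (borel G) -> \bar R}) : Prop :=
  [/\ mu setT != 0%E,
      forall K : set G, compact K -> (mu K < +oo)%E,
      forall A : set (borel G), measurable A ->
        mu A = ereal_inf [set mu U | U in [set U : set G | open U /\ A `<=` U]],
      forall U : set G, open U ->
        mu U = ereal_sup [set mu K |
          K in [set K : set G | compact K /\ K `<=` U]]
    & forall (x : G) (A : set (borel G)), measurable A ->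
        mu [set (x * y)%g | y in A] = mu A].

Section L1_Linf.
Context (R : realType) (G : topGroupType).
Variable mu : {measure set (borel G) -> \bar R}.

Definition cintegral (F : G -> R[i]) : R[i] :=
  (\int[mu]_y complex.Re (F y)) +i* (\int[mu]_y complex.Im (F y)).

Definition integrableC : {pred G -> R[i]^o} :=
  [pred f | ((@complex.Re R \o f : borel G -> R) \in Lfun mu 1) &&
            ((@complex.Im R \o f : borel G -> R) \in Lfun mu 1)].

Lemma integrableC_submod : submod_closed integrableC.
Proof.
split.
  apply/andP; split; [rewrite (_ : _ \o _ = 0)//|rewrite (_ : _ \o _ = 0)//];
    have [] := Lfun_submod_closed mu (lexx 1%E); by [].
move=> a f g /andP[f1 f2] /andP[g1 g2].
have [_ H] := Lfun_submod_closed mu (lexx 1%E).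
have H0 := fun b (u : borel G -> R) => Lfun_scale b (lexx 1).
apply/andP; split.
- have -> : (@complex.Re R \o (a *: f + g)) =
    (complex.Re a *: (@complex.Re R \o f) + ((- complex.Im a) *: (@complex.Im R \o f) + (@complex.Re R \o g))).
    apply/funext => x; rewrite /= !fctE.
    by case: a (f x) (g x) => [a b] [c d] [e h]; rewrite /GRing.scale /= mulNr addrA.
  by apply: (H _ _ _ f1); exact: H.
- have -> : (@complex.Im R \o (a *: f + g)) =
    (complex.Re a *: (@complex.Im R \o f) + (complex.Im a *: (@complex.Re R \o f) + (@complex.Im R \o g))).
    apply/funext => x; rewrite /= !fctE.
    by case: a (f x) (g x) => [a b] [c d] [e h]; rewrite /GRing.scale /= addrA.
  by apply: (H _ _ _ f2); exact: H.
Qed.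

HB.instance Definition _ :=
  GRing.isSubmodClosed.Build _ _ integrableC integrableC_submod.

(* Functions are not identified when they agree almost everywhere: the seminorm
   L1norm vanishes exactly on the null functions, so the bounded functionals
   below are those of the quotient. *)
Record L1 := MkL1 { L1_fun :> G -> R[i]^o ; _ : L1_fun \in integrableC }.

HB.instance Definition _ := [isSub for L1_fun].
HB.instance Definition _ := [Choice of L1 by <:].
HB.instance Definition _ := [SubChoice_isSubLmodule of L1 by <:].

Definition L1norm (f : L1) : R := \int[mu]_x Normc.normc (f x).

Definition L1_ge0 (f : L1) : Prop :=
  {ae mu, forall x : borel G, 0 <= f x :> R[i]}.

Definition P1 : set L1 := [set f | L1_ge0 f /\ L1norm f = 1].

Definition bounded_functional : {pred L1 -> R[i]^o} :=
  [pred T | `[< scalar T /\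
    exists M : R, forall f, Normc.normc (T f : R[i]) <= M * L1norm f >]].

Lemma L1norm_ge0 f : 0 <= L1norm f.
Proof.
apply: fine_ge0; apply: integral_ge0 => x _; rewrite lee_fin.
by case: (L1_fun f x) => a b; exact: sqrtr_ge0.
Qed.

Lemma bounded_functional_submod : submod_closed bounded_functional.
Proof.
split.
  apply/asboolP; split; first by move=> a f g /=; rewrite mulr0 addr0.
  by exists 0 => f; rewrite Normc.normc0 mul0r.
move=> a S T /asboolP[linS [M SM]] /asboolP[linT [N TN]]; apply/asboolP; split.
  move=> b f g; rewrite !fctE linS linT /= !scalerDr !mulrDr.
  by rewrite /GRing.scale/= mulrCA addrACA.
exists (Normc.normc a * M + N) => f; rewrite !fctE.
rewrite (le_trans (le_normcD _ _))// mulrDl lerD//.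
rewrite Normc.normcM -mulrA ler_wpM2l//.
by case: (a) => u v; exact: sqrtr_ge0.
Qed.

HB.instance Definition _ := GRing.isSubmodClosed.Build _ _ bounded_functional
  bounded_functional_submod.

(* L_infty(G), as the dual of L_1(G). *)
Record Linf := MkLinf {
  Linf_fun :> L1 -> R[i]^o ; _ : Linf_fun \in bounded_functional }.

HB.instance Definition _ := [isSub for Linf_fun].
HB.instance Definition _ := [Choice of Linf by <:].
HB.instance Definition _ := [SubChoice_isSubLmodule of Linf by <:].

Lemma Re_integrable (f : L1) :
  mu.-integrable setT (fun x => (complex.Re (f x))%:E).
Proof. by case: f => f /= /andP[f1 _]; apply/Lfun1_integrable. Qed.

Lemma Im_integrable (f : L1) :
  mu.-integrable setT (fun x => (complex.Im (f x))%:E).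
Proof. by case: f => f /= /andP[_ f2]; apply/Lfun1_integrable. Qed.

Lemma normc_le (z : R[i]) :
  Normc.normc z <= `|complex.Re z| + `|complex.Im z|.
Proof.
case: z => a b /=.
rewrite -[leRHS]ger0_norm ?addr_ge0// -sqrtr_sqr ler_wsqrtr// sqrrD.
by rewrite !real_normK ?num_real// addrAC lerDl mulrn_wge0// mulr_ge0.
Qed.

Lemma normc_ge (z : R[i]) :
  `|complex.Re z| <= Normc.normc z /\ `|complex.Im z| <= Normc.normc z.
Proof.
case: z => a b /=; rewrite -!sqrtr_sqr; split; apply: ler_wsqrtr.
  by rewrite lerDl sqr_ge0.
by rewrite lerDr sqr_ge0.
Qed.

Lemma normc_integrable (f : L1) :
  mu.-integrable setT (fun x => (Normc.normc (f x))%:E).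
Proof.
have mRe := measurable_int mu (Re_integrable f).
have mIm := measurable_int mu (Im_integrable f).
apply: (@le_integrable _ _ _ mu _ measurableT _
  (fun x => (`|complex.Re (f x)| + `|complex.Im (f x)|)%:E)).
- apply/measurable_EFinP.
  have -> : (fun x => Normc.normc (f x)) =
      (fun x => Num.sqrt (complex.Re (f x) ^+ 2 + complex.Im (f x) ^+ 2)).
    by apply/funext => x; case: (L1_fun f x).
  apply: (measurableT_comp (continuous_measurable_fun (@sqrt_continuous R))).
  by apply: measurable_funD; apply: measurable_funX; exact/measurable_EFinP.
- move=> x _; rewrite !abse_EFin lee_fin ger0_norm.
    by rewrite (le_trans (normc_le _))// ler_norm.
  by rewrite (le_trans _ (normc_ge _).1).
- under eq_fun do rewrite EFinD.
  apply: integrableD => //.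
    exact: (integrable_abse (Re_integrable f)).
  exact: (integrable_abse (Im_integrable f)).
Qed.

Lemma cintegral_bounded_functional :
  (fun f : L1 => cintegral f : R[i]^o) \in bounded_functional.
Proof.
apply/asboolP; split => [a f g|].
  have If := Re_integrable f; have Jf := Im_integrable f.
  have Ig := Re_integrable g; have Jg := Im_integrable g.
  have lin3 (r s : R) (u v w : borel G -> R) :
      mu.-integrable setT (EFin \o u) -> mu.-integrable setT (EFin \o v) ->
      mu.-integrable setT (EFin \o w) ->
      \int[mu]_x (r * u x + (s * v x + w x)) =
      r * (\int[mu]_x u x) + (s * (\int[mu]_x v x) + \int[mu]_x w x).
    move=> iu iv iw.
    have iru : mu.-integrable setT (EFin \o (fun x => r * u x)).
      exact: (integrableZl _ r iu).
    have isv : mu.-integrable setT (EFin \o (fun x => s * v x)).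
      exact: (integrableZl _ s iv).
    have isvw : mu.-integrable setT (EFin \o (fun x => s * v x + w x)).
      exact: (integrableD _ isv iw).
    rewrite RintegralD// RintegralZl//; congr (_ + _).
    by rewrite RintegralD// RintegralZl.
  have val_lin x : (a *: f + g) x = a * (f x : R[i]) + g x :> R[i] by [].
  rewrite /cintegral.
  have -> : \int[mu]_y complex.Re ((a *: f + g) y) =
      complex.Re a * (\int[mu]_y complex.Re (f y)) +
      ((- complex.Im a) * (\int[mu]_y complex.Im (f y)) +
      \int[mu]_y complex.Re (g y)).
    rewrite -lin3//; apply: eq_Rintegral => x _; rewrite val_lin.
    by case: (a) (f x : R[i]) (g x : R[i]) => [? ?] [? ?] [? ?] /=; ring.
  have -> : \int[mu]_y complex.Im ((a *: f + g) y) =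
      complex.Re a * (\int[mu]_y complex.Im (f y)) +
      (complex.Im a * (\int[mu]_y complex.Re (f y)) +
      \int[mu]_y complex.Im (g y)).
    rewrite -lin3//; apply: eq_Rintegral => x _; rewrite val_lin.
    by case: (a) (f x : R[i]) (g x : R[i]) => [? ?] [? ?] [? ?] /=; ring.
  by case: (a) => ? ?; apply/eqP; rewrite eq_complex /= mulNr !addrA !eqxx.
exists 2 => f; rewrite (le_trans (normc_le _))//= mulr_natl mulr2n lerD//.
  rewrite (le_trans (le_normr_Rintegral _ (Re_integrable f)))//.
  apply: le_Rintegral => //; [exact: (integrable_abse (Re_integrable f))|
    exact: normc_integrable|by move=> x _; exact: (normc_ge _).1].
rewrite (le_trans (le_normr_Rintegral _ (Im_integrable f)))//.
apply: le_Rintegral => //; [exact: (integrable_abse (Im_integrable f))|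
  exact: normc_integrable|by move=> x _; exact: (normc_ge _).2].
Qed.

(* The function 1, as a functional: f |-> \int f. *)
Definition Linf_one : Linf := MkLinf cintegral_bounded_functional.

Definition Linf_ge0 (T : Linf) : Prop :=
  forall f : L1, L1_ge0 f -> 0 <= T f :> R[i].

(* In convol, lact, ract, ltranslate and Linf_ltranslate, the default 0 of insubd
   is used only if the function built is not in L_1(G), resp. L_infty(G); this
   does not happen when mu is a left Haar measure of a locally compact Hausdorff
   group. *)
Definition convol (f g : L1) : L1 :=
  insubd 0 (fun x : G => cintegral (fun y => f y * g (y^-1 * x)%g) : R[i]^o).

(* <fT, g> = <T, f * g> *)
Definition lact (f : L1) (T : Linf) : Linf :=
  insubd 0 (fun g : L1 => T (convol f g)).

(* <Tf, g> = <T, g * f> *)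
Definition ract (T : Linf) (f : L1) : Linf :=
  insubd 0 (fun g : L1 => T (convol g f)).

Definition ltranslate (x : G) (f : L1) : L1 :=
  insubd 0 (fun y : G => f (x^-1 * y)%g).

(* The functional of the function y |-> T (x y), since
   \int T (x y) f(y) dy = \int T(y) f (x^-1 y) dy. *)
Definition Linf_ltranslate (x : G) (T : Linf) : Linf :=
  insubd 0 (fun f : L1 => T (ltranslate x f)).

Definition mean : set {scalar Linf} :=
  [set m : {scalar Linf} | (forall T, Linf_ge0 T -> 0 <= m T) /\ m Linf_one = 1].

Definition TLIM : set {scalar Linf} :=
  [set m : {scalar Linf} | mean m /\ forall f T, P1 f -> m (lact f T) = m T].

Definition TRIM : set {scalar Linf} :=
  [set m : {scalar Linf} | mean m /\ forall f T, P1 f -> m (ract T f) = m T].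

Definition TIM : set {scalar Linf} := TLIM `&` TRIM.

Definition amenable : Prop :=
  exists2 m : {scalar Linf}, mean m &
    forall x T, m (Linf_ltranslate x T) = m T.

End L1_Linf.

Arguments mean {R G} mu _.
Arguments TLIM {R G} mu _.
Arguments TRIM {R G} mu _.
Arguments TIM {R G} mu _.

Definition conjugacy_class (G : groupType) (x : G) : set G :=
  [set (g * x * g^-1)%g | g in setT].

(* Main.v *)
(* If the conjugacy class of x is not precompact, one can choose points y_n
   escaping every compact set together with their conjugates y_n x y_n^-1; from
   them one builds an open set A, disjoint from A x^-1, such that every z satisfies
   z y_n \in A for n large.  Averaging right translates by the y_n along an
   ultrafilter gives a positive unital operator Phi on L_infty(G) that commutes
   with the left action of L_1(G) and sends the indicator of A to 1.  Hence for
   any m in TLIM(G) the mean m o Phi is again in TLIM(G) and gives A mass 1.  If it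
   were right invariant it would give mass 1 to A x^-1 as well, although the two
   sets are disjoint.

   Amenability provides a mean that is invariant under translations only.  For
   T >= 0 the functional f |-> m(fT) on L_1(G) is bounded, positive, and
   transforms under right translations as the Haar integral does; uniqueness
   forces m(fT) to be a multiple of \int f, so that T |-> m(fT), for a fixed f in
   P_1(G), is topologically left invariant.

   Haar measure need not be sigma-finite, and the Borel sigma-algebra of G x G can
   be larger than the product sigma-algebra.  Tonelli's theorem is therefore
   proved from inner regularity, and applied on an open sigma-compact subgroup,
   outside of which any given countable family of integrable functions
   vanishes. *)

Require Import Defs.
From HB Require Import structures.
From mathcomp Require Import all_boot all_order all_algebra.
From mathcomp Require Import all_classical all_reals all_analysis.
From mathcomp Require Import measurable_realfun complex ring lra finmap.

Set Implicit Arguments.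
Unset Strict Implicit.
Unset Printing Implicit Defensive.

Import Order.TTheory GRing.Theory Num.Theory.
Import numFieldNormedType.Exports.
Import HBNNSimple HBSimple.

Local Open Scope classical_set_scope.
Local Open Scope ring_scope.
Local Open Scope complex_scope.

(** Dominated convergence is available for sequences, not for nets, and a sequence of compact sets
    exhausts only an open subgroup [H] of G. The compact sets are therefore chosen so that [H]
    contains [x] and all the points [y n]: right multiplication by these preserves each coset [s H],
    and a subset of [H] copied into every coset by left translation serves the whole group.

    Each of the two escape conditions has its own task. If a point of A and its translate by [x]
    come from different indices, some [y n] is a short product of elements of the compact set it was
    meant to avoid; if they come from the same index, its conjugate [y n * x * (y n)^-1] is.

    Elements of L_infty(G) are functionals, without values at points, and most convolution
    identities hold only almost everywhere. They are stated under an arbitrary functional [T] and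
    proved one argument at a time on indicators of sets of finite measure. G need not be unimodular,
    whence the factors [D x]. *)

Lemma measureS d (T : measurableType d) (R : realType)
    (mu : {measure set T -> \bar R}) (A B : set T) :
  measurable A -> measurable B -> A `<=` B -> (mu A <= mu B)%E.
Proof. by move=> mA mB AB; apply: le_measure => //; apply: mem_set. Qed.

(** * Tonelli's theorem for inner regular Borel measures *)

Section measurable_fun_induction.
Local Open Scope ereal_scope.
Context d (T : measurableType d) (R : realType).

(** The usual induction through simple functions. The sum over level sets is peeled off one set at a
    time, so [PD] only ever adds two nonnegative measurable functions. *)
Lemma ge0_measurable_fun_ind (P : (T -> \bar R) -> Prop) :
  P (cst 0) ->
  (forall A (c : R), measurable A -> (0 <= c)%R ->
    P (fun x => (c * \1_A x)%:E)) ->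
  (forall f g, measurable_fun setT f -> (forall x, 0 <= f x) -> P f ->
    measurable_fun setT g -> (forall x, 0 <= g x) -> P g ->
    P (f \+ g)) ->
  (forall f_ : nat -> T -> \bar R, (forall n, measurable_fun setT (f_ n)) ->
    (forall n x, 0 <= f_ n x) -> (forall x, nondecreasing_seq (f_ ^~ x)) ->
    (forall n, P (f_ n)) -> P (fun x => limn (f_ ^~ x))) ->
  forall f, measurable_fun setT f -> (forall x, 0 <= f x) -> P f.
Proof.
move=> P0 P1 PD Plim f mf f0.
pose f_ := nnsfun_approx measurableT mf.
have -> : f = fun x => limn (fun n => (f_ n x)%:E).
  by apply/funext => x; apply/esym/cvg_lim => //; exact: cvg_nnsfun_approx.
apply: (Plim (fun n x => (f_ n x)%:E)).
- by move=> n; exact/measurable_EFinP/measurable_funP.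
- by move=> n x; rewrite lee_fin.
- by move=> x m n mn; rewrite lee_fin; exact/lefP/nd_nnsfun_approx.
move=> n.
have [s s0 Es] : exists2 s : seq R, all (fun y => (0 <= y)%R) s &
    forall x, f_ n x = (\sum_(y <- s) y * \1_(f_ n @^-1` [set y]) x)%R.
  exists (fset_set (range (f_ n))).
    by apply/allP => y; rewrite in_fset_set// => /set_mem[x _ <-].
  by move=> x; rewrite fimfunE fsbig_finite.
under eq_fun do rewrite Es.
have mS (t : seq R) : measurable_fun setT (fun x =>
    (\sum_(y <- t) y * \1_(f_ n @^-1` [set y]) x)%:E).
  by apply/measurable_EFinP; apply: measurable_sum => y; exact: measurable_funM.
have S0 (t : seq R) x : all (fun y => (0 <= y)%R) t ->
    0 <= (\sum_(y <- t) y * \1_(f_ n @^-1` [set y]) x)%:E.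
  by move=> /allP t0; rewrite lee_fin big_seq sumr_ge0// => y /t0 ?; rewrite mulr_ge0.
elim: s s0 {Es} => [_|y s IH /= /andP[y0 s0]].
  by under eq_fun do rewrite big_nil.
under eq_fun do rewrite big_cons EFinD.
apply: PD.
- by apply/measurable_EFinP; exact: measurable_funM.
- by move=> x; rewrite lee_fin mulr_ge0.
- exact: P1.
- exact: mS.
- by move=> x; exact: S0.
- exact: IH.
Qed.

End measurable_fun_induction.

(* Without it, X * Y is not recognized as a ptopologicalType. *)
HB.saturate prod.

Notation bor X := (g_sigma_algebraType (@open X)).

Section borel_sets.
Context (X Y : ptopologicalType).

Lemma open_bor (U : set X) : open U -> measurable (U : set (bor X)).
Proof. by move=> oU; exact: sub_sigma_algebra. Qed.

Lemma closed_bor (U : set X) : closed U -> measurable (U : set (bor X)).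
Proof.
by move=> /closed_openC/open_bor/measurableC; rewrite setCK.
Qed.

Lemma compact_bor (K : set X) : hausdorff_space X -> compact K ->
  measurable (K : set (bor X)).
Proof. by move=> hX cK; apply: closed_bor; exact: compact_closed. Qed.

Lemma continuous_bor (f : X -> Y) : continuous f ->
  measurable_fun setT (f : bor X -> bor Y).
Proof.
move=> /continuousP cf; apply: (@measurability _ _ (bor X) (bor Y) setT f (@open Y)) => //.
by move=> _ [U oU <-]; rewrite setTI; apply: open_bor; exact: cf.
Qed.

Lemma lsc_bor (R : realType) (f : X -> \bar R) :
  (forall a : R, open [set x | (a%:E < f x)%E]) ->
  measurable_fun setT (f : bor X -> \bar R).
Proof.
move=> scif; apply: (measurability _ (ErealGenOInfty.measurableE R)).
move=> /= _ [_ [a ->]] <-; apply: measurableI => //; apply: open_bor.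
by rewrite preimage_itvoy; exact: scif.
Qed.

End borel_sets.

Section tight.
Context (X : ptopologicalType) (R : realType).
Local Open Scope ereal_scope.

(* Inner regularity on open sets; together with finiteness this is all that
   Tonelli's theorem needs. *)
Definition tight (nu : set (bor X) -> \bar R) :=
  forall (U : set X) (a : R), open U -> a%:E < nu U ->
  exists K : set X, [/\ compact K, K `<=` U & a%:E < nu K].

(** Finitely many of the sets [V] cover [K]. The conclusion is negligibility because a compact set
    need not be Borel in a space that may fail to be Hausdorff. *)
Lemma compact_null (nu : {measure set (bor X) -> \bar R}) (K B : set X) :
  compact K -> measurable (B : set (bor X)) ->
  (forall y, K y -> exists V, [/\ open V, V y & nu (V `&` B) = 0]) ->
  nu.-negligible (K `&` B).
Proof.
move=> cK mB H.
have /choice[V HV] : forall y, exists V : set X, K y ->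
    [/\ open V, V y & nu (V `&` B) = 0].
  move=> y; have [Ky|nKy] := pselect (K y); last by exists setT.
  by have [V ?] := H _ Ky; exists V.
move: cK; rewrite compact_cover => /(_ X K V) [||D' D'K KV].
- by move=> y /HV[].
- by move=> y Ky; exists y => //; have [] := HV _ Ky.
apply: (@negligibleS _ _ _ nu (\big[setU/set0]_(y <- D') (V y `&` B))).
  move=> y [Ky By]; have [z /= zD Vzy] := KV _ Ky.
  by rewrite -bigcup_seq; exists z.
rewrite big_seq; elim/big_ind: _ => [|A C nA nC|y yD].
- exact: negligible_set0.
- exact: negligibleU.
have /HV[oV Vy0 null] : K y by apply/set_mem; exact: D'K.
by apply/negligibleP => //; apply: measurableI => //; exact: open_bor.
Qed.

End tight.

Section sections.
Context (X Y : ptopologicalType) (R : realType).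
Local Open Scope ereal_scope.

Lemma continuous_pairr (y : Y) : continuous (fun x : X => (x, y)).
Proof. by move=> x; apply: cvg_pair; [exact: cvg_id|exact: cvg_cst]. Qed.

Lemma measurable_section (E : set (X * Y)%type) (y : Y) :
  measurable (E : set (bor (X * Y)%type)) ->
  measurable ([set x | E (x, y)] : set (bor X)).
Proof.
move=> mE; have := @continuous_bor X (X * Y)%type (fun x => (x, y)) (@continuous_pairr y)
    measurableT _ mE.
by rewrite setTI.
Qed.

(** The tube lemma. A box fits into [E] around each point of [K] over [y]; compactness, applied with
    the filter of small neighbourhoods of [y], yields one [W] that serves all points of [K]. *)
Lemma tube (E : set (X * Y)%type) (K : set X) (y : Y) : open E -> compact K ->
  K `<=` [set x | E (x, y)] ->
  exists U V, [/\ open U, open V, K `<=` U, V y & U `*` V `<=` E].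
Proof.
move=> oE /compact_near_coveringP cK KE.
have := cK _ (powerset_filter_from (nbhs y)) (fun V x =>
  nbhs x [set x' | forall z, V z -> E (x', z)]) _ .
case.
  move=> x /KE Exy.
  have [[A V] /= [nA nV] AVE] : nbhs (x, y) E by exact: open_nbhs_nbhs.
  exists (A°, [set W | nbhs y W /\ W `<=` V]).
    by split => /=; [exact: nbhs_interior|exact: powerset_filter_fromP].
  move=> [a W] /= [Aa [nW WV]].
  by apply: filterS Aa => b Ab z /WV Vz; apply: AVE.
move=> M [Mn _ [W MW]] /(_ _ MW) KW.
exists ([set x' | forall z, W z -> E (x', z)]°), (W°); split => //.
- exact: open_interior.
- exact: open_interior.
- by apply: nbhs_singleton; apply: nbhs_interior; exact: Mn.
move=> [a b] [/= /interior_subset aW /interior_subset Wb]; exact: aW.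
Qed.

(** A compact subset of the section over [y] of measure above [a] stays, by the tube lemma, inside
    the sections over all points near [y]. This semicontinuity gives measurability of section
    measures for sets outside the product sigma-algebra. *)
Lemma tight_section_lsc (nu : {measure set (bor X) -> \bar R})
  (E : set (X * Y)%type) : hausdorff_space X -> tight nu -> open E ->
  forall a : R, open [set y | a%:E < nu [set x | E (x, y)]].
Proof.
move=> hX tnu oE a; rewrite openE => y /= /tnu[|K [cK KE aK]].
  by have /continuousP := @continuous_pairr y; exact.
have [U [V [oU oV KU Vy UV]]] := tube oE cK KE.
apply: (@filterS _ _ _ V); last exact: open_nbhs_nbhs.
move=> z Vz /=; apply: (lt_le_trans aK); apply: measureS.
- exact: compact_bor.
- by apply: measurable_section; exact: open_bor.
by move=> x /KU Ux; apply: UV.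
Qed.

Lemma section_bigcup (nu : {measure set (bor X) -> \bar R})
    (F : (set (X * Y)%type)^nat) (y : Y) :
  (forall n, measurable (F n : set (bor (X * Y)%type))) -> trivIset setT F ->
  nu [set x | (\bigcup_k F k) (x, y)] = \sum_(k <oo) nu [set x | F k (x, y)].
Proof.
move=> mF tF; apply/esym/cvg_lim => //.
have -> : [set x | (\bigcup_k F k) (x, y)] = \bigcup_k [set x | F k (x, y)] by [].
apply: measure_sigma_additive; first by move=> k; exact: measurable_section.
apply/trivIsetP => i j _ _ ij; move/trivIsetP : tF => /(_ i j I I ij).
by move=> /seteqP[FF _]; apply/seteqP; split=> // x /FF.
Qed.

(** Open sets are handled by semicontinuity and are stable under intersection, so Dynkin's theorem
    extends the result to Borel sets. Finiteness of [nu] allows the subtraction needed for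
    complements. *)
Lemma measurable_fun_section (nu : {finite_measure set (bor X) -> \bar R})
    (E : set (X * Y)%type) : hausdorff_space X -> tight nu ->
  measurable (E : set (bor (X * Y)%type)) ->
  measurable_fun setT ((fun y => nu [set x | E (x, y)]) : bor Y -> \bar R).
Proof.
move=> hX tnu.
pose P (E : set (bor (X * Y)%type)) := measurable_fun setT
  ((fun y => nu [set x | E (x, y)]) : bor Y -> \bar R).
apply: (@dynkin_induction _ (bor (X * Y)%type) open P) => //; rewrite /P.
- exact: openI.
- exact: (measurable_cst (nu setT)).
- by move=> U oU; exact: (lsc_bor (tight_section_lsc hX tnu oU)).
- move=> S mS IH; have -> : (fun y => nu [set x | (~` S) (x, y)]) =
    (fun y => nu setT - nu [set x | S (x, y)]).
    apply/funext => y; have mSy := measurable_section y mS.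
    rewrite -[X in _ = _ - nu X]setTI -measureD//= ?setTD//.
    by rewrite ltey_eq fin_num_measure.
  by apply: emeasurable_funB.
move=> F mF tF IH.
have -> : (fun y => nu [set x | (\bigcup_k F k) (x, y)]) =
    fun y => \sum_(k <oo) nu [set x | F k (x, y)].
  by apply/funext => y; exact: section_bigcup.
exact: ge0_emeasurable_sum.
Qed.

End sections.

Section tonelli_open.
Context (R : realType).
Local Open Scope ereal_scope.

Lemma open_setX (X Y : topologicalType) (U : set X) (V : set Y) :
  open U -> open V -> open (U `*` V).
Proof.
move=> oU oV; have -> : U `*` V = fst @^-1` U `&` snd @^-1` V by [].
by apply: openI; apply: open_comp => // -[x y] _; [exact: cvg_fst|exact: cvg_snd].
Qed.

Lemma ge0_integral0_negligible d (T : measurableType d)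
    (nu : {measure set T -> \bar R}) (f : T -> \bar R) :
  measurable_fun setT f -> (forall x, 0 <= f x) -> \int[nu]_x f x = 0 ->
  nu.-negligible [set x | 0 < f x].
Proof.
move=> mf f0 If; have /(ae_eq_integral_abs nu measurableT mf) :
    \int[nu]_x `|f x| = 0.
  by under eq_integral do rewrite gee0_abs//.
apply: negligibleS => x /= fx /(_ I) /= fx0.
by rewrite fx0 ltxx in fx.
Qed.

Lemma fubini_section d1 d2 (X : measurableType d1) (Y : measurableType d2)
    (nu : {finite_measure set X -> \bar R})
    (la : {finite_measure set Y -> \bar R}) (A : set (X * Y)) : measurable A ->
  [/\ (nu \x la) A = \int[la]_y nu [set x | A (x, y)],
      (nu \x la) A = \int[nu]_x la [set y | A (x, y)],
      measurable_fun setT (fun y => nu [set x | A (x, y)]) &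
      measurable_fun setT (fun x => la [set y | A (x, y)])].
Proof.
move=> mA; split.
- rewrite (@product_measure_unique _ _ _ _ _ nu la (nu \x^ la))//; last first.
    by move=> B C mB mC; exact: product_measure2E.
  by apply: eq_integral => y _ /=; rewrite ysectionE.
- by apply: eq_integral => y _ /=; rewrite xsectionE.
- rewrite (_ : (fun y => _) = nu \o ysection A); first exact: measurable_fun_ysection.
  by apply/funext => y /=; rewrite ysectionE.
- rewrite (_ : (fun y => _) = la \o xsection A); first exact: measurable_fun_xsection.
  by apply/funext => y /=; rewrite xsectionE.
Qed.

Lemma measurable_swap (X Y : ptopologicalType) (E : set (X * Y)%type) :
  measurable (E : set (bor (X * Y)%type)) ->
  measurable ([set z | E (z.2, z.1)] : set (bor (Y * X)%type)).
Proof.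
move=> mE; have := @continuous_bor (Y * X)%type (X * Y)%type _
  (@swap_continuous Y X) measurableT _ mE.
by rewrite setTI.
Qed.

Lemma measurable_fun_section' (X Y : ptopologicalType)
    (la : {finite_measure set (bor Y) -> \bar R})
    (E : set (X * Y)%type) : hausdorff_space Y -> tight la ->
  measurable (E : set (bor (X * Y)%type)) ->
  measurable_fun setT ((fun x => la [set y | E (x, y)]) : bor X -> \bar R).
Proof.
by move=> hY tla mE; exact: (measurable_fun_section hY tla (measurable_swap mE)).
Qed.

Lemma measurable_section' (X Y : ptopologicalType) (E : set (X * Y)%type) (x : X) :
  measurable (E : set (bor (X * Y)%type)) ->
  measurable ([set y | E (x, y)] : set (bor Y)).
Proof. by move=> mE; exact: (measurable_section x (measurable_swap mE)). Qed.

(* Open sets of X * Y need not be measurable for the product sigma-algebra.  Among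
   the open subsets of E that are, take one, W, of maximal product measure: any
   box U `*` V contained in E is then included in W up to a null set.  By
   compactness this makes the two sections of E and W over y have the same measure
   for almost every y, and W satisfies Fubini's theorem. *)
Lemma tonelli_open_le (X Y : ptopologicalType)
    (nu : {finite_measure set (bor X) -> \bar R})
    (la : {finite_measure set (bor Y) -> \bar R}) (E : set (X * Y)%type) :
  hausdorff_space X -> hausdorff_space Y -> tight nu -> tight la -> open E ->
  \int[la]_y nu [set x | E (x, y)] <= \int[nu]_x la [set y | E (x, y)].
Proof.
move=> hX hY tnu tla oE.
pose S := [set W : set (X * Y)%type | [/\ open W, W `<=` E &
  measurable (W : set (bor X * bor Y)%type)]].
pose p := nu \x la.
have pT : p setT < +oo.
  rewrite -setXTT /p product_measure1E//.
  by rewrite ltey_eq fin_numM// fin_num_measure.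
have pfin (W : set (bor X * bor Y)%type) : measurable W -> p W \is a fin_num.
  move=> mW; rewrite ge0_fin_numE//; apply: le_lt_trans pT.
  exact: measureS.
have S0 : S set0 by split => //; exact: open0.
have supfin : ereal_sup [set p W | W in S] \is a fin_num.
  rewrite ge0_fin_numE; last first.
    by apply: le_ereal_sup_tmp; exists 0 => //; exists set0.
  apply: le_lt_trans pT; apply: ge_ereal_sup => _ [W [_ _ mW] <-].
  exact: measureS.
(* The supremum is attained: [S] is stable under countable unions, so the union of members within
   [n.+1%:R^-1] of the supremum is maximal. *)
have [W [oW WE mW] Wmax] : exists2 W, S W & forall V, S V -> p V <= p W.
  have /choice[F SF] : forall n : nat, exists W, S W /\
      ereal_sup [set p W | W in S] - (n.+1%:R^-1)%:E < p W.
    move=> n; have [//|_ [W SW <-] pW] := @ub_ereal_sup_adherent _ _ n.+1%:R^-1 _ supfin.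
    by exists W.
  have mF k : measurable (F k : set (bor X * bor Y)%type) by have [[]] := SF k.
  exists (\bigcup_k F k).
    split; first by apply: bigcup_open => k _; have [[]] := SF k.
    - by move=> x [k _]; have [[_ + _] _] := SF k; exact.
    - exact: bigcup_measurable.
  move=> V SV; apply: (@le_trans _ _ (ereal_sup [set p W | W in S])).
    by apply: ereal_sup_ubound; exists V.
  apply/lee_addgt0Pr => e e0.
  have [n ne] : exists n : nat, (n.+1%:R^-1 < e)%R.
    exists (Num.truncn e^-1); rewrite invf_plt ?posrE//; exact: truncnS_gt.
  rewrite -leeBlDr//; apply: (@le_trans _ _ (p (F n))).
    apply: le_trans (ltW (SF n).2); apply: leeB => //.
    by rewrite lee_fin ltW.
  apply: measureS => //; last exact: bigcup_sup.
  exact: bigcup_measurable.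
have [_ pW mnuW mlaW] := fubini_section nu la mW.
(* Adding the box to [W] cannot raise [p], so the box minus [W] is null. Over a point of [V] where
   the section of [W] is smaller than [U], this difference has a section of positive measure; such
   points are therefore negligible. *)
have Wnull U V : open U -> open V -> U `*` V `<=` E ->
    la.-negligible (V `&` [set y | nu [set x | W (x, y)] < nu U]).
  move=> oU oV UV.
  have mUV : measurable ((U `*` V) : set (bor X * bor Y)%type).
    by apply: measurableX; exact: open_bor.
  have mD := measurableD mUV mW.
  have : p (W `|` U `*` V) <= p W.
    apply: Wmax; split; [|by rewrite subUset|exact: measurableU].
    by apply: openU => //; exact: open_setX.
  have -> : W `|` U `*` V = W `|` (U `*` V `\` W).
    apply/seteqP; split=> z; last by case=> [|[]]; [left|right].
    by have [|nW] := pselect (W z); [left|case=> // ?; right].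
  rewrite /p measureU//; last by rewrite setDE setICA setICr setI0.
  have pDf := pfin _ mD; rewrite -/p -leeBrDl ?pfin// subee ?pfin// => pD.
  have {}pD : p (U `*` V `\` W) = 0 by apply/eqP; rewrite eq_le pD measure_ge0.
  have [pDE _ mnuD _] := fubini_section nu la mD.
  have := ge0_integral0_negligible mnuD (fun=> measure_ge0 _ _)
    (etrans (esym pDE) pD).
  apply: negligibleS => y [Vy /= Wy].
  have mWy : measurable ([set x | W (x, y)] : set (bor X)).
    by apply: measurable_section; exact: open_bor.
  have -> : [set x | (U `*` V `\` W) (x, y)] = U `\` [set x | W (x, y)].
    by apply/seteqP; split=> x /= [] => [[]|].
  rewrite -sube_gt0 in Wy.
  rewrite measureD//; [|exact: open_bor|by rewrite ltey_eq fin_num_measure//; exact: open_bor].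
  apply: (lt_le_trans Wy); apply: leeB => //; apply: measureS => //.
  by apply: measurableI => //; exact: open_bor.
have mE : measurable (E : set (bor (X * Y)%type)) by exact: open_bor.
have mW' : measurable (W : set (bor (X * Y)%type)) by exact: open_bor.
have mEX := measurable_fun_section hX tnu mE.
pose B (q : R) := [set y | nu [set x | W (x, y)] <= q%:E] `&`
  [set y | q%:E < nu [set x | E (x, y)]].
(* If [B q] had positive measure, a compact [K] inside [O] with measure above [la O - la (B q)]
   would meet it in positive measure. But through each point of [K] passes a tube inside [E] whose
   base has measure above [q], so by [Wnull] the set [B q] is null near that point. *)
have Bnull q : la.-negligible (B q).
  pose O : set Y := [set y | q%:E < nu [set x | E (x, y)]].
  have oO : open O := tight_section_lsc hX tnu oE q.
  have mB : measurable (B q : set (bor Y)).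
    apply: measurableI; last exact: open_bor.
    by rewrite -[X in measurable X]setTI; exact: emeasurable_fun_infty_c.
  apply: contrapT => /negligibleP => /(_ mB) /eqP B0.
  have fin (C : set (bor Y)) : measurable C -> la C \is a fin_num.
    exact: fin_num_measure.
  have Bgt0 : 0 < la (B q) by rewrite lt0e B0 measure_ge0.
  have mO := open_bor oO.
  have [K [cK KO aK]] : exists K : set Y, [/\ compact K, K `<=` O &
      (fine (la O) - fine (la (B q)))%:E < la K].
    apply: tla => //; rewrite EFinB !fineK ?fin// lteBlDr ?fin//.
    by rewrite lteDl// fin.
  have mK := compact_bor hY cK.
  have : la.-negligible (K `&` B q).
    apply: compact_null => // y /KO /= qh.
    have [|K' [cK' K'E qK']] := tnu _ _ _ qh.
      by have /continuousP := @continuous_pairr X Y y; exact.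
    have [U [V [oU oV KU Vy UV]]] := tube oE cK' K'E.
    exists V; split => //; apply/negligibleP.
      by apply: measurableI => //; exact: open_bor.
    apply: negligibleS (Wnull _ _ oU oV UV) => z [Vz [/= Wq _]]; split => //=.
    apply: (le_lt_trans Wq); apply: (lt_le_trans qK'); apply: measureS => //.
      exact: compact_bor.
    exact: open_bor.
  move/negligibleP => /(_ (measurableI _ _ mK mB)) KB0.
  have : la K + la (B q) <= la O.
    rewrite (measureDI la mB mK) [B q `&` K]setIC KB0 adde0 -measureU//.
    - apply: measureS => //; first by apply: measurableU => //; exact: measurableD.
      by move=> y [/KO//|[[]]].
    - exact: measurableD.
    - by rewrite setIC setDE -setIA setICl setI0.
  apply/negP; rewrite -ltNge; move: aK; rewrite EFinB !fineK ?fin//.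
  by rewrite lteBlDr// fin.
(* If the two sections differ in measure, a rational separates them, so the exceptional points lie
   in a countable union of sets [B q]. The default value 0 of the enumeration only repeats the null
   set [B 0]. *)
have -> : \int[la]_y nu [set x | E (x, y)] = \int[la]_y nu [set x | W (x, y)].
  apply: ge0_ae_eq_integral => //.
  have : la.-negligible (\bigcup_n B (ratr (odflt 0%R (@choice.unpickle rat n)))).
    exact: negligible_bigcup.
  apply: negligibleS => y /= /not_implyP[_ hw].
  have wh : nu [set x | W (x, y)] <= nu [set x | E (x, y)].
    apply: measureS; [exact: measurable_section|exact: measurable_section|].
    by move=> x /WE.
  have {hw wh} : nu [set x | W (x, y)] < nu [set x | E (x, y)].
    by rewrite lt_neqAle wh andbT; apply/eqP => h; exact: hw.
  have finx (C : set (bor X)) : measurable C -> nu C \is a fin_num.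
    exact: fin_num_measure.
  have mEy := measurable_section y mE; have mWy := measurable_section y mW'.
  rewrite -[X in X < _]fineK ?finx// -[X in _ < X]fineK ?finx// lte_fin.
  move=> /rat_in_itvoo[q] /[!in_itv]/= /andP[q1 q2].
  exists (choice.pickle q) => //; rewrite choice.pickleK; split => /=.
    by rewrite -[X in X <= _]fineK ?finx// lee_fin ltW.
  by rewrite -[X in _ < X]fineK ?finx// lte_fin.
(* The order of integration is exchanged for [W]; returning to [E] then uses only the inclusion of
   [W] in [E], whence an inequality. Exchanging the two factors gives the reverse one. *)
have [<- -> _ mla] := fubini_section nu la mW.
apply: ge0_le_integral => //; first exact: measurable_fun_section'.
by move=> x _; apply: measureS; [exact: measurable_section'|
  exact: measurable_section'|move=> y /WE].
Qed.

Lemma tonelli_open (X Y : ptopologicalType)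
    (nu : {finite_measure set (bor X) -> \bar R})
    (la : {finite_measure set (bor Y) -> \bar R}) (E : set (X * Y)%type) :
  hausdorff_space X -> hausdorff_space Y -> tight nu -> tight la -> open E ->
  \int[la]_y nu [set x | E (x, y)] = \int[nu]_x la [set y | E (x, y)].
Proof.
move=> hX hY tnu tla oE; apply/eqP; rewrite eq_le tonelli_open_le//=.
have oE' : open [set z : Y * X | E (z.2, z.1)].
  by apply: open_comp oE => z _; exact: swap_continuous.
exact: (tonelli_open_le hY hX tla tnu oE').
Qed.

(** Dynkin's theorem once more. The iterated integrals over the whole product are equal and finite,
    so those of [S] can be subtracted to reach the complement. *)
Lemma tonelli_set (X Y : ptopologicalType)
    (nu : {finite_measure set (bor X) -> \bar R})
    (la : {finite_measure set (bor Y) -> \bar R}) (E : set (X * Y)%type) :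
  hausdorff_space X -> hausdorff_space Y -> tight nu -> tight la ->
  measurable (E : set (bor (X * Y)%type)) ->
  \int[la]_y nu [set x | E (x, y)] = \int[nu]_x la [set y | E (x, y)].
Proof.
move=> hX hY tnu tla.
pose P (E : set (bor (X * Y)%type)) :=
  \int[la]_y nu [set x | E (x, y)] = \int[nu]_x la [set y | E (x, y)].
have PE (A : set (X * Y)%type) : open A -> P A by exact: tonelli_open.
have PT : P setT by apply: PE; exact: openT.
have fin : \int[la]_(y in setT) nu [set: X] \is a fin_num.
  by rewrite integral_cst// fin_numM// fin_num_measure.
apply: (@dynkin_induction _ (bor (X * Y)%type) open P) => //.
- exact: openI.
- move=> S mS PS.
  have DX : \int[la]_y nu [set x | S (x, y)] +
      \int[la]_y nu [set x | (~` S) (x, y)] = \int[la]_(y in setT) nu [set: X].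
    rewrite -ge0_integralD//; last 2 first.
      exact: measurable_fun_section.
      by apply: measurable_fun_section => //; exact: measurableC.
    apply: eq_integral => y _; rewrite -measureU//.
    + by rewrite -[in RHS](setUv [set x | S (x, y)]).
    + exact: measurable_section.
    + by apply: (@measurable_section _ _ (~` S)); exact: measurableC.
    + by apply/seteqP; split => // x [].
  have DY : \int[nu]_x la [set y | S (x, y)] +
      \int[nu]_x la [set y | (~` S) (x, y)] = \int[nu]_(x in setT) la [set: Y].
    rewrite -ge0_integralD//; last 2 first.
      exact: measurable_fun_section'.
      by apply: measurable_fun_section' => //; exact: measurableC.
    apply: eq_integral => x _; rewrite -measureU//.
    + by rewrite -[in RHS](setUv [set y | S (x, y)]).
    + exact: measurable_section'.
    + by apply: (@measurable_section' _ _ (~` S)); exact: measurableC.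
    + by apply/seteqP; split => // y [].
  have finS : \int[la]_y nu [set x | S (x, y)] \is a fin_num.
    move: fin; rewrite -DX fin_numD => /andP[]//.
  rewrite /P; have finS' : \int[nu]_x la [set y | S (x, y)] \is a fin_num by rewrite -PS.
  have := PT; rewrite /P -DX -DY addeC [in RHS]addeC PS.
  move=> /(congr1 (fun z => z - \int[nu]_x la [set y | S (x, y)])).
  by rewrite !addeK.
move=> F mF tF PF; rewrite /P.
have -> : \int[la]_y nu [set x | (\bigcup_k F k) (x, y)] =
    \int[la]_y \sum_(k <oo) nu [set x | F k (x, y)].
  by apply: eq_integral => y _; exact: section_bigcup.
have -> : \int[nu]_x la [set y | (\bigcup_k F k) (x, y)] =
    \int[nu]_x \sum_(k <oo) la [set y | F k (x, y)].
  apply: eq_integral => x _.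
  pose F' k := [set z : Y * X | F k (z.2, z.1)].
  apply: (@section_bigcup _ _ _ la F').
    by move=> k; exact: measurable_swap.
  apply/trivIsetP => i j _ _ ij; move/trivIsetP : tF => /(_ i j I I ij).
  by move=> /seteqP[FF _]; apply/seteqP; split=> // z /FF.
rewrite !integral_nneseries//.
- by apply: eq_eseriesr => k _; exact: PF.
- by move=> k; exact: measurable_fun_section'.
- by move=> k; exact: measurable_fun_section.
Qed.

End tonelli_open.

Section tonelli_fun.
Context (R : realType).
Local Open Scope ereal_scope.

Lemma ge0_integral_mfrestr d (T : measurableType d)
    (mu : {measure set T -> \bar R}) (D : set T) (mD : measurable D)
    (Doo : mu D < +oo) (f : T -> \bar R) :
  measurable_fun setT f -> (forall x, 0 <= f x) ->
  \int[mfrestr mD Doo]_x f x = \int[mu]_(x in D) f x.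
Proof.
pose P (f : T -> \bar R) := \int[mfrestr mD Doo]_x f x = \int[mu]_(x in D) f x.
apply: (@ge0_measurable_fun_ind _ _ _ P); rewrite /P.
- by rewrite !integral0.
- move=> A c mA c0; rewrite (_ : (fun x => _) = fun x => c%:E * (\1_A x)%:E)//.
  rewrite !ge0_integralZl//; try by [exact/measurable_EFinP/measurable_indic|
    move=> x _; rewrite lee_fin].
  by rewrite !integral_indic// setIT.
- move=> g h mg g0 Pg mh h0 Ph.
  rewrite !ge0_integralD ?Pg ?Ph//; exact: measurable_funTS.
move=> f_ mf f0 ndf Pf; rewrite !monotone_convergence//.
- congr (limn _); apply/funext => n; exact: Pf.
- by move=> n; exact: measurable_funTS.
Qed.

Lemma section_fun_measurable (X Y : ptopologicalType) (F : X * Y -> \bar R) y :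
  measurable_fun setT (F : bor (X * Y)%type -> \bar R) ->
  measurable_fun setT ((fun x => F (x, y)) : bor X -> \bar R).
Proof.
move=> mF; apply: (measurableT_comp mF).
exact: (@continuous_bor X (X * Y)%type (fun x => (x, y)) (@continuous_pairr _ _ y)).
Qed.

Lemma swap_fun_measurable (X Y : ptopologicalType) (F : X * Y -> \bar R) :
  measurable_fun setT (F : bor (X * Y)%type -> \bar R) ->
  measurable_fun setT ((fun z => F (z.2, z.1)) : bor (Y * X)%type -> \bar R).
Proof.
move=> mF; apply: (measurableT_comp mF).
exact: (@continuous_bor (Y * X)%type (X * Y)%type _ (@swap_continuous Y X)).
Qed.

Lemma measurable_fun_integral_finite (X Y : ptopologicalType)
    (nu : {finite_measure set (bor X) -> \bar R}) (F : X * Y -> \bar R) :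
  hausdorff_space X -> tight nu ->
  measurable_fun setT (F : bor (X * Y)%type -> \bar R) -> (forall z, 0 <= F z) ->
  measurable_fun setT ((fun y => \int[nu]_x F (x, y)) : bor Y -> \bar R).
Proof.
move=> hX tnu.
pose P (F : bor (X * Y)%type -> \bar R) :=
  measurable_fun setT ((fun y => \int[nu]_x F (x, y)) : bor Y -> \bar R).
apply: (@ge0_measurable_fun_ind _ _ _ P); rewrite /P.
- by under eq_fun do rewrite integral0; exact: measurable_cst.
- move=> A c mA c0.
  rewrite (_ : (fun y => _) = fun y => c%:E * nu [set x | A (x, y)]).
    by apply: measurable_funeM; exact: measurable_fun_section.
  apply/funext => y; under eq_integral do rewrite EFinM.
  have mAy := measurable_section y mA.
  rewrite ge0_integralZl//.
  + rewrite (_ : (fun x => _) = fun x => (\1_[set x | A (x, y)] x)%:E)//.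
    by rewrite integral_indic// setIT.
  + apply/measurable_EFinP; exact: (@measurable_indic _ _ R setT _ mAy).
- move=> g h mg g0 Pg mh h0 Ph.
  rewrite (_ : (fun y => _) =
    (fun y => \int[nu]_x g (x, y)) \+ (fun y => \int[nu]_x h (x, y))).
    exact: emeasurable_funD.
  apply/funext => y; rewrite ge0_integralD//; exact: section_fun_measurable.
move=> f_ mf f0 ndf Pf.
rewrite (_ : (fun y => _) = fun y => limn (fun n => \int[nu]_x f_ n (x, y))).
  apply: (emeasurable_fun_cvg _ _ Pf) => y _.
  apply: ereal_nondecreasing_is_cvgn => m n mn; apply: ge0_le_integral => //;
    [exact: section_fun_measurable|exact: section_fun_measurable|].
  by move=> x _; exact: ndf.
apply/funext => y; rewrite monotone_convergence//.
by move=> n; exact: section_fun_measurable.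
Qed.

Lemma tonelli_finite (X Y : ptopologicalType)
    (nu : {finite_measure set (bor X) -> \bar R})
    (la : {finite_measure set (bor Y) -> \bar R}) (F : X * Y -> \bar R) :
  hausdorff_space X -> hausdorff_space Y -> tight nu -> tight la ->
  measurable_fun setT (F : bor (X * Y)%type -> \bar R) -> (forall z, 0 <= F z) ->
  \int[la]_y \int[nu]_x F (x, y) = \int[nu]_x \int[la]_y F (x, y).
Proof.
move=> hX hY tnu tla.
have mXY (G : X * Y -> \bar R) : measurable_fun setT (G : bor (X * Y)%type -> \bar R) ->
    (forall z, 0 <= G z) ->
    measurable_fun setT ((fun y => \int[nu]_x G (x, y)) : bor Y -> \bar R).
  exact: measurable_fun_integral_finite.
have mYX (G : X * Y -> \bar R) : measurable_fun setT (G : bor (X * Y)%type -> \bar R) ->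
    (forall z, 0 <= G z) ->
    measurable_fun setT ((fun x => \int[la]_y G (x, y)) : bor X -> \bar R).
  by move=> mG G0; apply: (measurable_fun_integral_finite hY tla (swap_fun_measurable mG)).
pose P (F : bor (X * Y)%type -> \bar R) :=
  \int[la]_y \int[nu]_x F (x, y) = \int[nu]_x \int[la]_y F (x, y).
apply: (@ge0_measurable_fun_ind _ _ _ P); rewrite /P.
- under eq_integral do rewrite integral0.
  by under [RHS]eq_integral do rewrite integral0; rewrite !integral0.
- move=> A c mA c0.
  have -> : \int[la]_y \int[nu]_x (c * \1_A (x, y))%:E =
      c%:E * \int[la]_y nu [set x | A (x, y)].
    rewrite -ge0_integralZl//; last exact: measurable_fun_section.
    apply: eq_integral => y _; under eq_integral do rewrite EFinM.
    have mAy := measurable_section y mA.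
    rewrite ge0_integralZl//.
    + rewrite (_ : (fun x => _) = fun x => (\1_[set x | A (x, y)] x)%:E)//.
      by rewrite integral_indic// setIT.
    + apply/measurable_EFinP; exact: (@measurable_indic _ _ R setT _ mAy).
  have -> : \int[nu]_x \int[la]_y (c * \1_A (x, y))%:E =
      c%:E * \int[nu]_x la [set y | A (x, y)].
    rewrite -ge0_integralZl//; last exact: measurable_fun_section'.
    apply: eq_integral => x _; under eq_integral do rewrite EFinM.
    have mAx := measurable_section' x mA.
    rewrite ge0_integralZl//.
    + rewrite (_ : (fun y => _) = fun y => (\1_[set y | A (x, y)] y)%:E)//.
      by rewrite integral_indic// setIT.
    + apply/measurable_EFinP; exact: (@measurable_indic _ _ R setT _ mAx).
  by rewrite tonelli_set.
- move=> g h mg g0 Pg mh h0 Ph.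
  transitivity (\int[la]_y (\int[nu]_x g (x, y) + \int[nu]_x h (x, y))).
    apply: eq_integral => y _.
    by rewrite ge0_integralD//; exact: section_fun_measurable.
  transitivity (\int[nu]_x (\int[la]_y g (x, y) + \int[la]_y h (x, y))); last first.
    apply: eq_integral => x _; rewrite ge0_integralD//.
    - exact: (section_fun_measurable x (swap_fun_measurable mg)).
    - exact: (section_fun_measurable x (swap_fun_measurable mh)).
  have gX := mXY _ mg g0; have hhX := mXY _ mh h0.
  have gY := mYX _ mg g0; have hhY := mYX _ mh h0.
  rewrite ge0_integralD//; [|by move=> *; exact: integral_ge0..].
  rewrite [RHS]ge0_integralD//; [|by move=> *; exact: integral_ge0..].
  by rewrite Pg Ph.
move=> f_ mf f0 ndf Pf.
transitivity (\int[la]_y limn (fun n => \int[nu]_x f_ n (x, y))).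
  apply: eq_integral => y _; rewrite monotone_convergence//.
  by move=> n; exact: section_fun_measurable.
transitivity (\int[nu]_x limn (fun n => \int[la]_y f_ n (x, y))); last first.
  apply: eq_integral => x _; rewrite monotone_convergence//.
  by move=> n; exact: (section_fun_measurable x (swap_fun_measurable (mf n))).
rewrite !monotone_convergence//.
- congr (limn _); apply/funext => n; exact: Pf.
- by move=> n; exact: mYX.
- by move=> *; exact: integral_ge0.
- move=> x _ m n mn; apply: ge0_le_integral => //.
  + exact: (section_fun_measurable x (swap_fun_measurable (mf m))).
  + exact: (section_fun_measurable x (swap_fun_measurable (mf n))).
  + by move=> y _; exact: ndf.
- by move=> n; exact: mXY.
- by move=> *; exact: integral_ge0.
- move=> y _ m n mn; apply: ge0_le_integral => //; [exact: section_fun_measurable|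
    exact: section_fun_measurable|by move=> x _; exact: ndf].
Qed.

End tonelli_fun.

Section tonelli.
Context (R : realType).
Local Open Scope ereal_scope.

(** Disjointness of the pieces turns an integral over [D] into a series, and finiteness and
    tightness of each piece allow the finite case of Tonelli's theorem to be applied term by
    term. *)
Definition sigma_tight (X : ptopologicalType) (mu : set (bor X) -> \bar R)
    (D : set X) := exists F : (set X)^nat,
  [/\ forall n, measurable (F n : set (bor X)), forall n, mu (F n) < +oo,
      forall n, tight (fun A => mu (A `&` F n)), trivIset setT F &
      D = \bigcup_n F n].

Lemma measurable_fun_integral (X Y : ptopologicalType)
    (mu : {measure set (bor X) -> \bar R}) (D : set X) (F : X * Y -> \bar R) :
  hausdorff_space X -> sigma_tight mu D ->
  measurable_fun setT (F : bor (X * Y)%type -> \bar R) -> (forall z, 0 <= F z) ->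
  measurable_fun setT
    ((fun y => \int[mu]_(x in D) F (x, y)) : bor Y -> \bar R).
Proof.
move=> hX [A [mA Aoo tA trivA ->]] mF F0.
rewrite (_ : (fun y => _) = fun y => \sum_(n <oo)
    \int[mfrestr (mA n) (Aoo n)]_x F (x, y)).
  apply: ge0_emeasurable_sum => [n y _ _|n _]; first exact: integral_ge0.
  exact: (@measurable_fun_integral_finite _ _ _ (mfrestr (mA n) (Aoo n)) _ hX (tA n)).
apply/funext => y; have mFy := section_fun_measurable y mF.
rewrite ge0_integral_bigcup//; last exact: measurable_funTS.
by apply: eq_eseriesr => n _; rewrite ge0_integral_mfrestr.
Qed.

Lemma tonelli (X Y : ptopologicalType)
    (mu : {measure set (bor X) -> \bar R}) (la : {measure set (bor Y) -> \bar R})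
    (D : set X) (E : set Y) (F : X * Y -> \bar R) :
  hausdorff_space X -> hausdorff_space Y ->
  sigma_tight mu D -> sigma_tight la E ->
  measurable_fun setT (F : bor (X * Y)%type -> \bar R) -> (forall z, 0 <= F z) ->
  \int[la]_(y in E) \int[mu]_(x in D) F (x, y) =
  \int[mu]_(x in D) \int[la]_(y in E) F (x, y).
Proof.
move=> hX hY tD tE mF F0; have mF' := swap_fun_measurable mF.
have mG := measurable_fun_integral hX tD mF F0.
have mH := measurable_fun_integral hY tE mF' (fun z => F0 (z.2, z.1)).
move: tD tE mG mH => [A [mA Aoo tA trivA ->]] [B [mB Boo tB trivB ->]] mG mH.
rewrite ge0_integral_bigcup//; last 2 first.
- exact: measurable_funTS.
- by move=> *; exact: integral_ge0.
rewrite [RHS]ge0_integral_bigcup//; last 2 first.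
- exact: measurable_funTS.
- by move=> *; exact: integral_ge0.
pose a m n := \int[mfrestr (mB n) (Boo n)]_y \int[mfrestr (mA m) (Aoo m)]_x F (x, y).
transitivity (\sum_(n <oo) \sum_(m <oo) a m n).
  apply: eq_eseriesr => n _; rewrite -(ge0_integral_mfrestr _ (Boo n))//; last first.
    by move=> *; exact: integral_ge0.
  rewrite /a -integral_nneseries//; last 2 first.
  - move=> m.
    exact: (@measurable_fun_integral_finite _ _ _ (mfrestr (mA m) (Aoo m)) _ hX (tA m)).
  - by move=> *; exact: integral_ge0.
  apply: eq_integral => y _; have mFy := section_fun_measurable y mF.
  rewrite ge0_integral_bigcup//; last exact: measurable_funTS.
  by apply: eq_eseriesr => m _; rewrite ge0_integral_mfrestr.
rewrite nneseries_interchange; last by move=> *; do 2 apply: integral_ge0 => *.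
apply: eq_eseriesr => m _; rewrite -(ge0_integral_mfrestr _ (Aoo m))//; last first.
  by move=> *; exact: integral_ge0.
transitivity (\int[mfrestr (mA m) (Aoo m)]_x \sum_(n <oo)
    \int[mfrestr (mB n) (Boo n)]_y F (x, y)).
  rewrite integral_nneseries//; last 2 first.
  - move=> n.
    exact: (@measurable_fun_integral_finite _ _ _ (mfrestr (mB n) (Boo n)) _ hY (tB n) mF').
  - by move=> *; exact: integral_ge0.
  by apply: eq_eseriesr => n _; exact: (@tonelli_finite _ _ _ (mfrestr (mA m) (Aoo m))
    (mfrestr (mB n) (Boo n)) _ hX hY (tA m) (tB n)).
apply: eq_integral => x _; have mFx := section_fun_measurable x mF'.
rewrite ge0_integral_bigcup//; last exact: measurable_funTS.
by apply: eq_eseriesr => n _; rewrite ge0_integral_mfrestr.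
Qed.

End tonelli.

(** * Open sigma-compact subgroups and Haar measure *)

Section topological_group.
Context (G : topGroupType).
Implicit Types (A B K U : set G) (x y : G).

Definition setmulg A B : set G := [set (a * b)%g | a in A & b in B].
Definition setinvg A : set G := [set (a^-1)%g | a in A].

Lemma cvg_mulg (T : Type) (F : set_system T) (f g : T -> G) (a b : G) :
  Filter F -> f @ F --> a -> g @ F --> b ->
  (fun t => (f t * g t)%g) @ F --> (a * b)%g.
Proof.
move=> FF fa gb.
exact: (cvg_comp (fun t => (f t, g t)) (fun p : G * G => (p.1 * p.2)%g)
  (cvg_pair fa gb) (@mulg_continuous G (a, b))).
Qed.

Lemma mulgl_continuous x : continuous (fun y => (x * y)%g).
Proof. by move=> y; apply: cvg_mulg; [exact: cvg_cst|exact: cvg_id]. Qed.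

Lemma mulgr_continuous x : continuous (fun y => (y * x)%g).
Proof. by move=> y; apply: cvg_mulg; [exact: cvg_id|exact: cvg_cst]. Qed.

Lemma compact_setmulg A B : compact A -> compact B -> compact (setmulg A B).
Proof.
move=> cA cB; have -> : setmulg A B = (fun p : G * G => (p.1 * p.2)%g) @` (A `*` B).
  apply/seteqP; split=> [_ [a Aa [b Bb <-]]|_ [[a b] [/= Aa Bb] <-]].
    by exists (a, b).
  by exists a => //; exists b.
apply: continuous_compact; last exact: compact_setX.
by apply: continuous_subspaceT; exact: mulg_continuous.
Qed.

Lemma compact_setinvg A : compact A -> compact (setinvg A).
Proof.
move=> cA; apply: continuous_compact => //.
by apply: continuous_subspaceT; exact: invg_continuous.
Qed.

Lemma open_mulgl x U : open U -> open ((fun y => (x * y)%g) @^-1` U).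
Proof. by move=> oU; apply: open_comp => // y _; exact: mulgl_continuous. Qed.

Lemma open_mulgr x U : open U -> open ((fun y => (y * x)%g) @^-1` U).
Proof. by move=> oU; apply: open_comp => // y _; exact: mulgr_continuous. Qed.

Definition sigma_subgroup (H : set G) :=
  [/\ open H, H 1%g, forall x y, H x -> H y -> H (x * y)%g,
      forall x, H x -> H x^-1%g &
      exists2 K : (set G)^nat, forall n, compact (K n) & H = \bigcup_n K n].

(* The freedom in E is used twice: to absorb prescribed compact sets, and to
   make K n.+1 contain a point chosen far away from K n. *)
Lemma compact_chain (E : nat -> set G -> set G) (C : set G) :
  locally_compact [set: G] ->
  (forall n K, compact K -> compact (E n K)) -> compact C ->
  exists K : nat -> set G, [/\ forall n, compact (K n), nbhs 1%g (K 0%N) /\ C `<=` K 0%N,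
    forall n x, K n x -> K n x^-1%g, forall n, E n (K n) `<=` K n.+1 &
    forall n, setmulg (K n) (K n) `<=` K n.+1].
Proof.
move=> lG cE cC.
have [U0 U1 cU0] : exists2 U0 : set G, nbhs 1%g U0 & compact U0.
  have [U + [cU _]] := lG 1%g I => nU.
  by exists U => //; have : nbhs 1%g (fun t => [set: G] t -> U t) := nU; apply: filterS => t; exact.
pose sym (A : set G) := A `|` setinvg A.
have csym A : compact A -> compact (sym A).
  by move=> cA; apply: compactU => //; exact: compact_setinvg.
have symV A x : sym A x -> sym A x^-1%g.
  by move=> [Ax|[y Ay <-]]; [right; exists x|left; rewrite invgK].
(* Each new term is the square of a symmetric set containing 1. The inverse of [a * b] is
   [b^-1 * a^-1], so the square is symmetric, and the factor 1 keeps the old points. *)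
pose K := fix K n := if n is m.+1 then
  let M := sym (K m `|` E m (K m)) in setmulg M M else sym (C `|` U0).
exists K; split.
- elim=> [|n IH] /=; first by apply/csym/compactU.
  by apply: compact_setmulg; apply/csym/compactU => //; exact: cE.
- split; last by move=> x Cx; left; left.
  by apply: filterS U1 => x Ux; left; right.
- case=> [|n] x /=; first exact: symV.
  move=> [a Ma [b Mb <-]]; rewrite invgM; exists b^-1%g; first exact: symV.
  by exists a^-1%g => //; exact: symV.
- move=> n x Ex /=; exists x; first by left; right.
  exists 1%g; last by rewrite mulg1.
  have K1 : K n 1%g.
    elim: n {x Ex} => [|n IH] /=; first by left; right; exact: nbhs_singleton.
    by exists 1%g; [left; left|exists 1%g; [left; left|rewrite mulg1]].
  by left; left.
- move=> n _ [a Ka [b Kb <-]] /=; exists a; first by left; left.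
  by exists b => //; left; left.
Qed.

(** For [x] in [K n], the translate of [K 0] by [x] is a neighbourhood of [x] contained in the
    square of [K n], hence in [K n.+1]. This gives the interiors and the openness of the union. *)
Lemma chain_subgroup (K : nat -> set G) :
  (forall n, compact (K n)) -> nbhs 1%g (K 0%N) ->
  (forall n x, K n x -> K n x^-1%g) ->
  (forall n, setmulg (K n) (K n) `<=` K n.+1) ->
  [/\ sigma_subgroup (\bigcup_n K n), forall m n, (m <= n)%N -> K m `<=` K n &
      forall n, K n `<=` (K n.+1)°].
Proof.
move=> cK nK KV KM.
have K1 n : K n 1%g.
  elim: n => [|n IH]; first exact: nbhs_singleton.
  by apply: KM; exists 1%g => //; exists 1%g => //; rewrite mulg1.
have KS n : K n `<=` K n.+1.
  by move=> x Kx; apply: KM; exists x => //; exists 1%g => //; rewrite mulg1.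
have Kle m n : (m <= n)%N -> K m `<=` K n.
  by move=> /subnK <-; elim: (n - m)%N => [//|k IH] x /IH/KS.
have Kint n : K n `<=` (K n.+1)°.
  move=> x Kx; have : nbhs x ((fun y => (x^-1 * y)%g) @^-1` K 0%N).
    by apply: (@mulgl_continuous x^-1%g x); rewrite mulVg.
  apply: filterS => y /= Ky; apply: KM; exists x => //; exists (x^-1 * y)%g.
    by apply: Kle Ky.
  by rewrite mulgA mulgV mul1g.
split => //; split.
- rewrite openE => x [n _ Kx]; apply: filterS (Kint n x Kx) => y Ky.
  by exists n.+1.
- by exists 0%N.
- move=> x y [n _ Kx] [m _ Ky]; exists (maxn n m).+1 => //; apply: KM.
  exists x; first by apply: Kle Kx; exact: leq_maxl.
  by exists y => //; apply: Kle Ky; exact: leq_maxr.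
- by move=> x [n _ Kx]; exists n => //; exact: KV.
- by exists K.
Qed.

Lemma sigma_subgroup_gen (C : (set G)^nat) : locally_compact [set: G] ->
  (forall n, compact (C n)) ->
  exists2 H, sigma_subgroup H & forall n, C n `<=` H.
Proof.
move=> lG cC.
have [K [cK [nK _] KV KE KM]] := compact_chain lG (fun n _ _ => cC n) (@compact0 G).
have [HK _ _] := chain_subgroup cK nK KV KM.
by exists (\bigcup_n K n) => // n x Cx; exists n.+1 => //; exact: KE.
Qed.

Lemma exists_open_precompact : locally_compact [set: G] ->
  exists B, [/\ open B, B !=set0 & exists2 K, compact K & B `<=` K].
Proof.
move=> lG.
have [K [cK [nK _] _ _ _]] := compact_chain lG (fun n K (cK : compact K) => cK) (@compact0 G).
exists (K 0%N)°; split; [exact: open_interior|by exists 1%g|].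
by exists (K 0%N) => //; exact: interior_subset.
Qed.

Lemma sigma_subgroup_mull (H : set G) x y : sigma_subgroup H -> H x ->
  H (x * y)%g <-> H y.
Proof.
move=> [_ _ HM HV _] Hx; split=> [Hxy|]; last exact: HM.
by rewrite -[y](mulKg x); apply: HM => //; exact: HV.
Qed.

Lemma sigma_subgroup_mulr (H : set G) x y : sigma_subgroup H -> H x ->
  H (y * x)%g <-> H y.
Proof.
move=> [_ _ HM HV _] Hx; split=> [Hxy|Hy]; last exact: HM.
by rewrite -[y](mulgK x); apply: HM => //; exact: HV.
Qed.

Lemma sigma_subgroup_inv (H : set G) x : sigma_subgroup H -> H x^-1%g <-> H x.
Proof.
by move=> [_ _ _ HV _]; split=> [|]; [rewrite -{2}[x]invgK|]; exact: HV.
Qed.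

Lemma sigma_subgroup_closed (H : set G) : sigma_subgroup H -> closed H.
Proof.
move=> sH; have [oH H1 _ _ _] := sH.
rewrite -[H]setCK closedC openE => x nHx.
have : nbhs x ((fun y => (x^-1 * y)%g) @^-1` H).
  apply: (@mulgl_continuous x^-1%g x); rewrite mulVg; exact: open_nbhs_nbhs.
apply: filterS => y /= Hxy Hy; apply: nHx.
have := (sigma_subgroup_mulr x^-1%g sH Hy).1 Hxy.
by move/(sigma_subgroup_inv x sH).
Qed.

End topological_group.

Section haar.
Local Open Scope ereal_scope.
Context (R : realType) (G : topGroupType) (mu : {measure set (borel G) -> \bar R}).
Hypothesis hG : hausdorff_space G.
Hypothesis lG : locally_compact [set: G].
Hypothesis haar : left_haar mu.
Implicit Types (A B K U H : set G) (x y : G).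

Let hG' : hausdorff_space (pointed_group G).
Proof. exact: hG. Qed.

Lemma haar_compact K : compact K -> mu K < +oo.
Proof. by have [_ + _ _ _] := haar; exact. Qed.

Lemma haar_mull x A : measurable (A : set (borel G)) ->
  mu ((fun y => (x * y)%g) @^-1` A) = mu A.
Proof.
move=> mA; have [_ _ _ _ /(_ x^-1%g _ mA) <-] := haar; congr (mu _).
apply/seteqP; split=> [y /= Ay|_ [y Ay <-]] /=.
  by exists (x * y)%g => //; rewrite mulKg.
by rewrite mulgA mulgV mul1g.
Qed.

Lemma measurable_mull x :
  measurable_fun setT ((fun y => (x * y)%g) : borel G -> borel G).
Proof. exact: (@continuous_bor (pointed_group G) (pointed_group G) _ (@mulgl_continuous G x)). Qed.

Lemma measurable_mulr x :
  measurable_fun setT ((fun y => (y * x)%g) : borel G -> borel G).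
Proof. exact: (@continuous_bor (pointed_group G) (pointed_group G) _ (@mulgr_continuous G x)). Qed.

Lemma haar_integral_mull x (f : G -> \bar R) :
  measurable_fun setT (f : borel G -> \bar R) -> (forall y, 0 <= f y) ->
  \int[mu]_y f (x * y)%g = \int[mu]_y f y.
Proof.
move=> mf f0.
have mx := measurable_mull x.
have := @ge0_integral_pushforward _ _ (borel G) (borel G) _ _ mx mu setT f.
rewrite preimage_setT => <-//.
apply: eq_measure_integral => A mA _; exact: (haar_mull x mA).
Qed.

(** If [U] were null, finitely many left translates of it would cover any given compact set, so
    every compact set would be null; inner regularity of the open set [setT] would then make [mu]
    zero. *)
Lemma haar_open_gt0 U : open U -> U !=set0 -> 0 < mu U.
Proof.
move=> oU [u Uu]; rewrite lt0e measure_ge0 andbT; apply/eqP => U0.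
have [+ _ _ innr _] := haar; move=> /eqP; apply.
apply/eqP; rewrite eq_le measure_ge0 andbT (innr _ openT).
apply: ge_ereal_sup => _ [K [cK _] <-].
have mK := compact_bor hG' cK.
suff : mu.-negligible (K `&` setT).
  by rewrite setIT => /negligibleP => /(_ mK) ->.
apply: (compact_null (X := pointed_group G)) => // y Ky.
exists ((fun z => (u * y^-1 * z)%g) @^-1` U); split.
- exact: open_mulgl.
- by rewrite /= -mulgA mulVg mulg1.
- by rewrite setIT haar_mull//; exact: open_bor.
Qed.

(** Inner regularity is given for open sets only, and [U] may have infinite measure. An open [V] of
    finite measure around [A] replaces [U] by its intersection with [V]; a compact subset loses at
    most [e] of that measure, and no more after intersecting with [A]. *)
Lemma haar_tight A : measurable (A : set (borel G)) -> mu A < +oo ->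
  tight (X := pointed_group G) (fun B => mu (B `&` A)).
Proof.
move=> mA Aoo U a oU aU; have [_ _ outr innr _] := haar.
have finS (B : set (borel G)) : measurable B -> mu (B `&` A) \is a fin_num.
  move=> mB; rewrite ge0_fin_numE//; apply: le_lt_trans Aoo; apply: measureS => //.
  exact: measurableI.
have mU := open_bor (oU : open (U : set (pointed_group G))).
have Afin : mu A \is a fin_num by rewrite ge0_fin_numE.
pose e := ((fine (mu (U `&` A)) - a) / 2)%R.
have e0 : (0 < e)%R.
  by rewrite divr_gt0// subr_gt0 -lte_fin fineK ?finS.
have [V [oV AV Ve]] : exists V, [/\ open V, A `<=` V & mu V < mu A + e%:E].
  have := @lb_ereal_inf_adherent _ [set mu U | U in [set U : set G | open U /\ A `<=` U]] _ e0.
  rewrite -outr// => /(_ Afin)[_ [V [oV AV] <-]] ?.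
  by exists V.
have mV := open_bor (oV : open (V : set (pointed_group G))).
have Voo : mu V < +oo.
  by apply: (lt_le_trans Ve); rewrite leey.
have mUV : measurable (U `&` V : set (borel G)) by exact: measurableI.
have UVfin : mu (U `&` V) \is a fin_num.
  rewrite ge0_fin_numE//; apply: le_lt_trans Voo; exact: measureS.
have [K [cK KUV Ke]] : exists K, [/\ compact K, K `<=` U `&` V &
    mu (U `&` V) - e%:E < mu K].
  have := @ub_ereal_sup_adherent _ [set mu K |
          K in [set K : set G | compact K /\ K `<=` U `&` V]] _ e0.
  rewrite -innr; last exact: openI.
  by move=> /(_ UVfin)[_ [K [cK KV] <-]] ?; exists K.
have mK := compact_bor hG' cK.
have Kfin : mu K \is a fin_num by rewrite ge0_fin_numE ?haar_compact.
exists K; split => //; first by move=> z /KUV[].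
have mUA := measurableI _ _ mU mA.
have mKA := measurableI _ _ mK mA.
have UA : mu (U `&` A) <= mu (K `&` A) + mu ((U `&` V) `\` K).
  rewrite -measureU//.
  - apply: measureS => //; first by apply: measurableU => //; exact: measurableD.
    move=> z [Uz Az]; have [Kz|nKz] := pselect (K z); first by left.
    by right; split => //; split => //; exact: AV.
  - exact: measurableD.
  - by apply/seteqP; split => // z [[Kz _] [_]].
have UVK : mu ((U `&` V) `\` K) <= e%:E.
  rewrite measureD//; last by rewrite -ge0_fin_numE.
  rewrite (_ : (U `&` V) `&` K = K); last first.
    by apply/seteqP; split=> [z []//|z Kz]; split => //; exact: KUV.
  by rewrite leeBlDr// addeC -leeBlDr// ltW.
have : mu (U `&` A) <= mu (K `&` A) + e%:E.
  by apply: (le_trans UA); rewrite leeD2l.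
rewrite -[mu (U `&` A)]fineK ?finS// -[mu (K `&` A)]fineK ?finS//.
rewrite -EFinD lee_fin lte_fin; move: e0; rewrite /e; lra.
Qed.

Lemma sigma_tight_sub (E : (set G)^nat) :
  (forall n, measurable (E n : set (borel G))) -> (forall n, mu (E n) < +oo) ->
  sigma_tight (X := pointed_group G) mu (\bigcup_n E n).
Proof.
move=> mE Eoo; have mD n : measurable (seqDU E n : set (borel G)).
  by apply: measurableD => //; exact: bigsetU_measurable.
have Doo n : mu (seqDU E n) < +oo.
  by apply: le_lt_trans (Eoo n); apply: measureS => //; exact: subDsetl.
exists (seqDU E); split => //; last by rewrite seqDU_bigcup_eq.
by move=> n; exact: haar_tight.
Qed.

Lemma sigma_tight_subgroup H : sigma_subgroup H ->
  sigma_tight (X := pointed_group G) mu H.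
Proof.
move=> [_ _ _ _ [K cK ->]]; apply: sigma_tight_sub => n.
  exact: (compact_bor hG').
exact: haar_compact.
Qed.

(* Approximating E n from outside by V n and V n from inside by compact sets, the
   open set V n `\` H is null, hence empty because nonempty open sets have
   positive measure. *)
Lemma sigma_subgroup_cover (E : (set G)^nat) :
  (forall n, measurable (E n : set (borel G))) -> (forall n, mu (E n) < +oo) ->
  exists2 H, sigma_subgroup H & forall n, E n `<=` H.
Proof.
move=> mE Eoo; have [_ _ outr innr _] := haar.
have /choice[V HV] : forall n, exists V, [/\ open V, E n `<=` V & mu V < +oo].
  move=> n; have := @lb_ereal_inf_adherent _
    [set mu U | U in [set U : set G | open U /\ E n `<=` U]] _ (@ltr01 R).
  rewrite -outr// ge0_fin_numE// => /(_ (Eoo n))[_ [V [oV AV] <-]] Vlt.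
  by exists V; split => //; apply: (lt_le_trans Vlt); rewrite leey.
have /choice[K HK] : forall p : nat * nat, exists K : set G, [/\ compact K,
    K `<=` V p.1 & mu (V p.1) - (p.2.+1%:R^-1)%:E < mu K].
  move=> [n k] /=; have [oV _ Voo] := HV n.
  have p0 : (0 < k.+1%:R^-1 :> R)%R by [].
  have := @ub_ereal_sup_adherent _ [set mu K |
          K in [set K : set G | compact K /\ K `<=` V n]] _ p0.
  by rewrite -innr// ge0_fin_numE// => /(_ Voo)[_ [K [cK KV] <-]] ?; exists K.
(* The pairs [(n, k)] are enumerated through [pickle]; a number that codes no pair yields
   [K (0, 0)], which is compact as well. *)
have [H sH KH] := @sigma_subgroup_gen G
  (fun n => K (odflt (0, 0)%N (@choice.unpickle (nat * nat)%type n))) lG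
  (fun n => let: And3 a _ _ := HK _ in a).
exists H => // n x Ex; apply: contrapT => nHx.
have [oV EV Voo] := HV n.
have : 0 < mu (V n `&` ~` H).
  apply: haar_open_gt0; last by exists x; split => //; exact: EV.
  by apply: openI => //; apply: closed_openC; exact: sigma_subgroup_closed.
apply/negP; rewrite -leNgt; apply/lee_addgt0Pr => e e0.
have [k ke] : exists k : nat, (k.+1%:R^-1 < e)%R.
  exists (Num.truncn e^-1); rewrite invf_plt ?posrE//; exact: truncnS_gt.
have [cK KV Kk] := HK (n, k).
have mK := compact_bor hG' cK.
have mV := open_bor (oV : open (V n : set (pointed_group G))).
have Kfin : mu (K (n, k)) \is a fin_num by rewrite ge0_fin_numE ?haar_compact.
rewrite add0e; apply: (@le_trans _ _ (mu (V n `\` K (n, k)))).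
  apply: measureS; [|exact: measurableD|].
    apply: measurableI => //; apply: measurableC; apply: open_bor.
    by have [] := sH.
  move=> y [Vy nHy]; split => // Ky; apply: nHy.
  by have := KH (choice.pickle (n, k)); rewrite choice.pickleK; apply.
rewrite measureD// (_ : V n `&` K (n, k) = K (n, k)); last first.
  by apply/seteqP; split=> [z []//|z Kz]; split => //; exact: KV.
rewrite leeBlDr// addeC -leeBlDr//.
by apply: le_trans (ltW Kk); apply: leeB => //; rewrite lee_fin ltW.
Qed.

End haar.

(** * Uniqueness of Haar measure and the modular function *)

Section left_invariant_ratio.
Local Open Scope ereal_scope.
Context (R : realType) (G : topGroupType).
Hypothesis hG : hausdorff_space G.
Implicit Types (A B K U H : set G) (x y : G).

Let hG' : hausdorff_space (pointed_group G).
Proof. exact: hG. Qed.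

Definition left_invariant (la : set (borel G) -> \bar R) :=
  forall x (A : set (borel G)), measurable A ->
  la ((fun y => (x * y)%g) @^-1` A) = la A.

Lemma left_invariant_integral (la : {measure set (borel G) -> \bar R}) x H
    (f : G -> \bar R) :
  left_invariant la -> sigma_subgroup H -> H x ->
  measurable_fun setT (f : borel G -> \bar R) -> (forall y, 0 <= f y) ->
  \int[la]_(y in H) f (x * y)%g = \int[la]_(y in H) f y.
Proof.
move=> lla sH Hx mf f0.
have mH : measurable (H : set (borel G)).
  by apply: (open_bor (X := pointed_group G)); have [] := sH.
have mx := measurable_mull x.
have := @ge0_integral_pushforward _ _ (borel G) (borel G) _ _ mx la H f mH (measurable_funTS mf).
rewrite (_ : _ @^-1` H = H); last first.
  by apply/seteqP; split=> y /(sigma_subgroup_mull y sH Hx).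
move=> <-//.
apply: eq_measure_integral => A mA _; exact: lla.
Qed.

Lemma measurable_mulg :
  measurable_fun setT ((fun p => (p.1 * p.2)%g) :
    bor (pointed_group G * pointed_group G)%type -> borel G).
Proof.
exact: (@continuous_bor (pointed_group G * pointed_group G)%type (pointed_group G)
  _ (@mulg_continuous G)).
Qed.

Lemma measurable_mulVg :
  measurable_fun setT ((fun p => (p.1^-1 * p.2)%g) :
    bor (pointed_group G * pointed_group G)%type -> borel G).
Proof.
apply: (@continuous_bor (pointed_group G * pointed_group G)%type (pointed_group G)) => p.
apply: cvg_mulg.
  apply: (cvg_comp fst); [exact: cvg_fst|exact: (@invg_continuous G p.1)].
exact: cvg_snd.
Qed.

Lemma measurable_invg : measurable_fun setT ((fun y => y^-1%g) : borel G -> borel G).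
Proof.
exact: (@continuous_bor (pointed_group G) (pointed_group G) _ (@invg_continuous G)).
Qed.

Lemma measurable_bor_fst : measurable_fun setT
  (fst : bor (pointed_group G * pointed_group G)%type -> borel G).
Proof.
exact: (@continuous_bor (pointed_group G * pointed_group G)%type (pointed_group G)
  fst (fun p => @cvg_fst _ _ (nbhs p.1) (nbhs p.2) _)).
Qed.

Lemma measurable_bor_snd : measurable_fun setT
  (snd : bor (pointed_group G * pointed_group G)%type -> borel G).
Proof.
exact: (@continuous_bor (pointed_group G * pointed_group G)%type (pointed_group G)
  snd (fun p => @cvg_snd _ _ (nbhs p.1) (nbhs p.2) _)).
Qed.

(** The inverse of 0 is 0 by convention, which makes inversion discontinuous there; that point is
    treated apart. *)
Lemma measurable_inv : measurable_fun setT (@GRing.inv R).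
Proof.
rewrite -(setUv [set (0%R : R)]); apply/measurable_funU => //; first exact: measurableC.
split; first exact: measurable_fun_set1.
apply: open_continuous_measurable_fun; first exact/closed_openC/closed_eq.
by move=> x /set_mem /= /eqP x0; exact: inv_continuous.
Qed.

Let G2 := (pointed_group G * pointed_group G)%type.

(* The right-hand factor of la A does not depend on la: this is Weil's proof of
   the uniqueness of Haar measure. *)
Lemma left_invariant_ratio (nu la : {measure set (borel G) -> \bar R}) (A B H : set G) :
  left_invariant nu -> left_invariant la -> sigma_subgroup H ->
  sigma_tight (X := pointed_group G) nu H ->
  sigma_tight (X := pointed_group G) la H ->
  measurable (A : set (borel G)) -> measurable (B : set (borel G)) ->
  A `<=` H -> B `<=` H ->
  (forall y, H y -> 0 < nu [set z | A (z * y)%g] < +oo) ->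
  let g y := fine (\int[nu]_(z in H) (\1_A (z * y)%g)%:E) in
  la B = la A * \int[nu]_(z in H) ((\1_B z^-1%g) / g z^-1%g)%:E.
Proof.
move=> lnu lla sH tnu tla mA mB AH BH g0 g.
have mH : measurable (H : set (borel G)).
  by apply: (open_bor (X := pointed_group G)); have [] := sH.
have gge0 y : (0 <= g y)%R.
  by apply/fine_ge0/integral_ge0 => z _; rewrite lee_fin.
have iA : measurable_fun setT (\1_A : borel G -> R) by exact: measurable_indic.
have iB : measurable_fun setT (\1_B : borel G -> R) by exact: measurable_indic.
have mulm := measurable_mulg.
have mdiv := measurable_mulVg.
have mg : measurable_fun setT (g : borel G -> R).
  apply: (measurableT_comp (@fine_measurable R setT measurableT)) => //.
  apply: (measurable_fun_integral hG' tnu (F := fun p : G2 => (\1_A (p.1 * p.2)%g)%:E)) => //.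
  by apply/measurable_EFinP; exact: (measurableT_comp iA mulm).
(* For [y] in [H] the integral over [z] of [\1_A (z * y) * w y] is 1. Inserting this 1 under the
   integral of [\1_B] gives [I1]. *)
pose w y := ((g y)^-1)%R.
have mw : measurable_fun setT (w : borel G -> R) by exact: (measurableT_comp measurable_inv).
have w0 y : (0 <= w y)%R by rewrite invr_ge0.
have nuAH' y : H y -> \int[nu]_(z in H) (\1_A (z * y)%g)%:E = nu [set z | A (z * y)%g].
  move=> Hy; have mAy : measurable ([set z | A (z * y)%g] : set (borel G)).
    by have := measurable_mulr y measurableT mA; rewrite setTI.
  rewrite (_ : (fun z => _) = fun z => (\1_[set z | A (z * y)%g] z)%:E)//.
  rewrite integral_indic//; congr (nu _); apply/seteqP; split=> [z []//|z Az].
  by split => //; apply/(sigma_subgroup_mulr z sH Hy); exact: AH.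
have nuAH y : H y -> \int[nu]_(z in H) (\1_A (z * y)%g)%:E = (g y)%:E.
  move=> Hy; rewrite /g nuAH'//; have /andP[p1 p2] := g0 _ Hy.
  by rewrite fineK// ge0_fin_numE//; exact: ltW.
have nuA y : H y -> nu [set z | A (z * y)%g] = (g y)%:E.
  by move=> Hy; rewrite -nuAH'// nuAH.
have mBw : measurable_fun setT ((fun z => (\1_B z^-1%g * w z^-1%g)%:E) :
    borel G -> \bar R).
  apply/measurable_EFinP; apply: measurable_funM.
    exact: (measurableT_comp iB measurable_invg).
  exact: (measurableT_comp mw measurable_invg).
have I1 : la B = \int[la]_(y in H) \int[nu]_(z in H)
    (\1_B y * \1_A (z * y)%g * w y)%:E.
  have -> : la B = \int[la]_(y in H) (\1_B y)%:E by rewrite integral_indic// setIidl.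
  apply: eq_integral => y /set_mem Hy.
  rewrite (_ : (fun z => _) = fun z => (\1_B y * w y)%:E * (\1_A (z * y)%g)%:E); last first.
    by apply/funext => z; rewrite -EFinM mulrAC.
  have mAy : measurable ([set z | A (z * y)%g] : set (borel G)).
    by have := measurable_mulr y measurableT mA; rewrite setTI.
  have mAy' : measurable_fun (H : set (borel G))
      ((fun z => (\1_A (z * y)%g)%:E) : borel G -> \bar R).
    apply/measurable_EFinP.
    exact: (measurable_funTS (@measurable_indic _ (borel G) R setT _ mAy)).
  rewrite ge0_integralZl//; last by rewrite lee_fin mulr_ge0.
  rewrite nuAH// -EFinM -mulrA mulVf ?mulr1//.
  by rewrite gt_eqF// -lte_fin -nuA//; case/andP: (g0 _ Hy).
rewrite I1 (tonelli hG' hG' tnu tla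
    (F := fun p : G2 => (\1_B p.2 * \1_A (p.1 * p.2)%g * w p.2)%:E))//; last 2 first.
- apply/measurable_EFinP; apply: measurable_funM; first apply: measurable_funM.
  + exact: (measurableT_comp iB measurable_bor_snd).
  + exact: (measurableT_comp iA mulm).
  + exact: (measurableT_comp mw measurable_bor_snd).
- by move=> p; rewrite lee_fin !mulr_ge0.
have mF2 : measurable_fun setT ((fun p : G2 =>
    (\1_B (p.1^-1 * p.2)%g * \1_A p.2 * w (p.1^-1 * p.2)%g)%:E) : bor G2 -> \bar R).
  apply/measurable_EFinP; apply: measurable_funM; first apply: measurable_funM.
  + exact: (measurableT_comp iB mdiv).
  + exact: (measurableT_comp iA measurable_bor_snd).
  + exact: (measurableT_comp mw mdiv).
(* Left invariance of [la] replaces [y] by [z^-1 * y], so that [A] is tested at [y] alone. *)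
transitivity (\int[nu]_(z in H) \int[la]_(y in H)
    (\1_B (z^-1 * y)%g * \1_A y * w (z^-1 * y)%g)%:E).
  apply: eq_integral => z /set_mem Hz.
  rewrite -(left_invariant_integral lla sH Hz) /=.
  - by apply: eq_integral => y _; rewrite mulKg.
  - exact: (section_fun_measurable z (swap_fun_measurable mF2)).
  - by move=> y; rewrite lee_fin !mulr_ge0.
transitivity (\int[la]_(y in H) \int[nu]_(z in H)
    (\1_B (z^-1 * y)%g * \1_A y * w (z^-1 * y)%g)%:E).
  apply/esym/(tonelli hG' hG' tnu tla mF2) => p.
  by rewrite lee_fin !mulr_ge0.
have -> : la A = \int[la]_(y in H) (\1_A y)%:E by rewrite integral_indic// setIidl.
rewrite muleC.
(* Left invariance of [nu] replaces [z] by [y * z]. Since [(y * z)^-1 * y] is [z^-1], the inner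
   integral no longer depends on [y] and factors out. *)
transitivity (\int[la]_(y in H) ((\int[nu]_(z in H)
   (\1_B z^-1%g * w z^-1%g)%:E) * (\1_A y)%:E)).
  apply: eq_integral => y /set_mem Hy.
  rewrite -(left_invariant_integral lnu sH Hy) /=.
  - rewrite -ge0_integralZr//.
    + by apply: eq_integral => z _; rewrite invgM -mulgA mulVg mulg1 -EFinM mulrAC.
    + exact: (measurable_funTS mBw).
    + by move=> z _; rewrite lee_fin mulr_ge0.
  - exact: (section_fun_measurable y mF2).
  - by move=> z; rewrite lee_fin !mulr_ge0.
rewrite ge0_integralZl//.
- by apply: measurable_funTS; exact/measurable_EFinP.
- by apply: integral_ge0 => *; rewrite lee_fin mulr_ge0.
Qed.

End left_invariant_ratio.

Section modular.
Local Open Scope ereal_scope.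
Context (R : realType) (G : topGroupType) (mu : {measure set (borel G) -> \bar R}).
Hypothesis hG : hausdorff_space G.
Hypothesis lG : locally_compact [set: G].
Hypothesis haar : left_haar mu.
Implicit Types (A B K U H : set G) (x y : G).

Let hG' : hausdorff_space (pointed_group G).
Proof. exact: hG. Qed.

Lemma left_invariant_haar : left_invariant mu.
Proof. by move=> x A mA; exact: haar_mull. Qed.

Lemma measurable_preimage_mulr x (A : set (borel G)) : measurable A ->
  measurable ((fun y => (y * x)%g) @^-1` A : set (borel G)).
Proof. by move=> mA; have := measurable_mulr x measurableT mA; rewrite setTI. Qed.

Lemma measurable_preimage_mull x (A : set (borel G)) : measurable A ->
  measurable ((fun y => (x * y)%g) @^-1` A : set (borel G)).
Proof. by move=> mA; have := measurable_mull x measurableT mA; rewrite setTI. Qed.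

Lemma left_invariant_pushforward x :
  left_invariant (pushforward mu (fun y => (y * x)%g : borel G)).
Proof.
move=> y A mA; rewrite /pushforward -[RHS](left_invariant_haar y); last first.
  exact: measurable_preimage_mulr.
by congr (mu _); apply/seteqP; split=> z /=; rewrite mulgA.
Qed.

Lemma compact_preimage_mulr x K : compact K ->
  compact ((fun y => (y * x)%g) @^-1` K).
Proof.
move=> cK; have -> : (fun y => (y * x)%g) @^-1` K = (fun y => (y * x^-1)%g) @` K.
  apply/seteqP; split=> [y /= Ky|_ [y Ky <-]] /=; last by rewrite mulgVK.
  by exists (y * x)%g => //; rewrite mulgK.
apply: continuous_compact => //; apply: continuous_subspaceT.
exact: mulgr_continuous.
Qed.

(** The point [x] may lie outside [H], so tightness cannot be read off from an invariance of [H].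
    Each compact piece of [H] is pulled back by [x], [haar_tight] is applied there, and the compact
    set obtained is translated back. *)
Lemma sigma_tight_pushforward x H : sigma_subgroup H ->
  sigma_tight (X := pointed_group G) (pushforward mu (fun y => (y * x)%g : borel G)) H.
Proof.
move=> [_ _ _ _ [K cK ->]].
have mK n : measurable (seqDU K n : set (borel G)).
  apply: measurableD; first exact: (compact_bor hG').
  by apply: bigsetU_measurable => i _; exact: (compact_bor hG').
exists (seqDU K); split => //; last by rewrite seqDU_bigcup_eq.
- move=> n; rewrite /pushforward.
  apply: (@le_lt_trans _ _ (mu ((fun y => (y * x)%g) @^-1` K n))); last first.
    by apply: haar_compact => //; exact: compact_preimage_mulr.
  apply: measureS; first exact: measurable_preimage_mulr.
  + by apply: measurable_preimage_mulr; exact: (compact_bor hG').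
  + by move=> y [].
- move=> n U a oU; rewrite /pushforward preimage_setI => aU.
  have := @haar_tight _ _ mu hG haar ((fun y => (y * x)%g) @^-1` seqDU K n) _ _ _ a _ aU.
  case.
  + exact: measurable_preimage_mulr.
  + apply: (@le_lt_trans _ _ (mu ((fun y => (y * x)%g) @^-1` K n))); last first.
    by apply: haar_compact => //; exact: compact_preimage_mulr.
    apply: measureS; first exact: measurable_preimage_mulr.
      by apply: measurable_preimage_mulr; exact: (compact_bor hG').
    by move=> y [].
  + exact: open_mulgr.
  move=> L [cL LU aL]; exists ((fun y => (y * x^-1)%g) @^-1` L); split.
  + exact: compact_preimage_mulr.
  + by move=> y /= /LU /=; rewrite mulgVK.
  + move: aL; congr (is_true (_ < mu _)).
    by apply/seteqP; split=> z /=; rewrite mulgK.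
Qed.

(** [D x] is the ratio of the measures of the right translate of [A] by [x^-1] and of [A], for a
    fixed open precompact [A]; it is the inverse of the modular function defined by translates by
    [x]. In [left_invariant_ratio] the measure [mu] and its right translate share the same second
    factor, so the ratio is the same for [B] as for [A]. *)
Lemma haar_modular : exists D : G -> R, [/\ forall x, (0 < D x)%R,
  measurable_fun setT (D : borel G -> R),
  forall x y, D (x * y)%g = (D x * D y)%R &
  forall x (B : set (borel G)), measurable B ->
    mu ((fun y => (y * x)%g) @^-1` B) = (D x)%:E * mu B].
Proof.
have [A [oA A0 [U cU AU]]] := exists_open_precompact lG.
have mA : measurable (A : set (borel G)) by exact: (open_bor (X := pointed_group G)).
have Ax x : 0 < mu ((fun y => (y * x)%g) @^-1` A) < +oo.
  apply/andP; split.
    apply: haar_open_gt0 => //; first exact: open_mulgr.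
    by have [a Aa] := A0; exists (a * x^-1)%g; rewrite /= mulgVK.
  apply: (@le_lt_trans _ _ (mu ((fun y => (y * x)%g) @^-1` U))); last first.
    by apply: haar_compact => //; exact: compact_preimage_mulr.
  apply: measureS; first exact: measurable_preimage_mulr.
    by apply: measurable_preimage_mulr; exact: (compact_bor hG').
  by move=> y /= /AU.
have Axfin x : mu ((fun y => (y * x)%g) @^-1` A) \is a fin_num.
  by rewrite ge0_fin_numE//; case/andP: (Ax x).
have A1 : 0 < mu A < +oo.
  have := Ax 1%g; rewrite (_ : _ @^-1` A = A)//.
  by apply/seteqP; split=> z /=; rewrite mulg1.
have Afin : mu A \is a fin_num by rewrite ge0_fin_numE//; case/andP: A1.
pose D x := (fine (mu ((fun y => (y * x)%g) @^-1` A)) / fine (mu A))%R.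
have Agt0 : (0 < fine (mu A))%R by rewrite fine_gt0.
have D0 x : (0 < D x)%R by rewrite divr_gt0// fine_gt0.
have Dfin x (B : set (borel G)) : measurable B -> mu B < +oo ->
    mu ((fun y => (y * x)%g) @^-1` B) = (D x)%:E * mu B.
  move=> mB Boo.
  have [H sH BH] := @sigma_subgroup_cover _ _ _ hG lG haar
    (fun n => if n is 0%N then A else B) (fun n => match n with 0 => mA | _ => mB end)
    (fun n => match n with 0 => (proj2 (andP A1)) | _ => Boo end).
  have [AH BH'] := (BH 0%N, BH 1%N).
  have lmu := left_invariant_haar.
  have tH := sigma_tight_subgroup hG haar sH.
  have k1 := left_invariant_ratio hG lmu lmu sH tH tH mA mB AH BH' (fun y _ => Ax y).
  have k2 := left_invariant_ratio hG lmu (left_invariant_pushforward x) sH tH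
    (sigma_tight_pushforward x sH) mA mB AH BH' (fun y _ => Ax y).
  apply: (etrans (k2 (measurable_mulr x))).
  rewrite [X in _ = _ * X](k1 : mu B = _) muleA; congr (_ * _).
  by rewrite -[X in _ = _ * X]fineK// -EFinM mulfVK ?gt_eqF// fineK.
have DE x (B : set (borel G)) : measurable B ->
    mu ((fun y => (y * x)%g) @^-1` B) = (D x)%:E * mu B.
  (* If [mu B] is infinite but its translate were finite, [Dfin] applied to the translate and to
     [x^-1] would make [mu B] finite. *)
  move=> mB; have [Boo|] := ltP (mu B) +oo; first exact: Dfin.
  rewrite leye_eq => /eqP Boo; rewrite Boo gt0_muley ?lte_fin//.
  apply/eqP; rewrite -leye_eq leNgt; apply/negP => Bxoo.
  have := @Dfin x^-1%g _ (measurable_preimage_mulr x mB) Bxoo.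
  rewrite (_ : _ @^-1` _ = B); last first.
    by apply/seteqP; split=> z /=; rewrite mulgVK.
  rewrite Boo => /eqP; rewrite eq_sym => /eqP E.
  have : (D x^-1%g)%:E * mu ((fun y => (y * x)%g) @^-1` B) < +oo.
    by apply: lte_mul_pinfty => //; rewrite lee_fin ltW.
  by rewrite E ltxx.
exists D; split => //.
(* The sections of the open set [E] are the right translates of [A], so their measure is lower
   semicontinuous in [x]. *)
- apply: measurable_funM => //.
  apply: (measurableT_comp (@fine_measurable R setT measurableT)).
  have [_ _ _ innr _] := haar.
  have tmu : tight (X := pointed_group G) mu.
    move=> V a oV; rewrite innr// => /ereal_sup_gt[_ [K [cK KV] <-] aK].
    by exists K.
  pose E : set (pointed_group G * pointed_group G) := [set p | A (p.1 * p.2)%g].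
  have oE : open E by apply: open_comp oA => p _; exact: mulg_continuous.
  exact: (lsc_bor (tight_section_lsc hG' tmu oE)).
- move=> x y; have := DE (x * y)%g A mA.
  rewrite (_ : _ @^-1` A = (fun z => (z * x)%g) @^-1` ((fun z => (z * y)%g) @^-1` A)).
    rewrite DE ?DE//; last exact: measurable_preimage_mulr.
    rewrite -[mu A]fineK// -!EFinM => -[] /(congr1 (fun z => z / fine (mu A))%R).
    by rewrite mulrA !mulfK ?gt_eqF.
  by apply/seteqP; split=> z /=; rewrite mulgA.
Qed.

End modular.

(** * Convolution on L_1 *)

Section convolution_kernel.
Local Open Scope ereal_scope.
Context (R : realType) (G : topGroupType) (mu : {measure set (borel G) -> \bar R}).
Hypothesis hG : hausdorff_space G.
Hypothesis lG : locally_compact [set: G].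
Hypothesis haar : left_haar mu.
Implicit Types (A B K U H : set G) (x y : G).

Let hG' : hausdorff_space (pointed_group G).
Proof. exact: hG. Qed.

Let G2 := (pointed_group G * pointed_group G)%type.

Lemma integral_support H (f : G -> \bar R) : measurable (H : set (borel G)) ->
  (forall y, ~ H y -> f y = 0) -> \int[mu]_y f y = \int[mu]_(y in H) f y.
Proof.
move=> mH f0; rewrite [RHS]integral_mkcond; apply: eq_integral => y _.
by rewrite patchE; case: ifPn => // /negP nHy; apply: f0 => Hy; exact/nHy/mem_set.
Qed.

Lemma measurable_subgroup H : sigma_subgroup H -> measurable (H : set (borel G)).
Proof. by move=> [oH _ _ _ _]; exact: (open_bor (X := pointed_group G)). Qed.

Lemma measurable_integral_support H (F : G2 -> \bar R) : sigma_subgroup H ->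
  measurable_fun setT (F : bor G2 -> \bar R) -> (forall p, 0 <= F p) ->
  (forall y x, ~ H y -> F (y, x) = 0) ->
  measurable_fun setT ((fun x => \int[mu]_y F (y, x)) : borel G -> \bar R).
Proof.
move=> sH mF F0 FH.
rewrite (_ : (fun x => _) = fun x => \int[mu]_(y in H) F (y, x)).
  exact: (measurable_fun_integral hG' (sigma_tight_subgroup hG haar sH) mF F0).
apply/funext => x; apply: integral_support; first exact: measurable_subgroup.
by move=> y /FH.
Qed.

Lemma measurable_Rintegral_support H (K : G2 -> R) : sigma_subgroup H ->
  measurable_fun setT (K : bor G2 -> R) -> (forall y x, ~ H y -> K (y, x) = 0%R) ->
  measurable_fun setT ((fun x => (\int[mu]_y K (y, x))%R) : borel G -> R).
Proof.
move=> sH mK KH.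
have mEK : measurable_fun setT ((EFin \o K) : bor G2 -> \bar R) by exact/measurable_EFinP.
rewrite /Rintegral; apply: (measurableT_comp (@fine_measurable R setT measurableT)).
rewrite (_ : (fun x => _) = (fun x => \int[mu]_y (EFin \o K)^\+ (y, x)) \-
    (fun x => \int[mu]_y (EFin \o K)^\- (y, x))); last first.
  apply/funext => x; rewrite [LHS]integralE.
  by congr (_ - _); apply: eq_integral => y _; rewrite ?funeposE ?funenegE.
apply: emeasurable_funB.
- apply: (measurable_integral_support (F := (EFin \o K)^\+) sH).
  + exact: measurable_funepos.
  + by move=> p; rewrite funepos_ge0.
  + by move=> y x Hy; rewrite funeposE /= KH// maxxx.
- apply: (measurable_integral_support (F := (EFin \o K)^\-) sH).
  + exact: measurable_funeneg.
  + by move=> p; rewrite funeneg_ge0.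
  + by move=> y x Hy; rewrite funenegE /= KH// oppr0 maxxx.
Qed.

Lemma tonelli_support H (F : G2 -> \bar R) : sigma_subgroup H ->
  measurable_fun setT (F : bor G2 -> \bar R) -> (forall p, 0 <= F p) ->
  (forall y x, ~ (H y /\ H x) -> F (y, x) = 0) ->
  \int[mu]_x \int[mu]_y F (y, x) = \int[mu]_y \int[mu]_x F (y, x).
Proof.
move=> sH mF F0 FH; have mH := measurable_subgroup sH.
have tH := sigma_tight_subgroup hG haar sH.
rewrite (integral_support (H := H))//; last first.
  by move=> x nHx; apply: integral0_eq => y _; apply: FH => -[].
rewrite [RHS](integral_support (H := H))//; last first.
  by move=> y nHy; apply: integral0_eq => x _; apply: FH => -[].
transitivity (\int[mu]_(x in H) \int[mu]_(y in H) F (y, x)).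
  apply: eq_integral => x _; apply: integral_support => // y nHy.
  by apply: FH => -[].
rewrite (tonelli hG' hG' tH tH mF F0).
apply: eq_integral => y _; apply/esym/integral_support => // x nHx.
by apply: FH => -[].
Qed.

Lemma measurable_convolution_kernel (u v : G -> R) :
  measurable_fun setT (u : borel G -> R) -> measurable_fun setT (v : borel G -> R) ->
  measurable_fun setT ((fun p : G2 => (u p.1 * v (p.1^-1 * p.2)%g)%R) : bor G2 -> R).
Proof.
move=> mu_ mv; apply: measurable_funM.
  by have := measurableT_comp mu_ (@measurable_bor_fst G); exact.
by have := measurableT_comp mv (@measurable_mulVg G); exact.
Qed.

Lemma integral_convolution H (u v : G -> R) : sigma_subgroup H ->
  measurable_fun setT (u : borel G -> R) -> measurable_fun setT (v : borel G -> R) ->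
  (forall y, (0 <= u y)%R) -> (forall y, (0 <= v y)%R) ->
  (forall y, ~ H y -> u y = 0%R) -> (forall y, ~ H y -> v y = 0%R) ->
  \int[mu]_x \int[mu]_y (u y * v (y^-1 * x)%g)%:E =
  (\int[mu]_y (u y)%:E) * (\int[mu]_y (v y)%:E).
Proof.
move=> sH mu_ mv u0 v0 uH vH.
have mH := measurable_subgroup sH.
have mK : measurable_fun setT ((fun p : G2 => (u p.1 * v (p.1^-1 * p.2)%g)%:E) :
    bor G2 -> \bar R).
  by apply/measurable_EFinP; exact: measurable_convolution_kernel.
have tH := sigma_tight_subgroup hG haar sH.
rewrite (integral_support (H := H))//; last first.
  move=> x nHx; apply: integral0_eq => y _.
  have [Hy|/uH ->] := pselect (H y); last by rewrite mul0r.
  rewrite vH ?mulr0//; apply: contra_not nHx.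
  by move/(sigma_subgroup_mull x sH ((sigma_subgroup_inv y sH).2 Hy)).
transitivity (\int[mu]_(x in H) \int[mu]_(y in H) (u y * v (y^-1 * x)%g)%:E).
  apply: eq_integral => x _; apply: integral_support => // y /uH ->.
  by rewrite mul0r.
rewrite (tonelli hG' hG' tH tH mK)//; last first.
  by move=> p; rewrite lee_fin mulr_ge0.
rewrite [in RHS](integral_support (H := H))//; last by move=> y /uH ->.
have -> : \int[mu]_y (v y)%:E = \int[mu]_(y in H) (v y)%:E.
  by rewrite (integral_support (H := H))// => y /vH ->.
rewrite -ge0_integralZr//; last 3 first.
- by apply: measurable_funTS; exact/measurable_EFinP.
- by move=> y _; rewrite lee_fin.
- by apply: integral_ge0 => y _; rewrite lee_fin.
apply: eq_integral => y /set_mem Hy.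
transitivity (\int[mu]_(x in H) ((u y)%:E * (v (y^-1 * x)%g)%:E)).
  by apply: eq_integral => x _; rewrite EFinM.
rewrite ge0_integralZl//=; last 3 first.
- apply: measurable_funTS; apply/measurable_EFinP.
  exact: (measurableT_comp mv (measurable_mull y^-1%g)).
- by move=> z _; rewrite lee_fin.
- by rewrite lee_fin.
congr (_ * _).
apply: (left_invariant_integral (f := fun z => (v z)%:E) (left_invariant_haar haar) sH).
- exact/(sigma_subgroup_inv y sH).
- exact/measurable_EFinP.
- by move=> z; rewrite lee_fin.
Qed.

End convolution_kernel.

(** * Bounded functionals on L_1 are determined by indicators *)

Section L1_facts.
Context (R : realType) (G : topGroupType) (mu : {measure set (borel G) -> \bar R}).
Implicit Types (f g : L1 mu) (S T : Linf mu) (A : set G).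
Notation normc := Normc.normc.

Lemma integrableCP (F : G -> R[i]) :
  mu.-integrable setT (EFin \o (@complex.Re R \o F : borel G -> R)) ->
  mu.-integrable setT (EFin \o (@complex.Im R \o F : borel G -> R)) ->
  F \in integrableC mu.
Proof. by move=> iRe iIm; apply/andP; split; apply/Lfun1_integrable. Qed.

Lemma L1_insubdE (F : G -> R[i]^o) : F \in integrableC mu ->
  L1_fun (insubd (0 : L1 mu) F) = F.
Proof. by move=> /(insubdK (0 : L1 mu)). Qed.

Lemma Linf_insubdE (F : L1 mu -> R[i]^o) : F \in bounded_functional (mu:=mu) ->
  Linf_fun (insubd (0 : Linf mu) F) = F.
Proof. by move=> /(insubdK (0 : Linf mu)). Qed.

Lemma L1_addE f g x : (f + g) x = (f x : R[i]) + g x :> R[i].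
Proof. by []. Qed.

Lemma L1_subE f g x : (f - g) x = (f x : R[i]) - g x :> R[i].
Proof. by []. Qed.

Lemma L1_scaleE (a : R[i]) f x : (a *: f) x = a * (f x : R[i]) :> R[i].
Proof. by []. Qed.

Lemma Linf_addE S T f : (S + T) f = (S f : R[i]) + T f :> R[i].
Proof. by []. Qed.

Lemma Linf_subE S T f : (S - T) f = (S f : R[i]) - T f :> R[i].
Proof. by []. Qed.

Lemma Linf_scaleE (a : R[i]) S f : (a *: S) f = a * (S f : R[i]) :> R[i].
Proof. by []. Qed.

Lemma Linf_eq S T : (forall f, S f = T f :> R[i]) -> S = T.
Proof. by move=> ST; apply: val_inj; apply/funext => f; exact: ST. Qed.

Lemma L1normE f : (L1norm f)%:E = (\int[mu]_x (normc (f x))%:E)%E.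
Proof.
rewrite /L1norm /Rintegral fineK//.
exact: (integrable_fin_num measurableT (normc_integrable f)).
Qed.

Lemma Linf_linear T : scalar (T : L1 mu -> R[i]^o).
Proof. by case: T => T /= /asboolP[]. Qed.

Lemma LinfD T f g : T (f + g) = T f + T g :> R[i].
Proof. by have := Linf_linear T 1 f g; rewrite scale1r mul1r. Qed.

Lemma Linf0 T : T 0 = 0 :> R[i].
Proof. by have := LinfD T 0 0; rewrite addr0 => /eqP; rewrite eq_sym -subr_eq0 addrK => /eqP. Qed.

Lemma LinfZ T (a : R[i]) f : T (a *: f) = a * T f :> R[i].
Proof. by have := Linf_linear T a f 0; rewrite addr0 Linf0 addr0. Qed.

Lemma LinfB T f g : T (f - g) = T f - T g :> R[i].
Proof. by rewrite -scaleN1r addrC Linf_linear mulN1r addrC. Qed.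

Lemma Linf_bound T : exists2 M : R, 0 <= M & forall f, normc (T f) <= M * L1norm f.
Proof.
case: T => T /= /asboolP[_ [M TM]]; exists `|M| => // f.
apply: le_trans (TM f) _; apply: ler_wpM2r; [exact: L1norm_ge0|exact: ler_norm].
Qed.

Lemma normc_ge0 (z : R[i]) : 0 <= normc z.
Proof. by case: z => a b; exact: sqrtr_ge0. Qed.

Lemma normc_eq0 (z : R[i]) : normc z = 0 -> z = 0.
Proof. by move=> z0; apply: Normc.eq0_normc. Qed.

(** The difference has norm 0, and [T] is bounded by the norm. This turns identities valid almost
    everywhere into equalities under [T]. *)
Lemma Linf_ae T f g : {ae mu, forall x : borel G, f x = g x :> R[i]} ->
  T f = T g :> R[i].
Proof.
move=> fg; apply/eqP; rewrite -subr_eq0 -LinfB; apply/eqP/normc_eq0.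
apply/eqP; rewrite eq_le; apply/andP; split; last exact: normc_ge0.
have [M M0 TM] := Linf_bound T; apply: le_trans (TM _) _.
suff -> : L1norm (f - g) = 0 by rewrite mulr0.
apply: EFin_inj; rewrite L1normE.
have nm := measurable_int mu (normc_integrable (f - g)).
transitivity (\int[mu]_x (cst 0 x : \bar R))%E; last by rewrite integral0.
apply: ge0_ae_eq_integral => //.
- by move=> x _; rewrite lee_fin; exact: normc_ge0.
apply: filterS fg => x fgx _.
by rewrite L1_subE fgx subrr Normc.normc0.
Qed.

(** The default 0 occurs only if [A] is not Borel or has infinite measure. *)
Definition ind A : L1 mu := insubd 0 (fun x => (\1_A x)%:C : R[i]^o).

Lemma ind_integrableC A : measurable (A : set (borel G)) -> (mu A < +oo)%E ->
  (fun x => (\1_A x)%:C : R[i]^o) \in integrableC mu.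
Proof.
move=> mA Aoo; apply: integrableCP.
  rewrite (_ : _ \o _ = EFin \o (\1_A : borel G -> R))//.
  apply/integrableP; split.
    by apply/measurable_EFinP; exact: (@measurable_indic _ (borel G) R setT _ mA).
  rewrite (eq_integral (fun x : borel G => (\1_A x)%:E)); last first.
    by move=> x _; rewrite gee0_abs// lee_fin.
  by rewrite integral_indic// setIT.
rewrite (_ : _ \o _ = cst 0%E)//; exact: integrable0.
Qed.

Lemma indE A x : measurable (A : set (borel G)) -> (mu A < +oo)%E ->
  ind A x = (\1_A x)%:C :> R[i].
Proof. by move=> mA Aoo; rewrite /ind L1_insubdE//; exact: ind_integrableC. Qed.

Lemma integrable_superlevel (u : borel G -> R) (e : R) : 0 < e ->
  mu.-integrable setT (EFin \o u) ->
  (mu [set x | (e <= `|u x|)%R] < +oo)%E.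
Proof.
move=> e0 iu; have mu_ := measurable_int mu iu.
have := le_integral_abse mu measurableT mu_ e0.
rewrite setTI => le; have : (e%:E * mu [set x | (e%:E <= `|(EFin \o u) x|)%E] < +oo)%E.
  by apply: le_lt_trans le _; have /integrableP[] := iu.
have -> : [set x | (e%:E <= `|(EFin \o u) x|)%E] = [set x | (e <= `|u x|)%R].
  by apply/seteqP; split=> x /=; rewrite lee_fin.
by move=> h; rewrite ltNge leye_eq; apply/eqP => h2; move: h; rewrite h2 gt0_muley ?lte_fin// ltxx.
Qed.

Definition ofreal (u : G -> R) : L1 mu := insubd 0 (fun x => (u x)%:C : R[i]^o).

Lemma ofrealE (u : borel G -> R) x : mu.-integrable setT (EFin \o u) ->
  ofreal u x = (u x)%:C :> R[i].
Proof.
move=> iu; rewrite /ofreal L1_insubdE//; apply: integrableCP => //.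
by rewrite (_ : _ \o _ = cst 0%E)//; exact: integrable0.
Qed.

Lemma normc_real (a : R) : normc a%:C = `|a|.
Proof. by rewrite /= expr0n addr0 sqrtr_sqr. Qed.

Lemma sfun_ofreal S T (u : {sfun borel G >-> R}) :
  mu.-integrable setT (EFin \o (u : borel G -> R)) ->
  (forall A, measurable (A : set (borel G)) -> (mu A < +oo)%E ->
    S (ind A) = T (ind A) :> R[i]) ->
  S (ofreal u) = T (ofreal u) :> R[i].
Proof.
move=> iu ST; pose A c := u @^-1` [set c].
pose e s : L1 mu := \sum_(c <- s) (c%:C : R[i]) *: ind (A c).
have mA c : measurable (A c : set (borel G)).
  by rewrite -[A c]setTI; exact: (measurable_funP u).
(* The zero level may have infinite measure, but its coefficient is 0; the other levels have finite
   measure by Markov's inequality. *)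
have Aoo c : c != 0 -> (mu (A c) < +oo)%E.
  move=> c0; have c1 : 0 < `|c| by rewrite normr_gt0.
  apply: le_lt_trans (integrable_superlevel c1 iu); apply: measureS => //.
    rewrite -[X in measurable X]setTI.
    apply: (measurable_fun_le (f := cst `|c|) (g := fun x => `|u x|)) => //.
    exact: measurableT_comp.
  by move=> x /= ->.
have STe s : S (e s) = T (e s) :> R[i].
  rewrite /e; elim: s => [|c s IH]; first by rewrite big_nil !Linf0.
  rewrite big_cons !LinfD IH !LinfZ; congr (_ + _).
  have [->|c0] := eqVneq c 0; first by rewrite !mul0r.
  by rewrite ST//; exact: Aoo.
have eE s x : (e s) x = (\sum_(c <- s) c * \1_(A c) x)%:C :> R[i].
  rewrite /e; elim: s => [|c s IH]; first by rewrite !big_nil.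
  rewrite !big_cons rmorphD L1_addE IH L1_scaleE; congr (_ + _).
  have [->|c0] := eqVneq c 0; first by rewrite !mul0r.
  by rewrite indE// ?rmorphM//; exact: Aoo.
have -> : ofreal u = e (fset_set (range u)); last exact: STe.
apply: val_inj; apply/funext => x /=.
by rewrite ofrealE// eE fimfunE fsbig_finite.
Qed.

Lemma Linf_ext_real S T (u : borel G -> R) :
  mu.-integrable setT (EFin \o u) ->
  (forall A, measurable (A : set (borel G)) -> (mu A < +oo)%E ->
    S (ind A) = T (ind A) :> R[i]) ->
  S (ofreal u) = T (ofreal u) :> R[i].
Proof.
move=> iu ST; have [g [ig _ gu]] := approximation_sfun_integrable measurableT iu.
have [M M0 SM] := Linf_bound S; have [N N0 TN] := Linf_bound T.
apply/eqP; rewrite -subr_eq0; apply/eqP/normc_eq0/eqP.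
rewrite eq_le normc_ge0 andbT; apply/ler_addgt0Pr => e e0; rewrite add0r.
(* The summand 1 keeps the later denominator positive when both bounds are 0. *)
have MN : 0 < M + N + 1 by rewrite ltr_wpDl// addr_ge0.
have [n gn] : exists n, (\int[mu]_z `|(u z)%:E - (g n z)%:E| < (e / (M + N + 1))%:E)%E.
  have de : 0 < e / (M + N + 1) by rewrite divr_gt0.
  have /fine_cvgP[fin /cvgr_lt/(_ _ de) lt] := gu.
  have [n _ /(_ n (leqnn n))[h1 h2]] := filterI fin lt; exists n.
  by rewrite -[X in (X < _)%E]fineK// lte_fin.
pose d : L1 mu := ofreal u - ofreal (g n).
have dE : L1norm d <= e / (M + N + 1).
  rewrite -lee_fin L1normE; apply: le_trans (ltW gn).
  apply: ge0_le_integral => //.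
  - by move=> x _; rewrite lee_fin normc_ge0.
  - exact: (measurable_int mu (normc_integrable d)).
  - apply: measurableT_comp => //; apply: emeasurable_funB.
      exact: (measurable_int mu iu).
    exact: (measurable_int mu (ig n)).
  - move=> x _.
    by rewrite L1_subE !ofrealE// -rmorphB normc_real lee_fin.
have -> : S (ofreal u) - T (ofreal u) = S d - T d :> R[i].
  by rewrite /d !LinfB (sfun_ofreal (ig n) ST); ring.
apply: (@le_trans _ _ ((M + N) * L1norm d)).
  rewrite mulrDl; apply: le_trans (le_normcD _ _) _.
  by rewrite normcN lerD.
apply: (@le_trans _ _ ((M + N + 1) * L1norm d)).
  by rewrite ler_wpM2r ?L1norm_ge0// lerDl.
by rewrite -ler_pdivlMl// mulrC.
Qed.

(** Simple functions approximate the real and the imaginary part in norm. Identities for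
    convolutions are reduced by this to indicators, where all integrands are nonnegative and all
    integrals finite. *)
Lemma Linf_ext S T : (forall A, measurable (A : set (borel G)) -> (mu A < +oo)%E ->
  S (ind A) = T (ind A) :> R[i]) -> S = T.
Proof.
move=> ST; apply: val_inj; apply/funext => f /=.
have -> : f = ofreal (@complex.Re R \o f) + 'i *: ofreal (@complex.Im R \o f).
  apply: val_inj; apply/funext => x.
  rewrite [RHS]L1_addE L1_scaleE !ofrealE; [|exact: Im_integrable|exact: Re_integrable].
  by rewrite [LHS]complexE.
by rewrite !LinfD !LinfZ !(Linf_ext_real _ ST)//; [exact: Im_integrable|exact: Re_integrable].
Qed.

End L1_facts.

Section convolution.
Context (R : realType) (G : topGroupType) (mu : {measure set (borel G) -> \bar R}).
Hypothesis hG : hausdorff_space G.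
Hypothesis lG : locally_compact [set: G].
Hypothesis haar : left_haar mu.
Implicit Types (f g h : L1 mu) (S T : Linf mu) (A B H : set G) (x y : G).
Notation normc := (@Normc.normc R).

Let G2 := (pointed_group G * pointed_group G)%type.

Lemma L1_Re_measurable f : measurable_fun setT (@complex.Re R \o f : borel G -> R).
Proof. by apply/measurable_EFinP; exact: (measurable_int mu (Re_integrable f)). Qed.

Lemma L1_Im_measurable f : measurable_fun setT (@complex.Im R \o f : borel G -> R).
Proof. by apply/measurable_EFinP; exact: (measurable_int mu (Im_integrable f)). Qed.

Lemma L1_normc_measurable f : measurable_fun setT (normc \o f : borel G -> R).
Proof. by apply/measurable_EFinP; exact: (measurable_int mu (normc_integrable f)). Qed.

(** The sets where a modulus is at least [n.+1%:R^-1] have finite measure, so one subgroup contains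
    them all; outside it the functions vanish at every point, not merely almost everywhere. *)
Lemma L1_support f g : exists2 H, sigma_subgroup H &
  forall x, ~ H x -> f x = 0 :> R[i] /\ g x = 0 :> R[i].
Proof.
pose E (n : nat) := [set x | n.+1%:R^-1 <= normc (f x)] `|`
  [set x | n.+1%:R^-1 <= normc (g x)].
have n0 (n : nat) : 0 < n.+1%:R^-1 :> R by [].
have mE (h : L1 mu) n : measurable ([set x | n.+1%:R^-1 <= normc (h x)] : set (borel G)).
  rewrite -[X in measurable X]setTI.
  by apply: measurable_fun_le => //; exact: L1_normc_measurable.
have Eoo (h : L1 mu) n : (mu [set x | (n.+1%:R^-1 <= normc (h x))%R] < +oo)%E.
  have := integrable_superlevel (n0 n) (normc_integrable h).
  rewrite (_ : [set x | _] = [set x | (n.+1%:R^-1 <= normc (h x))%R])//.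
  by apply/seteqP; split=> x /=; rewrite ger0_norm// normc_ge0.
have [|n|H sH EH] := @sigma_subgroup_cover _ _ mu hG lG haar E.
- by move=> n; apply: measurableU; exact: mE.
- apply: (@le_lt_trans _ _ (mu [set x | (n.+1%:R^-1 <= normc (f x))%R] +
    mu [set x | (n.+1%:R^-1 <= normc (g x))%R])%E).
    by apply: measureU2; exact: mE.
  by apply: lte_add_pinfty; exact: Eoo.
have small (z : R[i]) : (forall n : nat, normc z < n.+1%:R^-1) -> z = 0.
  move=> zn; apply: normc_eq0; apply/eqP; rewrite eq_le normc_ge0 andbT leNgt.
  apply/negP => z0.
  have := zn (Num.truncn (normc z)^-1); rewrite ltNge => /negP; apply.
  by rewrite invf_ple ?posrE//; apply/ltW/truncnS_gt.
exists H => // x nHx; split; apply: small => n; rewrite ltNge; apply/negP => le.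
  by apply: nHx; apply: (EH n); left.
by apply: nHx; apply: (EH n); right.
Qed.

Definition conv_fun (f g : L1 mu) x : R[i]^o :=
  cintegral mu (fun y => f y * g (y^-1 * x)%g).

(** The convolution of the two moduli, extended real because it may diverge on a null set. Where it
    is finite, the integrand of [conv_fun] is integrable. *)
Definition conv_norm (f g : L1 mu) x : \bar R :=
  (\int[mu]_y (normc (f y) * normc (g (y^-1 * x)%g))%:E)%E.

Lemma conv_norm_measurable f g : measurable_fun setT (conv_norm f g : borel G -> \bar R).
Proof.
have [H sH fgH] := L1_support f g.
apply: (measurable_integral_support hG haar
  (F := fun p : G2 => (normc (f p.1) * normc (g (p.1^-1 * p.2)%g))%:E) sH).
- apply/measurable_EFinP.
  exact: (measurable_convolution_kernel (L1_normc_measurable f) (L1_normc_measurable g)).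
- by move=> p; rewrite lee_fin mulr_ge0// normc_ge0.
- by move=> y x /fgH[fy _]; rewrite (_ : normc (f (y, x).1) = 0) ?mul0r// fy Normc.normc0.
Qed.

Lemma integral_conv_norm f g :
  (\int[mu]_x conv_norm f g x = (L1norm f * L1norm g)%:E)%E.
Proof.
have [H sH fgH] := L1_support f g.
rewrite /conv_norm.
rewrite (integral_convolution hG haar (u := normc \o f) (v := normc \o g) sH).
- by rewrite EFinM !L1normE.
- exact: L1_normc_measurable.
- exact: L1_normc_measurable.
- by move=> y; exact: normc_ge0.
- by move=> y; exact: normc_ge0.
- by move=> y /fgH[fy _]; rewrite /comp fy Normc.normc0.
- by move=> y /fgH[_ gy]; rewrite /comp gy Normc.normc0.
Qed.

Lemma conv_norm_ge0 f g x : (0 <= conv_norm f g x)%E.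
Proof. by apply: integral_ge0 => y _; rewrite lee_fin mulr_ge0// normc_ge0. Qed.

Lemma conv_norm_integrable f g : mu.-integrable setT (conv_norm f g : borel G -> \bar R).
Proof.
apply/integrableP; split; first exact: conv_norm_measurable.
rewrite (eq_integral (conv_norm f g : borel G -> \bar R)); last first.
  by move=> x _; rewrite gee0_abs// conv_norm_ge0.
by rewrite integral_conv_norm ltry.
Qed.

Lemma ReM (a b : R[i]) : complex.Re (a * b) =
  complex.Re a * complex.Re b - complex.Im a * complex.Im b.
Proof. by case: a b => [? ?] [? ?]. Qed.

Lemma ImM (a b : R[i]) : complex.Im (a * b) =
  complex.Re a * complex.Im b + complex.Im a * complex.Re b.
Proof. by case: a b => [? ?] [? ?] /=; rewrite addrC mulrC addrC. Qed.

Lemma conv_Re_measurable f g : measurable_fun setT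
  ((fun p : G2 => complex.Re (f p.1 * g (p.1^-1 * p.2)%g)) : bor G2 -> R).
Proof.
under eq_fun do rewrite ReM.
apply: measurable_funB.
  exact: (measurable_convolution_kernel (L1_Re_measurable f) (L1_Re_measurable g)).
exact: (measurable_convolution_kernel (L1_Im_measurable f) (L1_Im_measurable g)).
Qed.

Lemma conv_Im_measurable f g : measurable_fun setT
  ((fun p : G2 => complex.Im (f p.1 * g (p.1^-1 * p.2)%g)) : bor G2 -> R).
Proof.
under eq_fun do rewrite ImM.
apply: measurable_funD.
  exact: (measurable_convolution_kernel (L1_Re_measurable f) (L1_Im_measurable g)).
exact: (measurable_convolution_kernel (L1_Im_measurable f) (L1_Re_measurable g)).
Qed.

Lemma real_section_measurable (K : G2 -> R) x :
  measurable_fun setT (K : bor G2 -> R) ->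
  measurable_fun setT ((fun y => K (y, x)) : borel G -> R).
Proof.
move=> mK; apply/measurable_EFinP.
apply: (section_fun_measurable (X := pointed_group G) (F := fun p => (K p)%:E) x).
exact/measurable_EFinP.
Qed.

Lemma Rintegral_le_abs (u : borel G -> R) (v : borel G -> R) :
  measurable_fun setT u -> measurable_fun setT v -> (forall y, `|u y| <= v y) ->
  (`|\int[mu]_y u y|%:E <= \int[mu]_y (v y)%:E)%E.
Proof.
move=> mu_ mv uv; apply: (@le_trans _ _ (\int[mu]_y `|(u y)%:E|)%E); last first.
  apply: ge0_le_integral => //.
  - by do 2 apply: measurableT_comp => //.
  - exact/measurable_EFinP.
  - by move=> y _; rewrite lee_fin.
apply: le_trans (le_abse_integral mu measurableT _); last exact/measurable_EFinP.
(* If the integral is infinite, [fine] replaces it by 0 and the bound is trivial. *)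
by rewrite /Rintegral; case: (integral _ _ _) => [r||] //=; rewrite normr0 leey.
Qed.

Lemma conv_fun_Re f g x : (`|complex.Re (conv_fun f g x)|%:E <= conv_norm f g x)%E.
Proof.
apply: Rintegral_le_abs.
- exact: (real_section_measurable x (conv_Re_measurable f g)).
- exact: (real_section_measurable x
    (measurable_convolution_kernel (L1_normc_measurable f) (L1_normc_measurable g))).
- by move=> y; rewrite -Normc.normcM; have [] := normc_ge (f y * g (y^-1 * x)%g).
Qed.

Lemma conv_fun_Im f g x : (`|complex.Im (conv_fun f g x)|%:E <= conv_norm f g x)%E.
Proof.
apply: Rintegral_le_abs.
- exact: (real_section_measurable x (conv_Im_measurable f g)).
- exact: (real_section_measurable x
    (measurable_convolution_kernel (L1_normc_measurable f) (L1_normc_measurable g))).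
- by move=> y; rewrite -Normc.normcM; have [] := normc_ge (f y * g (y^-1 * x)%g).
Qed.

Lemma conv_fun_integrableC f g : conv_fun f g \in integrableC mu.
Proof.
have [H sH fgH] := L1_support f g.
apply: integrableCP; apply: (le_integrable measurableT _ _ (conv_norm_integrable f g)).
- apply/measurable_EFinP.
  apply: (measurable_Rintegral_support hG haar sH (conv_Re_measurable f g)).
  by move=> y x /fgH[/= -> _]; rewrite mul0r.
- by move=> x _; rewrite (gee0_abs (conv_norm_ge0 _ _ _)); exact: conv_fun_Re.
- apply/measurable_EFinP.
  apply: (measurable_Rintegral_support hG haar sH (conv_Im_measurable f g)).
  by move=> y x /fgH[/= -> _]; rewrite mul0r.
- by move=> x _; rewrite (gee0_abs (conv_norm_ge0 _ _ _)); exact: conv_fun_Im.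
Qed.

Lemma convolE f g x : convol f g x = conv_fun f g x :> R[i].
Proof. by rewrite /convol L1_insubdE//; exact: conv_fun_integrableC. Qed.

Lemma cintegral_linear (a : R[i]) (F F' : G -> R[i]) :
  F \in integrableC mu -> F' \in integrableC mu ->
  cintegral mu (fun y => a * F y + F' y) = a * cintegral mu F + cintegral mu F'.
Proof.
move=> iF iF'; pose f : L1 mu := insubd 0 (F : G -> R[i]^o).
pose f' : L1 mu := insubd 0 (F' : G -> R[i]^o).
by have := Linf_linear (Linf_one mu) a f f'; rewrite /= /f /f' !L1_insubdE.
Qed.

Lemma conv_integrand_integrableC f g x : conv_norm f g x \is a fin_num ->
  (fun y => f y * g (y^-1 * x)%g : R[i]) \in integrableC mu.
Proof.
move=> fin.
have mK := measurable_convolution_kernel (L1_normc_measurable f) (L1_normc_measurable g).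
have iK : mu.-integrable setT
    (fun y : borel G => (normc (f y) * normc (g (y^-1 * x)%g))%:E).
  apply/integrableP; split.
    by apply/measurable_EFinP; exact: (real_section_measurable x mK).
  rewrite (eq_integral (fun y : borel G => (normc (f y) * normc (g (y^-1 * x)%g))%:E)).
    by rewrite -ge0_fin_numE//; exact: conv_norm_ge0.
  by move=> y _; rewrite gee0_abs// lee_fin mulr_ge0// normc_ge0.
apply: integrableCP; apply: (le_integrable measurableT _ _ iK).
- apply/measurable_EFinP; exact: (real_section_measurable x (conv_Re_measurable f g)).
- move=> y _; rewrite lee_fin [leRHS]ger0_norm ?mulr_ge0 ?normc_ge0//.
  by rewrite -Normc.normcM; have [] := normc_ge (f y * g (y^-1 * x)%g).
- apply/measurable_EFinP; exact: (real_section_measurable x (conv_Im_measurable f g)).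
- move=> y _; rewrite lee_fin [leRHS]ger0_norm ?mulr_ge0 ?normc_ge0//.
  by rewrite -Normc.normcM; have [] := normc_ge (f y * g (y^-1 * x)%g).
Qed.

Lemma conv_norm_fin f g : {ae mu, forall x : borel G, conv_norm f g x \is a fin_num}.
Proof.
have := integrable_ae measurableT (conv_norm_integrable f g).
by apply: filterS => x; exact.
Qed.

(** Where [conv_norm] is infinite the integrals may take conventional values, for which linearity is
    not guaranteed; hence an identity almost everywhere. *)
Lemma convol_linear_r (a : R[i]) f g h : {ae mu, forall x : borel G,
  convol f (a *: g + h) x = (a *: convol f g + convol f h) x :> R[i]}.
Proof.
near=> x; have fing : conv_norm f g x \is a fin_num by near: x; exact: conv_norm_fin.
have finh : conv_norm f h x \is a fin_num by near: x; exact: conv_norm_fin.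
rewrite L1_addE L1_scaleE !convolE /conv_fun.
rewrite -(cintegral_linear a (conv_integrand_integrableC fing)
  (conv_integrand_integrableC finh)).
congr cintegral; apply/funext => y.
by rewrite L1_addE L1_scaleE mulrDr mulrCA.
Unshelve. all: by end_near. Qed.

Lemma convol_linear_l (a : R[i]) f g h : {ae mu, forall x : borel G,
  convol (a *: f + g) h x = (a *: convol f h + convol g h) x :> R[i]}.
Proof.
near=> x; have fing : conv_norm f h x \is a fin_num by near: x; exact: conv_norm_fin.
have finh : conv_norm g h x \is a fin_num by near: x; exact: conv_norm_fin.
rewrite L1_addE L1_scaleE !convolE /conv_fun.
rewrite -(cintegral_linear a (conv_integrand_integrableC fing)
  (conv_integrand_integrableC finh)).
congr cintegral; apply/funext => y.
by rewrite L1_addE L1_scaleE mulrDl mulrA.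
Unshelve. all: by end_near. Qed.

(** The factor 2 comes from bounding a modulus by the real and imaginary parts, each at most
    [conv_norm]. Any constant will do, since the estimate only serves to obtain bounded
    functionals. *)
Lemma L1norm_convol f g : L1norm (convol f g) <= 2 * (L1norm f * L1norm g).
Proof.
rewrite -lee_fin L1normE EFinM -integral_conv_norm -ge0_integralZl//; last 2 first.
- exact: conv_norm_measurable.
- by move=> x _; exact: conv_norm_ge0.
apply: ge0_le_integral => //.
- by move=> x _; rewrite lee_fin normc_ge0.
- exact: (measurable_int mu (normc_integrable _)).
- by apply: measurable_funeM; exact: conv_norm_measurable.
move=> x _; rewrite mule_natl mule2n; apply: (@le_trans _ _
  (`|complex.Re (convol f g x)| + `|complex.Im (convol f g x)|)%:E).
  by rewrite lee_fin normc_le.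
by rewrite EFinD convolE; apply: leeD; [exact: conv_fun_Re|exact: conv_fun_Im].
Qed.

Lemma convol_bounded_l T g : (fun f => T (convol f g) : R[i]^o) \in bounded_functional (mu := mu).
Proof.
apply/asboolP; split.
  move=> a f f' /=; rewrite (Linf_ae T (convol_linear_l a f f' g)).
  exact: Linf_linear.
have [M M0 TM] := Linf_bound T; exists (M * (2 * L1norm g)) => f.
apply: le_trans (TM _) _; rewrite -mulrA ler_wpM2l//.
by rewrite -mulrA [L1norm g * _]mulrC L1norm_convol.
Qed.

Lemma convol_bounded_r T f : (fun g => T (convol f g) : R[i]^o) \in bounded_functional (mu := mu).
Proof.
apply/asboolP; split.
  move=> a g h /=; rewrite (Linf_ae T (convol_linear_r a f g h)).
  exact: Linf_linear.
have [M M0 TM] := Linf_bound T; exists (M * (2 * L1norm f)) => g.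
apply: le_trans (TM _) _; rewrite -mulrA ler_wpM2l//.
by rewrite -mulrA L1norm_convol.
Qed.

Lemma lactE f T g : lact f T g = T (convol f g) :> R[i].
Proof. by rewrite /lact Linf_insubdE//; exact: convol_bounded_r. Qed.

Lemma ractE f T g : ract T f g = T (convol g f) :> R[i].
Proof. by rewrite /ract Linf_insubdE//; exact: convol_bounded_l. Qed.

Lemma measurable_preimage_mulVg B x : measurable (B : set (borel G)) ->
  measurable ([set y | B (y^-1 * x)%g] : set (borel G)).
Proof.
move=> mB.
have := measurableT_comp (measurable_mulr x) (@measurable_invg G) measurableT mB.
by rewrite setTI.
Qed.

Lemma cintegral_real (u : G -> R) :
  cintegral mu (fun y => (u y)%:C) = (\int[mu]_y u y)%:C.
Proof.
by rewrite /cintegral /= /Rintegral integral0.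
Qed.

Lemma convol_indE A B x : measurable (A : set (borel G)) -> (mu A < +oo)%E ->
  measurable (B : set (borel G)) -> (mu B < +oo)%E ->
  convol (ind mu A) (ind mu B) x =
    (fine (mu (A `&` [set y | B (y^-1 * x)%g])))%:C :> R[i].
Proof.
move=> mA Aoo mB Boo; rewrite convolE /conv_fun.
have mBx := measurable_preimage_mulVg x mB.
rewrite (_ : (fun y => _) = fun y => (\1_(A `&` [set y | B (y^-1 * x)%g]) y)%:C).
  rewrite cintegral_real /Rintegral integral_indic ?setIT//.
  exact: measurableI.
by apply/funext => y; rewrite !indE// indicI rmorphM.
Qed.

Lemma ind_support A B C : measurable (A : set (borel G)) -> (mu A < +oo)%E ->
  measurable (B : set (borel G)) -> (mu B < +oo)%E ->
  measurable (C : set (borel G)) -> (mu C < +oo)%E ->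
  exists2 H, sigma_subgroup H & [/\ A `<=` H, B `<=` H & C `<=` H].
Proof.
move=> mA Aoo mB Boo mC Coo.
pose E (n : nat) := match n with 0%N => A | 1%N => B | _ => C end.
have [||H sH EH] := @sigma_subgroup_cover _ _ mu hG lG haar E.
- by case=> [|[|]].
- by case=> [|[|]].
by exists H => //; split; [exact: (EH 0%N)|exact: (EH 1%N)|exact: (EH 2%N)].
Qed.

Lemma conv_indE A B x : measurable (A : set (borel G)) -> measurable (B : set (borel G)) ->
  (\int[mu]_y (\1_A y * \1_B (y^-1 * x)%g)%:E = mu (A `&` [set y | B (y^-1 * x)%g]))%E.
Proof.
move=> mA mB; rewrite (_ : (fun y => _) =
    fun y => (\1_(A `&` [set y | B (y^-1 * x)%g]) y)%:E).
  rewrite integral_indic ?setIT//; apply: measurableI => //.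
  exact: measurable_preimage_mulVg.
by apply/funext => y; rewrite indicI.
Qed.

(* Both sides are bounded and linear in each variable, so indicators suffice. *)
Lemma integral_convol f g :
  Linf_one mu (convol f g) = Linf_one mu f * Linf_one mu g :> R[i].
Proof.
pose one := Linf_one mu.
suff : MkLinf (convol_bounded_l one g) = (one g : R[i]) *: one.
  by move=> /(congr1 (fun T : Linf mu => T f : R[i])); rewrite Linf_scaleE mulrC.
apply: Linf_ext => A mA Aoo; rewrite Linf_scaleE /=.
suff : MkLinf (convol_bounded_r one (ind mu A)) = (one (ind mu A) : R[i]) *: one.
  by move=> /(congr1 (fun T : Linf mu => T g : R[i])); rewrite Linf_scaleE mulrC.
apply: Linf_ext => B mB Boo; rewrite Linf_scaleE /= /one /=.
have [H sH [AH BH _]] := ind_support mA Aoo mB Boo mB Boo.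
have indC C : measurable (C : set (borel G)) -> (mu C < +oo)%E ->
    cintegral mu (ind mu C) = (fine (mu C))%:C.
  move=> mC Coo; rewrite (_ : (ind mu C : G -> R[i]) = fun y => (\1_C y)%:C).
    by rewrite cintegral_real /Rintegral integral_indic ?setIT.
  by apply/funext => y; rewrite indE.
rewrite !indC// -rmorphM/=.
rewrite (_ : (convol (ind mu A) (ind mu B) : G -> R[i]) =
  fun x => (fine (mu (A `&` [set y | B (y^-1 * x)%g])))%:C); last first.
  by apply/funext => x; rewrite convol_indE.
rewrite cintegral_real; congr (_%:C); rewrite /Rintegral.
rewrite -fineM ?ge0_fin_numE//; congr fine.
have iA C : measurable (C : set (borel G)) -> measurable_fun setT (\1_C : borel G -> R).
  by move=> mC; exact: measurable_indic.
have := integral_convolution hG haar sH (iA _ mA) (iA _ mB).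
rewrite !integral_indic// !setIT => <-//.
- apply: eq_integral => x _; rewrite conv_indE// fineK// ge0_fin_numE//.
  apply: le_lt_trans Aoo; apply: measureS => //; apply: measurableI => //.
  exact: measurable_preimage_mulVg.
- by move=> y nHy; rewrite indicE memNset// => /AH.
- by move=> y nHy; rewrite indicE memNset// => /BH.
Qed.

(** With indicators every integral is finite, so the identity holds at each point. The substitution
    of [y^-1 * w] for [w] brings the left side to the double integral of [F], and Tonelli's theorem
    does the rest. *)
Lemma convolA_ind A B C : measurable (A : set (borel G)) -> (mu A < +oo)%E ->
  measurable (B : set (borel G)) -> (mu B < +oo)%E ->
  measurable (C : set (borel G)) -> (mu C < +oo)%E ->
  convol (ind mu A) (convol (ind mu B) (ind mu C)) =
  convol (convol (ind mu A) (ind mu B)) (ind mu C).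
Proof.
move=> mA Aoo mB Boo mC Coo; apply: val_inj; apply/funext => x.
have [H sH [AH BH CH]] := ind_support mA Aoo mB Boo mC Coo.
have fin (D E : set G) z : measurable (D : set (borel G)) -> (mu D < +oo)%E ->
    measurable (E : set (borel G)) ->
    mu (D `&` [set y | E (y^-1 * z)%g]) \is a fin_num.
  move=> mD Doo mE; rewrite ge0_fin_numE//.
  apply: le_lt_trans Doo; apply: measureS => //; apply: measurableI => //.
  exact: measurable_preimage_mulVg.
rewrite [LHS](convolE _ _ x) [RHS](convolE _ _ x) /conv_fun.
rewrite (_ : (fun y => _) = fun y =>
  (\1_A y * fine (mu (B `&` [set w | C (w^-1 * (y^-1 * x))%g])))%:C); last first.
  by apply/funext => y; rewrite convol_indE// indE// rmorphM.
rewrite [in RHS](_ : (fun y => _) = fun w =>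
  (fine (mu (A `&` [set y | B (y^-1 * w)%g])) * \1_C (w^-1 * x)%g)%:C); last first.
  by apply/funext => y; rewrite convol_indE// indE// rmorphM.
rewrite !cintegral_real; congr (_%:C); rewrite /Rintegral; congr fine.
have iA D : measurable (D : set (borel G)) -> measurable_fun setT (\1_D : borel G -> R).
  by move=> mD; exact: measurable_indic.
pose F (p : G2) : \bar R := (\1_A p.1 * \1_B (p.1^-1 * p.2)%g * \1_C (p.2^-1 * x)%g)%:E.
transitivity (\int[mu]_y \int[mu]_w F (y, w))%E.
  apply: eq_integral => y _; rewrite EFinM fineK ?fin// -conv_indE//.
  rewrite -(haar_integral_mull haar y^-1%g)/=; last 2 first.
  - apply/measurable_EFinP; apply: measurable_funM; first exact: iA.
    have := measurableT_comp (iA _ mC)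
      (measurableT_comp (measurable_mulr (y^-1 * x)%g) (@measurable_invg G)).
    exact.
  - by move=> w; rewrite lee_fin mulr_ge0.
  rewrite -ge0_integralZl//=.
  - apply: eq_integral => w _; rewrite -EFinM /F /= mulrA invgM invgK.
    by rewrite -mulgA mulVKg.
  - apply/measurable_EFinP; apply: measurable_funM.
      exact: (measurableT_comp (iA _ mB) (measurable_mull y^-1%g)).
    have := measurableT_comp (iA _ mC)
      (measurableT_comp (measurable_mulr (y^-1 * x)%g)
        (measurableT_comp (@measurable_invg G) (measurable_mull y^-1%g))).
    exact.
transitivity (\int[mu]_w \int[mu]_y F (y, w))%E.
  apply/esym/(tonelli_support hG haar sH).
  - apply/measurable_EFinP; apply: measurable_funM.
      exact: (measurable_convolution_kernel (iA _ mA) (iA _ mB)).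
    have := measurableT_comp (iA _ mC)
      (measurableT_comp (measurable_mulr x)
        (measurableT_comp (@measurable_invg G) (@measurable_bor_snd G))).
    exact.
  - by move=> p; rewrite lee_fin !mulr_ge0.
  - move=> y w yw; rewrite /F /=.
    have [/AH Hy|nAy] := pselect (A y); last by rewrite indicE memNset// !mul0r.
    have [/BH Hyw|nB] := pselect (B (y^-1 * w)%g); last first.
      by rewrite [\1_B _]indicE memNset// mulr0 mul0r.
    case: yw; split => //.
    by apply/(sigma_subgroup_mull w sH ((sigma_subgroup_inv y sH).2 Hy)).
apply: eq_integral => w _; rewrite EFinM fineK ?fin// -conv_indE//.
rewrite -ge0_integralZr//=.
- apply/measurable_EFinP.
  exact: (real_section_measurable w (measurable_convolution_kernel (iA _ mA) (iA _ mB))).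
Qed.

(** For fixed values of the other arguments each side is a bounded functional of the remaining one;
    [mkl] and [mkr] build these functionals, and indicators are substituted for [f], [g], [h] in
    turn. *)
Lemma convolA T f g h : T (convol f (convol g h)) = T (convol (convol f g) h) :> R[i].
Proof.
pose mkl T k := MkLinf (convol_bounded_l T k).
pose mkr T k := MkLinf (convol_bounded_r T k).
suff : mkl T (convol g h) = mkl (mkl T h) g.
  by move=> /(congr1 (fun T : Linf mu => T f : R[i])).
apply: Linf_ext => A mA Aoo /=.
suff : mkl (mkr T (ind mu A)) h = mkr (mkl T h) (ind mu A).
  by move=> /(congr1 (fun T : Linf mu => T g : R[i])).
apply: Linf_ext => B mB Boo /=.
suff : mkr (mkr T (ind mu A)) (ind mu B) = mkr T (convol (ind mu A) (ind mu B)).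
  by move=> /(congr1 (fun T : Linf mu => T h : R[i])).
by apply: Linf_ext => C mC Coo /=; rewrite convolA_ind.
Qed.

End convolution.

(** * Translations *)

Section translations.
Context (R : realType) (G : topGroupType) (mu : {measure set (borel G) -> \bar R}).
Hypothesis hG : hausdorff_space G.
Hypothesis lG : locally_compact [set: G].
Hypothesis haar : left_haar mu.
Variable D : G -> R.
Hypothesis D0 : forall x, 0 < D x.
Hypothesis DE : forall x (B : set (borel G)), measurable B ->
  mu ((fun y => (y * x)%g) @^-1` B) = ((D x)%:E * mu B)%E.
Implicit Types (f g h : L1 mu) (S T : Linf mu) (A B H : set G) (x y : G).
Notation normc := (@Normc.normc R).

Lemma haar_integral_mulr x (F : G -> \bar R) :
  measurable_fun setT (F : borel G -> \bar R) -> (forall y, (0 <= F y)%E) ->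
  (\int[mu]_y F (y * x)%g = (D x)%:E * \int[mu]_y F y)%E.
Proof.
move=> mF F0; have mx := measurable_mulr x.
have := @ge0_integral_pushforward _ _ (borel G) (borel G) _ _ mx mu setT F.
rewrite preimage_setT => <-//.
rewrite -(@ge0_integral_mscale _ _ _ mu setT measurableT (NngNum (ltW (D0 x))))//.
by apply: eq_measure_integral => A mA _; exact: DE.
Qed.

Definition rtranslate x f : L1 mu :=
  insubd 0 (fun y : G => f (y * x)%g).

Lemma integrableC_comp f (phi : G -> G) (c : R) :
  measurable_fun setT (phi : borel G -> borel G) ->
  (forall F : G -> \bar R, measurable_fun setT (F : borel G -> \bar R) ->
    (forall y, (0 <= F y)%E) -> (\int[mu]_y F (phi y) = c%:E * \int[mu]_y F y)%E) ->
  (fun y => f (phi y)) \in integrableC mu.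
Proof.
move=> mphi Iphi.
have comp (u : borel G -> R) : mu.-integrable setT (EFin \o u) ->
    mu.-integrable setT (EFin \o (u \o phi)).
  move=> iu; have mu_ := measurable_int mu iu.
  apply/integrableP; split; first exact: (measurableT_comp mu_ mphi).
  have mabs : measurable_fun setT ((fun y => `|(u y)%:E|%E) : borel G -> \bar R).
    by apply: measurableT_comp.
  have -> := Iphi _ mabs (fun y => abse_ge0 _).
  have /integrableP[_] := iu; rewrite -ge0_fin_numE ?integral_ge0// => fin.
  by rewrite -[X in (_ * X)%E]fineK// -EFinM ltry.
apply: integrableCP; [exact: (comp _ (Re_integrable f))|exact: (comp _ (Im_integrable f))].
Qed.

Lemma ltranslateE x f y : ltranslate x f y = f (x^-1 * y)%g :> R[i].
Proof.
rewrite /ltranslate L1_insubdE//; apply: (@integrableC_comp _ _ 1).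
  exact: measurable_mull.
by move=> F mF F0; rewrite mul1e; exact: haar_integral_mull.
Qed.

Lemma rtranslateE x f y : rtranslate x f y = f (y * x)%g :> R[i].
Proof.
rewrite /rtranslate L1_insubdE//; apply: (@integrableC_comp _ _ (D x)).
  exact: measurable_mulr.
exact: haar_integral_mulr.
Qed.

Lemma L1norm_ltranslate x f : L1norm (ltranslate x f) = L1norm f.
Proof.
apply: EFin_inj; rewrite !L1normE.
rewrite -(haar_integral_mull haar x^-1%g (f := fun y => (normc (f y))%:E)).
- by apply: eq_integral => y _; rewrite ltranslateE.
- by apply/measurable_EFinP; exact: L1_normc_measurable.
- by move=> y; rewrite lee_fin normc_ge0.
Qed.

Lemma L1norm_rtranslate x f : L1norm (rtranslate x f) = D x * L1norm f.
Proof.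
apply: EFin_inj; rewrite EFinM !L1normE.
rewrite -(haar_integral_mulr x (F := fun y => (normc (f y))%:E)).
- by apply: eq_integral => y _; rewrite rtranslateE.
- by apply/measurable_EFinP; exact: L1_normc_measurable.
- by move=> y; rewrite lee_fin normc_ge0.
Qed.

Lemma ltranslate_linear x (a : R[i]) f g :
  ltranslate x (a *: f + g) = a *: ltranslate x f + ltranslate x g.
Proof.
apply: val_inj; apply/funext => y.
rewrite [LHS](ltranslateE x (a *: f + g) y) [RHS]L1_addE L1_scaleE !ltranslateE.
by rewrite L1_addE L1_scaleE.
Qed.

Lemma rtranslate_linear x (a : R[i]) f g :
  rtranslate x (a *: f + g) = a *: rtranslate x f + rtranslate x g.
Proof.
apply: val_inj; apply/funext => y.
rewrite [LHS](rtranslateE x (a *: f + g) y) [RHS]L1_addE L1_scaleE !rtranslateE.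
by rewrite L1_addE L1_scaleE.
Qed.

Lemma ltranslate_bounded T x :
  (fun f => T (ltranslate x f) : R[i]^o) \in bounded_functional (mu := mu).
Proof.
apply/asboolP; split; first by move=> a f g; rewrite /= ltranslate_linear Linf_linear.
by have [M _ TM] := Linf_bound T; exists M => f; rewrite -(L1norm_ltranslate x).
Qed.

Lemma rtranslate_bounded T x :
  (fun f => T (rtranslate x f) : R[i]^o) \in bounded_functional (mu := mu).
Proof.
apply/asboolP; split; first by move=> a f g; rewrite /= rtranslate_linear Linf_linear.
have [M _ TM] := Linf_bound T; exists (M * D x) => f.
by rewrite -mulrA -L1norm_rtranslate.
Qed.

Lemma Linf_ltranslateE x T f : Linf_ltranslate x T f = T (ltranslate x f) :> R[i].
Proof. by rewrite /Linf_ltranslate Linf_insubdE//; exact: ltranslate_bounded. Qed.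

Lemma ltranslate_ind x A : measurable (A : set (borel G)) -> (mu A < +oo)%E ->
  ltranslate x (ind mu A) = ind mu [set y | A (x^-1 * y)%g].
Proof.
move=> mA Aoo; apply: val_inj; apply/funext => y.
rewrite [LHS](ltranslateE x _ y) [RHS](indE y) ?indE//.
- exact: measurable_preimage_mull.
- by rewrite (haar_mull haar).
Qed.

Lemma rtranslate_ind x A : measurable (A : set (borel G)) -> (mu A < +oo)%E ->
  rtranslate x (ind mu A) = ind mu [set y | A (y * x)%g].
Proof.
move=> mA Aoo; apply: val_inj; apply/funext => y.
rewrite [LHS](rtranslateE x _ y) [RHS](indE y) ?indE//.
- exact: measurable_preimage_mulr.
- by rewrite (DE x mA) lte_mul_pinfty// lee_fin ltW.
Qed.

(** Substituting [y * x^-1] for the integration variable [y] produces the factor [D x] and moves the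
    translation onto the argument of [g]. *)
Lemma convol_rtranslate_l T x f g :
  T (convol (rtranslate x f) g) = (D x)%:C * T (convol f (ltranslate x^-1%g g)) :> R[i].
Proof.
pose mkl T k := MkLinf (convol_bounded_l hG lG haar T k).
pose mkr T k := MkLinf (convol_bounded_r hG lG haar T k).
pose tr T := MkLinf (rtranslate_bounded T x).
pose tl T := MkLinf (ltranslate_bounded T x^-1%g).
suff : tr (mkl T g) = ((D x)%:C : R[i]) *: mkl T (ltranslate x^-1%g g).
  by move=> /(congr1 (fun T : Linf mu => T f : R[i])).
apply: Linf_ext => A mA Aoo; rewrite Linf_scaleE /=.
suff : mkr T (rtranslate x (ind mu A)) = ((D x)%:C : R[i]) *: tl (mkr T (ind mu A)).
  by move=> /(congr1 (fun T : Linf mu => T g : R[i])).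
apply: Linf_ext => B mB Boo; rewrite Linf_scaleE /=.
have mAx := measurable_preimage_mulr x mA.
have Axoo : (mu [set y | A (y * x)%g] < +oo)%E.
  by rewrite (DE x mA) lte_mul_pinfty// lee_fin ltW.
have mBx := measurable_preimage_mull x mB.
have Bxoo : (mu [set y | B (x * y)%g] < +oo)%E.
  by rewrite (haar_mull haar x mB).
rewrite rtranslate_ind// ltranslate_ind// invgK -LinfZ; congr (T _ : R[i]).
apply: val_inj; apply/funext => z.
rewrite [LHS](convol_indE hG lG haar)// [RHS]L1_scaleE (convol_indE hG lG haar)//.
rewrite -rmorphM; congr (_%:C).
have mBz := measurable_preimage_mulVg z mBx.
have fin : mu (A `&` [set y | B (x * (y^-1 * z))%g]) \is a fin_num.
  rewrite ge0_fin_numE//; apply: le_lt_trans Aoo; apply: measureS => //.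
  exact: measurableI.
apply: EFin_inj; rewrite [RHS]EFinM [in RHS]fineK// -DE; last exact: measurableI.
rewrite fineK.
  congr (mu _); apply/seteqP; split=> y /=; by rewrite invgM !mulgA mulgV mul1g.
rewrite ge0_fin_numE//; apply: le_lt_trans Axoo; apply: measureS => //.
by apply: measurableI => //; exact: measurable_preimage_mulVg.
Qed.

(** In [g (y^-1 * (z * x))] the translation does not touch the integration variable, so no factor
    appears. This is why averaging over right translations commutes with the left action. *)
Lemma convol_rtranslate_r T x f g :
  T (convol f (rtranslate x g)) = T (rtranslate x (convol f g)) :> R[i].
Proof.
pose mkl T k := MkLinf (convol_bounded_l hG lG haar T k).
pose mkr T k := MkLinf (convol_bounded_r hG lG haar T k).
pose tr T := MkLinf (rtranslate_bounded T x).
suff : mkl T (rtranslate x g) = mkl (tr T) g.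
  by move=> /(congr1 (fun T : Linf mu => T f : R[i])).
apply: Linf_ext => A mA Aoo /=.
suff : tr (mkr T (ind mu A)) = mkr (tr T) (ind mu A).
  by move=> /(congr1 (fun T : Linf mu => T g : R[i])).
apply: Linf_ext => B mB Boo /=.
have mBx := measurable_preimage_mulr x mB.
have Bxoo : (mu [set y | B (y * x)%g] < +oo)%E.
  by rewrite (DE x mB) lte_mul_pinfty// lee_fin ltW.
rewrite rtranslate_ind//; congr (T _ : R[i]).
apply: val_inj; apply/funext => z.
rewrite [LHS](convol_indE hG lG haar)// [RHS](rtranslateE x _ z) (convol_indE hG lG haar)//.
by congr ((fine (mu _))%:C); apply/seteqP; split=> y /=; rewrite mulgA.
Qed.

Lemma ge0_normc (z : R[i]) : 0 <= z -> z = (normc z)%:C.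
Proof. by move=> z0; rewrite -[LHS]ger0_norm. Qed.

Lemma real_ge0 (a : R) : 0 <= a -> 0 <= a%:C :> R[i].
Proof. by move=> a0; rewrite lecR. Qed.

(** [L1_ge0] holds only almost everywhere. For such [f] this is a representative nonnegative
    everywhere, so that positivity of a convolution can be read off its integrand. *)
Definition L1abs f : L1 mu := ofreal mu (normc \o f).

Lemma L1absE f x : L1abs f x = (normc (f x))%:C :> R[i].
Proof. by rewrite /L1abs ofrealE//; exact: normc_integrable. Qed.

Lemma L1abs_ae f : L1_ge0 f -> {ae mu, forall x : borel G, f x = L1abs f x :> R[i]}.
Proof. by apply: filterS => x fx; rewrite L1absE; exact: ge0_normc. Qed.

Lemma Linf_one_ge0 f : L1_ge0 f -> Linf_one mu f = (L1norm f)%:C :> R[i].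
Proof.
move=> f0; rewrite (Linf_ae _ (L1abs_ae f0)) /=.
rewrite (_ : (L1abs f : G -> R[i]) = fun y => (normc (f y))%:C).
  by rewrite cintegral_real.
by apply/funext => y; rewrite L1absE.
Qed.

Lemma convol_ge0 T f g : Linf_ge0 T -> L1_ge0 f -> L1_ge0 g ->
  0 <= T (convol f g) :> R[i].
Proof.
move=> T0 f0 g0.
have -> : T (convol f g) = T (convol (L1abs f) g) :> R[i] :=
  Linf_ae (MkLinf (convol_bounded_l hG lG haar T g)) (L1abs_ae f0).
have -> : T (convol (L1abs f) g) = T (convol (L1abs f) (L1abs g)) :> R[i] :=
  Linf_ae (MkLinf (convol_bounded_r hG lG haar T (L1abs f))) (L1abs_ae g0).
apply: T0; apply: aeW => x; rewrite (convolE hG lG haar) /conv_fun.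
rewrite (_ : (fun y => _) = fun y => (normc (f y) * normc (g (y^-1 * x)%g))%:C).
  rewrite cintegral_real; apply: real_ge0; apply: fine_ge0; apply: integral_ge0 => y _.
  by rewrite lee_fin mulr_ge0// normc_ge0.
by apply/funext => y; rewrite !L1absE rmorphM.
Qed.

End translations.

(** * Positive functionals on L_1 and topologically left invariant means *)

Section functional_measure.
Context (R : realType) (G : topGroupType) (mu : {measure set (borel G) -> \bar R}).
Implicit Types (f g h : L1 mu) (A B C H : set G) (x y : G).
Notation normc := (@Normc.normc R).

Lemma ind_ge0 A : L1_ge0 (ind mu A).
Proof.
apply: aeW => x; rewrite /ind.
have [iA|iA] := boolP ((fun x => (\1_A x)%:C : R[i]^o) \in integrableC mu).
  by rewrite L1_insubdE// lecR.
by rewrite /insubd insubN.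
Qed.

Lemma L1norm_ind A : measurable (A : set (borel G)) -> (mu A < +oo)%E ->
  L1norm (ind mu A) = fine (mu A).
Proof.
move=> mA Aoo; rewrite /L1norm /Rintegral; congr fine.
rewrite (_ : (fun x => _) = fun x => (\1_A x)%:E); first by rewrite integral_indic// setIT.
by apply/funext => x; rewrite indE// normc_real ger0_norm.
Qed.

Lemma indU A B : measurable (A : set (borel G)) -> (mu A < +oo)%E ->
  measurable (B : set (borel G)) -> (mu B < +oo)%E -> A `&` B = set0 ->
  ind mu (A `|` B) = ind mu A + ind mu B.
Proof.
move=> mA Aoo mB Boo AB; apply: val_inj; apply/funext => x.
rewrite [LHS]indE; first 1 last.
- exact: measurableU.
- by apply: le_lt_trans (measureU2 mu mA mB) _; exact: lte_add_pinfty.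
rewrite [RHS]L1_addE !indE// -rmorphD; congr (_%:C).
rewrite !indicE in_setU; have : ~~ ((x \in A) && (x \in B)).
  apply/negP => /andP[/set_mem Ax /set_mem Bx].
  by have : (A `&` B) x by []; rewrite AB.
by case: (x \in A) (x \in B) => [] []; rewrite ?addr0 ?add0r.
Qed.

(* The proofs are arguments so that fmeasure can carry the structure of a
   measure. *)
Definition fmeasure (phi : Linf mu) (E : set (borel G)) & Linf_ge0 phi & measurable E
    & (mu E < +oo)%E := fun C : set (borel G) =>
  (complex.Re (phi (ind mu (C `&` E))))%:E.

Variable phi : Linf mu.
Hypothesis phi0 : Linf_ge0 phi.
Variable E : set G.
Hypothesis mE : measurable (E : set (borel G)).
Hypothesis Eoo : (mu E < +oo)%E.

Local Notation nu := (fmeasure phi0 mE Eoo).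

Let mCE (C : set (borel G)) : measurable C -> measurable (C `&` E : set (borel G)).
Proof. by move=> mC; exact: measurableI. Qed.

Let CEoo (C : set (borel G)) : measurable C -> (mu (C `&` E) < +oo)%E.
Proof. by move=> mC; apply: le_lt_trans Eoo; apply: measureS => //; exact: mCE. Qed.

Lemma fmeasure_ge0 C : (0 <= nu C)%E.
Proof. by rewrite lee_fin; have := phi0 (ind_ge0 (C `&` E)); rewrite lecE => /andP[]. Qed.

Lemma fmeasure0 : nu set0 = 0%E.
Proof.
rewrite /fmeasure set0I (_ : ind mu set0 = 0) ?Linf0//.
apply: val_inj; apply/funext => x; rewrite [LHS]indE ?measure0//.
by rewrite indicE memNset.
Qed.

Lemma fmeasureU C C' : measurable (C : set (borel G)) -> measurable (C' : set (borel G)) ->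
  C `&` C' = set0 -> nu (C `|` C') = (nu C + nu C')%E.
Proof.
move=> mC mC' CC'; rewrite /fmeasure setIUl indU.
- by rewrite LinfD raddfD EFinD.
- exact: mCE.
- exact: CEoo.
- exact: mCE.
- exact: CEoo.
- by rewrite setIACA CC' set0I.
Qed.

(** Domination by a multiple of [mu] on [E] carries continuity at the empty set and tightness from
    [mu] over to [nu]. *)
Lemma fmeasure_le : exists2 M : R, 0 <= M & forall C : set (borel G), measurable C ->
  (nu C <= M%:E * mu (C `&` E))%E.
Proof.
have [M M0 phiM] := Linf_bound phi; exists M => // C mC.
have fin : mu (C `&` E) \is a fin_num by rewrite ge0_fin_numE// CEoo.
rewrite -[X in (_ * X)%E]fineK// -EFinM lee_fin -L1norm_ind; [|exact: mCE|exact: CEoo].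
apply: le_trans (phiM _); apply: le_trans (ler_norm _) _.
exact: (normc_ge _).1.
Qed.

Lemma fmeasure_sigma_additive : semi_sigma_additive nu.
Proof.
move=> F mF tF mU.
have [M M0 le] := fmeasure_le.
pose B n := \big[setU/set0]_(i < n) F i.
pose T n := \bigcup_k F k `\` B n.
have mB n : measurable (B n : set (borel G)) by exact: bigsetU_measurable.
have mT n : measurable (T n : set (borel G)) by exact: measurableD.
have BT n : nu (\bigcup_k F k) = (nu (B n) + nu (T n))%E.
  rewrite -fmeasureU//; last by rewrite /T setDE setICA setICr setI0.
  by rewrite /T setDUK//; exact: bigsetU_bigcup.
have fB n : nu (B n) = (\sum_(0 <= i < n) nu (F i))%E.
  elim: n => [|n IH]; first by rewrite /B big_ord0 big_nil fmeasure0.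
  have tF' : trivIset [set` predT] F by apply: sub_trivIset tF.
  have Bn : B n.+1 = B n `|` F n by rewrite /B big_ord_recr.
  rewrite big_nat_recr//= -IH Bn fmeasureU//.
  exact: (@trivIset_bigsetUI _ predT F tF' n n isT (leqnn n)).
(* The remainders decrease to the empty set inside [E], which has finite measure. *)
have muT : (fun n => mu (T n `&` E)) @ \oo --> 0%E.
  have -> : 0%E = mu (\bigcap_n (T n `&` E)).
    rewrite (_ : \bigcap_n _ = set0) ?measure0//.
    apply/seteqP; split=> // x TEx; have [[[k _ Fk] _] _] := TEx 0%N I.
    have [[_ nB] _] := TEx k.+1 I; apply: nB.
    by rewrite /B big_ord_recr /=; right.
  apply: nonincreasing_cvg_mu.
  - exact: CEoo.
  - by move=> n; exact: mCE.
  - by apply: bigcapT_measurable => n; exact: mCE.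
  - move=> m n mn; apply/subsetPset => x [[Fx nBx] Ex]; split => //; split => //.
    by move=> Bx; apply: nBx; move: Bx; rewrite /B -!bigcup_mkord => -[k /= km Fk];
      exists k => //=; exact: leq_trans mn.
rewrite (_ : (fun n => _) = fun n => (nu (\bigcup_k F k) - nu (T n))%E); last first.
  by apply/funext => n; rewrite -fB (BT n) addeK.
rewrite -[X in _ --> X]sube0; apply: cvgeB => //; first exact: cvg_cst.
apply: (@squeeze_cvge _ _ _ _ (cst 0%E) _ (fun n => (M%:E * mu (T n `&` E))%E)).
- by apply: nearW => n; rewrite fmeasure_ge0 le.
- exact: cvg_cst.
- by rewrite -[X in _ --> X](mule0 M%:E); exact: cvgeZl.
Qed.

HB.instance Definition _ := isMeasure.Build _ _ _ nu fmeasure0 fmeasure_ge0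
  fmeasure_sigma_additive.

Lemma tight_fmeasure : hausdorff_space G -> left_haar mu ->
  tight (X := pointed_group G) nu.
Proof.
move=> hG haar U a oU aU; have [M M0 le] := fmeasure_le.
have mU := open_bor (oU : open (U : set (pointed_group G))).
have M1 : 0 < M + 1 by rewrite ltr_wpDl.
(* A loss of [e] for [mu] costs [nu] at most [M * e]. Dividing by [M + 1] rather than [M] makes this
   strictly less than the gap, also when [M] is 0. *)
pose e := (fine (nu U) - a) / (M + 1).
have e0 : 0 < e by rewrite divr_gt0// subr_gt0 -lte_fin.
have fin C : measurable (C : set (borel G)) -> mu (C `&` E) \is a fin_num.
  by move=> mC; rewrite ge0_fin_numE// CEoo.
have [|K [cK KU Ke]] := haar_tight hG haar mE Eoo (a := fine (mu (U `&` E)) - e) oU.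
  by rewrite EFinB fineK ?fin// lteBlDr// lteDl ?fin// lte_fin.
have mK := compact_bor (hG : hausdorff_space (pointed_group G)) cK.
exists K; split => //.
have UK : nu U = (nu K + nu (U `\` K))%E.
  rewrite -fmeasureU//; [by rewrite setDUK|exact: measurableD|].
  by rewrite setDE setICA setICr setI0.
have UKE : (mu ((U `\` K) `&` E) <= e%:E)%E.
  have -> : (U `\` K) `&` E = (U `&` E) `\` K by apply/seteqP; split=> x /=; tauto.
  rewrite measureD//; [|exact: mCE|exact: CEoo].
  rewrite (_ : U `&` E `&` K = K `&` E); last first.
    by apply/seteqP; split=> x; [case=> -[]|case=> /[dup] /KU].
  rewrite EFinB fineK ?fin// in Ke.
  by rewrite leeBlDr ?fin// addeC -leeBlDr// ltW.
have := le _ (measurableD mU mK) => leUK.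
have : (nu U <= nu K + (M * e)%:E)%E.
  rewrite UK leeD2l//; apply: le_trans leUK _; rewrite EFinM.
  by apply: lee_pmul => //; rewrite lee_fin.
have Me : M * e < fine (nu U) - a.
  rewrite /e mulrA ltr_pdivrMr// [M * _]mulrC ltr_pM2l ?ltrDl//.
  by rewrite subr_gt0 -lte_fin.
rewrite /fmeasure -EFinD lee_fin lte_fin; move: Me; rewrite /fmeasure /=; lra.
Qed.

End functional_measure.

(** * Functionals on L_1 that transform like the Haar integral *)

Section right_invariant_functional.
Context (R : realType) (G : topGroupType) (mu : {measure set (borel G) -> \bar R}).
Hypothesis hG : hausdorff_space G.
Hypothesis lG : locally_compact [set: G].
Hypothesis haar : left_haar mu.
Variable D : G -> R.
Hypothesis D0 : forall x, 0 < D x.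
Hypothesis mD : measurable_fun setT (D : borel G -> R).
Hypothesis DM : forall x y, D (x * y)%g = D x * D y.
Hypothesis DE : forall x (B : set (borel G)), measurable B ->
  mu ((fun y => (y * x)%g) @^-1` B) = ((D x)%:E * mu B)%E.
Implicit Types (f g h : L1 mu) (S T : Linf mu) (A B H : set G) (x y : G).

Let hG' : hausdorff_space (pointed_group G).
Proof. exact: hG. Qed.

Let G2 := (pointed_group G * pointed_group G)%type.

Lemma sigma_tight_finite (nu : {measure set (borel G) -> \bar R}) :
  (nu setT < +oo)%E -> tight (X := pointed_group G) nu ->
  sigma_tight (X := pointed_group G) nu setT.
Proof.
move=> nuoo tnu; exists (fun n => if n is 0%N then setT else set0); split.
- by case.
- by case=> //; rewrite measure0.
- case=> [|n] U a oU; last first.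
    rewrite setI0 => aU; exists set0; split => //; first exact: compact0.
    by rewrite setI0.
  by rewrite setIT => /(tnu _ _ oU)[K ?]; exists K; rewrite setIT.
- by apply/trivIsetP => -[|i] [|j] //= _ _ _; rewrite ?setI0 ?set0I.
- by apply/seteqP; split => // x _; exists 0%N.
Qed.

Lemma mul_posE (c : R) (a b : \bar R) : 0 < c -> (c%:E * a = c%:E * b)%E -> a = b.
Proof.
move=> c0 /(congr1 (fun z => (c^-1)%:E * z)%E).
by rewrite !muleA -EFinM mulVf ?gt_eqF// !mul1e.
Qed.

(* Applied to phi and to the Haar integral, this shows that the two are
   proportional. *)
Lemma rinv_functional_ratio (phi : Linf mu) A B : Linf_ge0 phi ->
  (forall x f, phi (rtranslate x f) = (D x)%:C * phi f :> R[i]) ->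
  measurable (A : set (borel G)) -> (mu A < +oo)%E ->
  measurable (B : set (borel G)) -> (mu B < +oo)%E ->
  ((complex.Re (phi (ind mu A)))%:E * mu B =
  (complex.Re (phi (ind mu B)))%:E * \int[mu]_z (D z * \1_A z^-1%g)%:E)%E.
Proof.
move=> phi0 phiD mA Aoo mB Boo.
have [H sH [AH BH _]] := ind_support hG lG haar mA Aoo mB Boo mB Boo.
have mE := measurableU _ _ mA mB.
have Eoo : (mu (A `|` B) < +oo)%E.
  by apply: le_lt_trans (measureU2 mu mA mB) _; exact: lte_add_pinfty.
pose nu : {measure set (borel G) -> \bar R} := fmeasure phi0 mE Eoo.
have nuE C : C `<=` A `|` B -> nu C = (complex.Re (phi (ind mu C)))%:E.
  by move=> CE; rewrite /nu /= /fmeasure setIidl.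
have tnu : sigma_tight (X := pointed_group G) nu setT.
  apply: sigma_tight_finite; first by rewrite /nu /= /fmeasure ltry.
  exact: tight_fmeasure.
have tH := sigma_tight_subgroup hG haar sH.
have mH := measurable_subgroup sH.
have iA C : measurable (C : set (borel G)) -> measurable_fun setT (\1_C : borel G -> R).
  by move=> mC; exact: measurable_indic.
(* For fixed [z], the integrals of [F1] and [F2] over [y] against [nu] agree: this is the
   transformation rule of [phi] under right translation by [z]. Integrated over [z] first, they
   separate into the two products of the conclusion, [e1] and [e2]. *)
pose F1 (p : G2) : \bar R := (\1_A p.1 * \1_B (p.1 * p.2)%g)%:E.
pose F2 (p : G2) : \bar R := (D p.2 * (\1_B p.1 * \1_A (p.1 * p.2^-1)%g))%:E.
have mF1 : measurable_fun setT (F1 : bor G2 -> \bar R).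
  apply/measurable_EFinP; apply: measurable_funM.
    by have := measurableT_comp (iA _ mA) (@measurable_bor_fst G); exact.
  by have := measurableT_comp (iA _ mB) (@measurable_mulg G); exact.
have mdiv : measurable_fun setT ((fun p : G2 => (p.1 * p.2^-1)%g) : bor G2 -> borel G).
  apply: (@continuous_bor G2 (pointed_group G)) => p; apply: cvg_mulg.
    exact: cvg_fst.
  apply: (cvg_comp snd); [exact: cvg_snd|exact: (@invg_continuous G p.2)].
have mF2 : measurable_fun setT (F2 : bor G2 -> \bar R).
  apply/measurable_EFinP; apply: measurable_funM.
    by have := measurableT_comp mD (@measurable_bor_snd G); exact.
  apply: measurable_funM.
    by have := measurableT_comp (iA _ mB) (@measurable_bor_fst G); exact.
  by have := measurableT_comp (iA _ mA) mdiv; exact.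
have F10 p : (0 <= F1 p)%E by rewrite lee_fin mulr_ge0.
have F20 p : (0 <= F2 p)%E by rewrite lee_fin !mulr_ge0// ltW.
have t1 := tonelli hG' hG' tnu tH mF1 F10.
have t2 := tonelli hG' hG' tnu tH mF2 F20.
have e1 : (\int[nu]_(y in setT) \int[mu]_(z in H) F1 (y, z) = nu A * mu B)%E.
  have -> : (nu A * mu B = \int[nu]_(y in setT) (\1_A y)%:E * mu B)%E.
    by rewrite integral_indic// setIT.
  rewrite -ge0_integralZr//; last by apply/measurable_EFinP; exact: iA.
  apply: eq_integral => y _; rewrite /F1 /=.
  have [Ay|nAy] := pselect (A y); last first.
    rewrite indicE memNset// mul0e; apply: integral0_eq => z _.
    by rewrite mul0r.
  rewrite indicE mem_set// mul1e.
  transitivity (\int[mu]_(z in H) (\1_B (y * z)%g)%:E)%E.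
    by apply: eq_integral => z _; rewrite mul1r.
  rewrite (left_invariant_integral (f := fun z => (\1_B z)%:E)
    (left_invariant_haar haar) sH (AH _ Ay)).
  - by rewrite integral_indic// setIidl.
  - by apply/measurable_EFinP; exact: iA.
  - by move=> z; rewrite lee_fin.
have mDA : measurable_fun setT ((fun z => (D z * \1_A z^-1%g)%:E) : borel G -> \bar R).
  apply/measurable_EFinP; apply: measurable_funM => //.
  by have := measurableT_comp (iA _ mA) (@measurable_invg G); exact.
have e2 : (\int[nu]_(y in setT) \int[mu]_(z in H) F2 (y, z) =
    nu B * \int[mu]_z (D z * \1_A z^-1%g)%:E)%E.
  have -> : nu B = (\int[nu]_(y in setT) (\1_B y)%:E)%E.
    by rewrite integral_indic// setIT.
  rewrite -ge0_integralZr//; last 2 first.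
  - by apply/measurable_EFinP; exact: iA.
  - by apply: integral_ge0 => z _; rewrite lee_fin mulr_ge0// ltW.
  apply: eq_integral => w _; rewrite /F2 /=.
  have [Bw|nBw] := pselect (B w); last first.
    rewrite indicE memNset// mul0e; apply: integral0_eq => z _.
    by rewrite mul0r mulr0.
  rewrite indicE mem_set// mul1e.
  have Hw := BH _ Bw.
  rewrite -integral_support//; last first.
    move=> z nHz; rewrite [\1_A _]indicE memNset ?mulr0// => /AH.
    by move/(sigma_subgroup_mull _ sH Hw)/(sigma_subgroup_inv z sH).
  (* Multiplying by [D w^-1] allows [z] to be translated to [z * w^-1], whose inverse is
     [w * z^-1]. *)
  apply: (mul_posE (D0 w^-1%g)).
  rewrite -(haar_integral_mulr D0 DE w^-1%g mDA); last first.
    by move=> z; rewrite lee_fin mulr_ge0// ltW.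
  rewrite -ge0_integralZl//; last 3 first.
  - have := section_fun_measurable (X := pointed_group G) w (swap_fun_measurable mF2).
    rewrite /F2 /= (_ : (fun x => _) = fun z : borel G => (D z * (1 * \1_A (w * z^-1)%g))%:E)//.
    by apply/funext => z; rewrite indicE mem_set.
  - by move=> z _; rewrite lee_fin !mulr_ge0// ltW.
  - by rewrite lee_fin ltW.
  apply: eq_integral => z _.
  by rewrite -EFinM DM invgM invgK mul1r mulrCA mulrA.
rewrite -(nuE A); last by move=> ? ?; left.
rewrite -(nuE B); last by move=> ? ?; right.
rewrite -e1 -e2 -t1 -t2; apply: eq_integral => z /set_mem Hz.
have mBz := measurable_preimage_mulr z mB.
have mAz := measurable_preimage_mulr z^-1%g mA.
transitivity (nu (A `&` [set y | B (y * z)%g])).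
  rewrite -[X in nu X]setIT -integral_indic//; last exact: measurableI.
  by apply: eq_integral => y _; rewrite /F1 /= indicI.
transitivity ((D z)%:E * nu (B `&` [set y | A (y * z^-1)%g]))%E; last first.
  rewrite -[X in (_ * nu X)%E]setIT -integral_indic//; last exact: measurableI.
  rewrite -ge0_integralZl//; last 2 first.
  - by apply/measurable_EFinP; apply: iA; exact: measurableI.
  - by rewrite lee_fin ltW.
  by apply: eq_integral => y _; rewrite /F2 /= indicI.
rewrite !nuE; [|by move=> y [By _]; right|by move=> y [Ay _]; left].
set C := B `&` _.
have mC : measurable (C : set (borel G)) by exact: measurableI.
have Coo : (mu C < +oo)%E by apply: le_lt_trans Boo; apply: measureS => // y [].
rewrite -EFinM; congr (_%:E); have := phiD z (ind mu C).
rewrite (rtranslate_ind D0 DE)//.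
rewrite (_ : [set y | C (y * z)%g] = A `&` [set y | B (y * z)%g]); last first.
  by apply/seteqP; split=> y /=; rewrite /C /= mulgK => -[].
by move=> ->; case: (phi (ind mu C) : R[i]) => a b /=; rewrite mul0r subr0.
Qed.

Lemma Linf_one_ind A : measurable (A : set (borel G)) -> (mu A < +oo)%E ->
  Linf_one mu (ind mu A) = (fine (mu A))%:C :> R[i].
Proof. by move=> mA Aoo; rewrite Linf_one_ge0 ?L1norm_ind//; exact: ind_ge0. Qed.

Lemma Linf_one_rtranslate x f :
  Linf_one mu (rtranslate x f) = (D x)%:C * Linf_one mu f :> R[i].
Proof.
suff : MkLinf (rtranslate_bounded D0 DE (Linf_one mu) x) = ((D x)%:C : R[i]) *: Linf_one mu.
  by move=> /(congr1 (fun T : Linf mu => T f : R[i])).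
apply: Linf_ext => A mA Aoo.
change (Linf_one mu (rtranslate x (ind mu A)) =
  (D x)%:C * Linf_one mu (ind mu A) :> R[i]).
have mAx := measurable_preimage_mulr x mA.
have Axoo : (mu [set y | A (y * x)%g] < +oo)%E.
  by rewrite (DE x mA) lte_mul_pinfty// lee_fin ltW.
rewrite (rtranslate_ind D0 DE)// !Linf_one_ind// -rmorphM; congr (_%:C).
by rewrite (DE x mA) fineM// ge0_fin_numE.
Qed.

Lemma Linf_one_pos : Linf_ge0 (Linf_one mu).
Proof. by move=> f f0; rewrite Linf_one_ge0// lecR L1norm_ge0. Qed.

Lemma rinv_functional (phi : Linf mu) : Linf_ge0 phi ->
  (forall x f, phi (rtranslate x f) = (D x)%:C * phi f :> R[i]) ->
  exists c : R[i], forall f, phi f = c * Linf_one mu f :> R[i].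
Proof.
move=> phi0 phiD.
have [B [oB B0 [U cU BU]]] := exists_open_precompact lG.
have mB : measurable (B : set (borel G)) by exact: (open_bor (X := pointed_group G)).
have Boo : (mu B < +oo)%E.
  apply: le_lt_trans (haar_compact haar cU); apply: measureS => //.
  exact: (compact_bor hG').
have Bgt0 : (0 < mu B)%E by exact: haar_open_gt0.
pose b := fine (mu B); have b0 : 0 < b by rewrite fine_gt0// Bgt0.
have muB : mu B = b%:E by rewrite /b fineK// ge0_fin_numE.
have real A : phi (ind mu A) = (complex.Re (phi (ind mu A)))%:C :> R[i].
  by have := phi0 _ (ind_ge0 mu A); case: (phi (ind mu A) : R[i]) => p q;
    rewrite lecE /= => /andP[/eqP -> _].
pose c := complex.Re (phi (ind mu B)) / b.
exists c%:C; suff : phi = (c%:C : R[i]) *: Linf_one mu by move=> -> f.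
apply: Linf_ext => A mA Aoo.
rewrite Linf_scaleE Linf_one_ind// real -rmorphM; congr (_%:C).
have k1 := rinv_functional_ratio phi0 phiD mA Aoo mB Boo.
have k2 := rinv_functional_ratio Linf_one_pos Linf_one_rtranslate mA Aoo mB Boo.
rewrite !Linf_one_ind//= in k2.
(* The ratio identity for the Haar integral itself evaluates this integral: inversion carries the
   measure of density [D] to [mu]. *)
have k : (\int[mu]_z (D z * \1_A z^-1%g)%:E = mu A)%E.
  apply: (mul_posE b0); rewrite -k2 muB fineK ?ge0_fin_numE//.
  by rewrite muleC.
move: k1; rewrite k muB -[mu A]fineK ?ge0_fin_numE// -!EFinM => -[] k1.
by rewrite /c -mulrAC -k1 mulfK// gt_eqF.
Qed.

End right_invariant_functional.

Section scalar_pack.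
Context (K : comNzRingType) (V : lmodType K).

Lemma scalar_exists (m : V -> K) : (forall a u v, m (a *: u + v) = a * m u + m v) ->
  exists m' : {scalar V}, forall u, m' u = m u.
Proof.
move=> ml.
pose m' : {scalar V} := HB.pack m (GRing.isLinear.Build K V K *%R m ml).
by exists m'.
Qed.

End scalar_pack.

(** * From translation invariance to topological left invariance *)

Section TLIM_exists.
Context (R : realType) (G : topGroupType) (mu : {measure set (borel G) -> \bar R}).
Hypothesis hG : hausdorff_space G.
Hypothesis lG : locally_compact [set: G].
Hypothesis haar : left_haar mu.
Variable D : G -> R.
Hypothesis D0 : forall x, 0 < D x.
Hypothesis mD : measurable_fun setT (D : borel G -> R).
Hypothesis DM : forall x y, D (x * y)%g = D x * D y.
Hypothesis DE : forall x (B : set (borel G)), measurable B ->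
  mu ((fun y => (y * x)%g) @^-1` B) = ((D x)%:E * mu B)%E.
Implicit Types (f g h : L1 mu) (S T : Linf mu) (A B H : set G) (x y : G).
Notation normc := (@Normc.normc R).
Local Notation one := (Linf_one mu).

Lemma lact_linear_r f (a : R[i]) S T : lact f (a *: S + T) = a *: lact f S + lact f T.
Proof.
apply: Linf_eq => g; rewrite Linf_addE Linf_scaleE !(lactE hG lG haar).
by rewrite Linf_addE Linf_scaleE.
Qed.

Lemma lact_scale f (a : R[i]) T : lact f (a *: T) = a *: lact f T.
Proof. by apply: Linf_eq => g; rewrite Linf_scaleE !(lactE hG lG haar) Linf_scaleE. Qed.

Lemma lact_linear_l (a : R[i]) f g T :
  lact (a *: f + g) T = a *: lact f T + lact g T.
Proof.
apply: Linf_eq => h; rewrite Linf_addE Linf_scaleE !(lactE hG lG haar).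
exact: (Linf_linear (MkLinf (convol_bounded_l hG lG haar T h))).
Qed.

Lemma lact_one f : lact f one = (one f : R[i]) *: one.
Proof.
by apply: Linf_eq => g; rewrite Linf_scaleE (lactE hG lG haar) (integral_convol hG lG haar).
Qed.

Lemma lact_lact f g T : lact f (lact g T) = lact (convol g f) T.
Proof.
by apply: Linf_eq => h; rewrite !(lactE hG lG haar) (convolA hG lG haar).
Qed.

(** A right translation of [f] becomes a left translation of [lact f T], which an invariant mean
    does not see; only the factor [D x] remains. *)
Lemma lact_rtranslate x f T :
  lact (rtranslate x f) T = ((D x)%:C : R[i]) *: Linf_ltranslate x^-1%g (lact f T).
Proof.
apply: Linf_eq => g; rewrite Linf_scaleE (Linf_ltranslateE haar).
by rewrite !(lactE hG lG haar) (convol_rtranslate_l hG lG haar D0 DE).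
Qed.

Lemma lact_ge0 f T : L1_ge0 f -> Linf_ge0 T -> Linf_ge0 (lact f T).
Proof.
by move=> f0 T0 g g0; rewrite (lactE hG lG haar); exact: (convol_ge0 hG lG haar).
Qed.

Lemma P1_one f : P1 f -> one f = 1 :> R[i].
Proof. by move=> [f0 f1]; rewrite Linf_one_ge0// f1. Qed.

Section mean.
Variable m : {scalar Linf mu}.
Hypothesis mm : mean mu m.

Let mZ (a : R[i]) T : m (a *: T) = a * m T.
Proof. by rewrite linearZ. Qed.

(** The functional [M - T] is positive, hence so is the result of acting on it by [f], and [f] acts
    on the constant 1 as multiplication by [L1norm f]. *)
Lemma lact_mean_le f T (M : R) : Linf_ge0 T -> (forall g, normc (T g) <= M * L1norm g) ->
  L1_ge0 f -> normc (m (lact f T)) <= M * L1norm f.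
Proof.
move=> T0 TM f0; have [m0 m1] := mm.
have mT0 := m0 _ (lact_ge0 f0 T0).
have := m0 _ (lact_ge0 f0 (_ : Linf_ge0 ((-1 : R[i]) *: T + (M%:C : R[i]) *: one))).
have -> : m (lact f ((-1 : R[i]) *: T + (M%:C : R[i]) *: one)) =
    - m (lact f T) + M%:C * (L1norm f)%:C.
  rewrite lact_linear_r linearP lact_scale lact_one !mZ m1 Linf_one_ge0//.
  by rewrite mulN1r mulr1.
move=> h; have {h} : 0 <= - m (lact f T) + M%:C * (L1norm f)%:C.
  apply: h => g g0; rewrite Linf_addE !Linf_scaleE Linf_one_ge0// mulN1r addrC.
  by rewrite subr_ge0 -rmorphM (ge0_normc (T0 _ g0)) lecR.
by rewrite addrC subr_ge0 {1}(ge0_normc mT0) -rmorphM lecR.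
Qed.

(* m is not assumed to be bounded; positivity bounds m (lact f T) for f >= 0, and
   a general f is a combination of the nonnegative |f|, |f| + Re f, |f| + Im f. *)
Lemma mean_functional_bounded T : Linf_ge0 T ->
  (fun f => m (lact f T) : R[i]^o) \in bounded_functional (mu := mu).
Proof.
move=> T0; apply/asboolP; split.
  by move=> a f g /=; rewrite lact_linear_l linearP.
(* The real and the imaginary part each contribute 3: the shifted functions [p] and [r] have norm at
   most twice that of [f], and the modulus of [f] is subtracted from each. *)
have [M M0 TM] := Linf_bound T; exists (6 * M) => f.
pose p := ofreal mu (fun x => normc (f x) + complex.Re (f x)).
pose r := ofreal mu (fun x => normc (f x) + complex.Im (f x)).
have in_ := normc_integrable f.
have ip : mu.-integrable setT (fun x : borel G => (normc (f x) + complex.Re (f x))%:E).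
  by have := integrableD measurableT in_ (Re_integrable f).
have ir : mu.-integrable setT (fun x : borel G => (normc (f x) + complex.Im (f x))%:E).
  by have := integrableD measurableT in_ (Im_integrable f).
have nRe (z : R[i]) : 0 <= normc z + complex.Re z <= 2 * normc z.
  by have [/ler_normlP[]] := normc_ge z; lra.
have nIm (z : R[i]) : 0 <= normc z + complex.Im z <= 2 * normc z.
  by have [_ /ler_normlP[]] := normc_ge z; lra.
have p0 : L1_ge0 p by apply: aeW => x; rewrite ofrealE// lecR; case/andP: (nRe (f x)).
have r0 : L1_ge0 r by apply: aeW => x; rewrite ofrealE// lecR; case/andP: (nIm (f x)).
have q0 : L1_ge0 (L1abs f) by apply: aeW => x; rewrite L1absE lecR normc_ge0.
have qn : L1norm (L1abs f) = L1norm f.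
  apply: EFin_inj; rewrite !L1normE; apply: eq_integral => x _.
  by rewrite L1absE normc_real ger0_norm// normc_ge0.
have le2 (k : L1 mu) : (forall x, normc (k x) <= 2 * normc (f x)) ->
    L1norm k <= 2 * L1norm f.
  move=> kf; rewrite -lee_fin EFinM !L1normE -ge0_integralZl//; last 2 first.
  - exact: (measurable_int mu in_).
  - by move=> x _; rewrite lee_fin normc_ge0.
  apply: ge0_le_integral => //.
  - by move=> x _; rewrite lee_fin normc_ge0.
  - exact: (measurable_int mu (normc_integrable k)).
  - by apply: measurable_funeM; exact: (measurable_int mu in_).
  - by move=> x _; rewrite -EFinM lee_fin.
have pn : L1norm p <= 2 * L1norm f.
  apply: le2 => x; rewrite ofrealE// normc_real ger0_norm; by case/andP: (nRe (f x)).
have rn : L1norm r <= 2 * L1norm f.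
  apply: le2 => x; rewrite ofrealE// normc_real ger0_norm; by case/andP: (nIm (f x)).
have fE : f = (p - L1abs f) + 'i%C *: (r - L1abs f).
  apply: val_inj; apply/funext => x.
  rewrite [RHS]L1_addE L1_scaleE !L1_subE L1absE !ofrealE//.
  rewrite -!rmorphB ![normc _ + _ - _]addrAC subrr !add0r.
  by rewrite [LHS]complexE.
pose psi k := m (lact k T).
have psiE : psi f = (psi p - psi (L1abs f)) + 'i%C * (psi r - psi (L1abs f)).
  have psil a u v : psi (a *: u + v) = a * psi u + psi v.
    by rewrite /psi lact_linear_l linearP.
  have psiB u v : psi (u - v) = psi u - psi v.
    by rewrite -scaleN1r addrC psil mulN1r addrC.
  by rewrite {1}fE addrC psil !psiB addrC.
have pb := lact_mean_le T0 TM.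
rewrite -/(psi f) psiE; apply: le_trans (le_normcD _ _) _.
rewrite Normc.normcM (_ : normc 'i%C = 1) ?mul1r; last by rewrite /= expr0n expr1n add0r sqrtr1.
apply: (@le_trans _ _ ((2 * M * L1norm f + M * L1norm f) + (2 * M * L1norm f + M * L1norm f))).
  apply: lerD.
    apply: le_trans (le_normcD _ _) _; rewrite normcN; apply: lerD.
      by apply: le_trans (pb _ p0) _; have := ler_wpM2l M0 pn; lra.
    by rewrite -qn; exact: pb.
  apply: le_trans (le_normcD _ _) _; rewrite normcN; apply: lerD.
    by apply: le_trans (pb _ r0) _; have := ler_wpM2l M0 rn; lra.
  by rewrite -qn; exact: pb.
by rewrite le_eqVlt; apply/orP; left; apply/eqP; ring.
Qed.

Hypothesis minv : forall x T, m (Linf_ltranslate x T) = m T.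

Lemma mean_functional_const T : Linf_ge0 T ->
  exists c : R[i], forall f, m (lact f T) = c * one f.
Proof.
move=> T0; pose phi := MkLinf (mean_functional_bounded T0).
have := @rinv_functional _ _ _ hG lG haar D D0 mD DM DE phi; apply.
  by move=> f f0 /=; apply: mm.1; exact: lact_ge0.
by move=> x f /=; rewrite lact_rtranslate mZ minv.
Qed.

Let const T := exists c : R[i], forall f, m (lact f T) = c * one f.

Lemma const_linear (a : R[i]) S T : const S -> const T -> const (a *: S + T).
Proof.
move=> [c cS] [d dT]; exists (a * c + d) => f.
by rewrite lact_linear_r linearP cS dT mulrDl mulrA.
Qed.

Definition L1conj f : L1 mu := insubd 0 (fun x => (f x)^*%C : R[i]^o).

Lemma L1conjE f x : L1conj f x = (f x)^*%C :> R[i].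
Proof.
rewrite /L1conj L1_insubdE//; apply: integrableCP.
  rewrite (_ : _ \o _ = @complex.Re R \o f); first exact: Re_integrable.
  by apply/funext => y /=; case: (L1_fun f y).
rewrite (_ : EFin \o _ = (fun x => - (complex.Im (f x))%:E)%E).
  exact: (integrableN (Im_integrable f)).
by apply/funext => y /=; case: (L1_fun f y).
Qed.

Lemma L1norm_conj f : L1norm (L1conj f) = L1norm f.
Proof.
apply: EFin_inj; rewrite !L1normE; apply: eq_integral => x _; rewrite L1conjE.
by case: (L1_fun f x) => a b /=; rewrite sqrrN.
Qed.

Lemma Linf_conj_bounded T :
  (fun f => (T (L1conj f))^*%C : R[i]^o) \in bounded_functional (mu := mu).
Proof.
apply/asboolP; split.
  move=> a f g /=; rewrite (_ : L1conj (a *: f + g) = a^*%C *: L1conj f + L1conj g).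
    by rewrite Linf_linear rmorphD rmorphM /= conjcK.
  apply: val_inj; apply/funext => x.
  rewrite [LHS]L1conjE [RHS]L1_addE L1_scaleE !L1conjE L1_addE L1_scaleE.
  by rewrite rmorphD rmorphM.
have [M _ TM] := Linf_bound T; exists M => f; rewrite -(L1norm_conj f).
apply: le_trans (TM _).
by case: (T _ : R[i]) => a b /=; rewrite sqrrN.
Qed.

(* With T' the conjugate of T and M a bound of T, T is a combination of 1 and of
   the positive functionals Re T + M and Im T + M. *)
Lemma mean_functional_const_all T : const T.
Proof.
have [M M0 TM] := Linf_bound T.
pose T' := MkLinf (Linf_conj_bounded T).
pose i : R[i] := 'i%C.
pose T1 := (2^-1 : R[i]) *: (T + T').
pose T2 := ((2 * i)^-1 : R[i]) *: (T - T').
pose C : Linf mu := (M%:C : R[i]) *: one.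
(* A nonnegative [f] equals its conjugate almost everywhere. *)
have ae f : L1_ge0 f -> T' f = (T f)^*%C :> R[i].
  move=> f0 /=; congr (_^*%C); apply: Linf_ae; apply: filterS f0 => x fx.
  rewrite L1conjE (ge0_normc fx); exact: conjc_real.
have addc (z : R[i]) : z + z^*%C = 2 * (complex.Re z)%:C.
  rewrite mulr_natl mulr2n; case: z => p q; apply/eqP.
  by rewrite eq_complex /= subrr addr0 !eqxx.
have subc (z : R[i]) : z - z^*%C = 2 * i * (complex.Im z)%:C.
  rewrite -mulrA mulr_natl mulr2n; case: z => p q; apply/eqP; rewrite eq_complex /=.
  by apply/andP; split; apply/eqP; ring.
have i0 : i != 0 by rewrite eq_complex /= negb_and oner_eq0 orbT.
have P1 : Linf_ge0 (T1 + C).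
  move=> f f0; rewrite Linf_addE /T1 /C !Linf_scaleE Linf_addE ae// addc mulKf//.
  rewrite Linf_one_ge0// -rmorphM -rmorphD lecR.
  by have := TM f; have [/ler_normlP[]] := normc_ge (T f : R[i]); lra.
have P2 : Linf_ge0 (T2 + C).
  move=> f f0; rewrite Linf_addE /T2 /C !Linf_scaleE Linf_subE ae// subc mulKf ?mulf_neq0//.
  rewrite Linf_one_ge0// -rmorphM -rmorphD lecR.
  by have := TM f; have [_ /ler_normlP[]] := normc_ge (T f : R[i]); lra.
have c1 : const one by apply: mean_functional_const; exact: Linf_one_pos.
(* The last term has to be of the form [k *: one + one] to fit [const_linear], so [k] is one less
   than the coefficient wanted. *)
pose k : R[i] := - (M%:C + i * M%:C) - 1.
have -> : T = (1 : R[i]) *: (T1 + C) + (i *: (T2 + C) + (k *: one + one)).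
  apply: Linf_eq => f; rewrite /T1 /T2 /C /k !(Linf_subE, Linf_addE, Linf_scaleE).
  move: (T f : R[i]) (T' f : R[i]) (one f : R[i]) => u v w.
  by field; rewrite i0.
apply: const_linear; first exact: mean_functional_const.
apply: const_linear; first exact: mean_functional_const.
exact: const_linear.
Qed.

End mean.

Lemma P1_exists : exists f : L1 mu, P1 f.
Proof.
have [B [oB B0 [U cU BU]]] := exists_open_precompact lG.
have hG' : hausdorff_space (pointed_group G) by exact: hG.
have mB : measurable (B : set (borel G)) by exact: (open_bor (X := pointed_group G)).
have Boo : (mu B < +oo)%E.
  apply: le_lt_trans (haar_compact haar cU); apply: measureS => //.
  exact: (compact_bor hG').
have Bgt0 : (0 < mu B)%E by exact: haar_open_gt0.
have b0 : 0 < fine (mu B) by rewrite fine_gt0// Bgt0.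
pose f : L1 mu := ((fine (mu B))^-1%:C : R[i]) *: ind mu B.
have f0 : L1_ge0 f.
  by apply: aeW => x; rewrite L1_scaleE indE// -rmorphM lecR mulr_ge0// invr_ge0 ltW.
exists f; split => //.
have := Linf_one_ge0 f0; rewrite LinfZ Linf_one_ind// -rmorphM mulVf ?gt_eqF//.
by move=> [].
Qed.

Lemma TLIM_exists : amenable mu -> exists m, TLIM mu m.
Proof.
move=> [m mm minv].
have [f1 P1f1] := P1_exists.
have lin (a : R[i]) S T : m (lact f1 (a *: S + T)) = a * m (lact f1 S) + m (lact f1 T).
  by rewrite lact_linear_r linearP.
have [m' m'E] := scalar_exists lin.
have [f10 _] := P1f1.
exists m'; split.
  split=> [T T0|]; first by rewrite m'E; apply: mm.1; exact: lact_ge0.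
  by rewrite m'E lact_one (P1_one P1f1) scale1r mm.2.
(* The convolution of [f] and [f1] has integral 1, like [f1] itself, and [m (lact f T)] depends on
   [f] through its integral only. *)
move=> f T Pf; rewrite !m'E lact_lact.
have [c cT] := mean_functional_const_all mm minv T.
by rewrite !cT (integral_convol hG lG haar) !P1_one// !mulr1.
Qed.

End TLIM_exists.

(** * A thick set disjoint from one of its translates *)

Section thick_set.
Context (G : topGroupType).
Hypothesis hG : hausdorff_space G.
Hypothesis lG : locally_compact [set: G].
Implicit Types (A H K : set G) (x y z : G).

(** Four is the number of factors needed to express [y n] when a point of the set below and its
    translate by [x] come from different indices: two elements of the chain, one earlier [y m], and
    [x] or its inverse. *)
Let mul4 K := setmulg (setmulg K K) (setmulg K K).

Let mul4I K a b c d : K a -> K b -> K c -> K d -> mul4 K (a * b * (c * d))%g.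
Proof.
move=> Ka Kb Kc Kd; exists (a * b)%g; first by exists a => //; exists b.
by exists (c * d)%g => //; exists c => //; exists d.
Qed.

(** Otherwise every conjugate of [x] would either lie in the compact set [mul4 K] or be a conjugate
    by an element of it, and the conjugacy class would be contained in the compact set [C]. *)
Lemma conjugates_escape K x : ~ precompact (conjugacy_class x) -> compact K ->
  exists y, ~ mul4 K y /\ ~ mul4 K (y * x * y^-1)%g.
Proof.
move=> nx cK; apply: contrapT => nex; apply: nx.
have cK4 : compact (mul4 K) by do !apply: compact_setmulg.
pose C := setmulg (setmulg (mul4 K) [set x]) (setinvg (mul4 K)) `|` mul4 K.
have cC : compact C.
  apply: compactU => //; apply: compact_setmulg; last exact: compact_setinvg.
  by apply: compact_setmulg => //; exact: compact_set1.
rewrite precompactE; apply: (subclosed_compact _ cC); first exact: closed_closure.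
have /closure_id -> := compact_closed hG cC.
apply: closureS => _ [y _ <-].
have [Ky|nKy] := pselect (mul4 K y); last first.
  by right; apply: contrapT => nKx; apply: nex; exists y.
left; exists (y * x)%g; first by exists y => //; exists x.
by exists y^-1%g => //; exists y.
Qed.

(* A is the union of the s A_H, for s in a transversal of G / H, where H is the
   union of the K n and A_H the union of the sets (K n)° y_n. *)
Lemma thick_set x : ~ precompact (conjugacy_class x) ->
  exists A (y : G^nat), [/\ open A, forall z, A z -> ~ A (z * x)%g &
    forall z, \forall n \near \oo, A (z * y n)%g].
Proof.
move=> nx.
have /choice[e eP] : forall K, exists y, compact K ->
    ~ mul4 K y /\ ~ mul4 K (y * x * y^-1)%g.
  move=> K; have [cK|ncK] := pselect (compact K); last by exists 1%g.
  by have [y] := conjugates_escape nx cK; exists y.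
have [K [cK [nK xK] KV KE KM]] := compact_chain lG
  (fun n K (_ : compact K) => @compact_set1 _ (e K)) (@compact_set1 _ x).
have [sH Kle Kint] := chain_subgroup cK nK KV KM.
set H := \bigcup_n K n in sH; have [_ H1 HM HV _] := sH.
pose y n := e (K n).
have yK n : K n.+1 (y n) by exact: KE.
have yH n : H (y n) by exists n.+1.
have xKn n : K n x by apply: (Kle 0%N) => //; exact: xK.
have K1 n : K n 1%g by apply: (Kle 0%N) => //; exact: nbhs_singleton.
have xH : H x by exists 0%N => //; exact: xKn.
pose AH := \bigcup_n [set h | (K n)° (h * (y n)^-1)%g].
have AHH : AH `<=` H.
  move=> h [n _ /= /interior_subset Kh]; rewrite -[h](mulgVK (y n)).
  by apply: HM => //; exists n.
have AHx h : AH h -> ~ AH (h * x)%g.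
  move=> [n _ /= /interior_subset Kn] [m _ /= /interior_subset Km].
  (* The larger index gives the contradiction. With [m < n], solving for [y n] leaves four factors
     in [K n]; [y m] is one of them because it lies in [K m.+1]. With equal indices the same
     cancellation isolates the conjugate of [x] by [y n]. *)
  have [mn|nm|emn] := ltngtP m n.
  - have [+ _] := eP _ (cK n); apply.
    have -> : e (K n) = (((h * (y n)^-1)^-1 * ((h * x) * (y m)^-1)) * (y m * x^-1))%g.
      by rewrite !mulgA mulgVK mulgK invgM invgK mulgVK.
    apply: mul4I; [exact: KV|exact: (Kle m n (ltnW mn))|exact: (Kle m.+1 n)|].
    exact: KV.
  - have [+ _] := eP _ (cK m); apply.
    have -> : e (K m) = (((h * x * (y m)^-1)^-1 * (h * (y n)^-1)) * (y n * x))%g.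
      by rewrite !mulgA mulgVK !invgM invgK !mulgA mulgVK mulgVK.
    apply: mul4I; [exact: KV|exact: (Kle n m (ltnW nm))|exact: (Kle n.+1 m)|].
    exact: xKn.
  - rewrite emn in Km; have [_] := eP _ (cK n); apply.
    have -> : (e (K n) * x * (e (K n))^-1 =
        (h * (y n)^-1)^-1 * (h * x * (y n)^-1) * (1 * 1))%g.
      by rewrite !mulg1 !mulgA invgM invgK mulgVK.
    by apply: mul4I => //; exact: KV.
(* The chosen element depends only on the set it is chosen from, here the coset of [z], so [r] is
   constant on cosets. *)
pose r z : G := xget 1%g [set s | H (s^-1 * z)%g].
have rP z : H ((r z)^-1 * z)%g.
  by apply: (@xgetPex _ 1%g [set s | H (s^-1 * z)%g]); exists z; rewrite /= mulVg.
have rE z h : H h -> r (z * h)%g = r z.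
  move=> Hh; congr (xget _ _); apply/seteqP; split=> s /=; rewrite mulgA;
    exact: (sigma_subgroup_mulr _ sH Hh).1 || exact: (sigma_subgroup_mulr _ sH Hh).2.
pose A := \bigcup_(s in range r) (fun z => (s^-1 * z)%g) @^-1` AH.
have AE z : A z <-> AH ((r z)^-1 * z)%g.
  split=> [[_ [w _ <-] /= Az]|Az]; last by exists (r z) => //; exists z.
  suff -> : r z = r w by [].
  have Hz := AHH _ Az.
  by rewrite -[z](mulVKg (r w)) rE// -[X in _ = r X](mulVKg (r w)) rE.
exists A, y; split.
- apply: bigcup_open => s _; apply: open_mulgl; apply: bigcup_open => n _.
  by apply: open_mulgr; exact: open_interior.
- by move=> z /AE Az /AE; rewrite rE// mulgA; exact: AHx.
- move=> z; have [N _ KN] := rP z; near=> n; apply/AE; rewrite rE//.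
  exists n => //=; rewrite mulgA mulgK.
  (* [N.+1] rather than [N]: the definition of [AH] uses interiors, and [K N] lies in the interior
     of [K N.+1]. *)
  have Nn : (N.+1 <= n)%N by near: n; exact: nbhs_infty_ge.
  by apply: (interiorS (Kle _ _ Nn)); exact: Kint.
Unshelve. all: by end_near.
Qed.

End thick_set.

(** * Limits of translates along an ultrafilter *)

Section ultralimit.
Context (R : realType) (U : set_system nat).
Hypothesis UU : UltraFilter U.
Hypothesis ooU : \oo `<=` U.
Notation normc := (@Normc.normc R).
Implicit Types u v : nat -> R[i].

Local Instance ultra_proper : ProperFilter U := ultra_proper.

(** Compactness of the segment gives a cluster point, and a cluster point of an ultrafilter is a
    limit. *)
Lemma ultra_cvg (u : nat -> R) (M : R) : (forall n, `|u n| <= M) -> cvg (u n @[n --> U]).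
Proof.
move=> uM; have uK : (u n @[n --> U]) `[- M, M]%classic.
  by apply: nearW => n; rewrite /= in_itv /= -ler_norml.
have [p [_ clp]] := @segment_compact R (- M) M _ _ uK.
apply/cvg_ex; exists p => B Bp; have [//|UB] := in_ultra_setVsetC (u @^-1` B) UU.
have [q [nBq Bq]] := clp (~` B) B UB Bp; contradiction.
Qed.

(** Taken coordinatewise, so that compactness of real segments suffices; this costs the factor 2 in
    [ulim_bound]. *)
Definition ulim u : R[i] :=
  (lim (complex.Re (u n) @[n --> U])) +i* (lim (complex.Im (u n) @[n --> U])).

Definition ubounded u := exists M, forall n, normc (u n) <= M.

Lemma ubounded_Re u : ubounded u -> cvg (complex.Re (u n) @[n --> U]).
Proof.
by move=> [M uM]; apply: (@ultra_cvg _ M) => n; exact: le_trans (normc_ge _).1 (uM n).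
Qed.

Lemma ubounded_Im u : ubounded u -> cvg (complex.Im (u n) @[n --> U]).
Proof.
by move=> [M uM]; apply: (@ultra_cvg _ M) => n; exact: le_trans (normc_ge _).2 (uM n).
Qed.

Lemma ulim_cvg u (a b : R) : complex.Re (u n) @[n --> \oo] --> a ->
  complex.Im (u n) @[n --> \oo] --> b -> ulim u = a +i* b.
Proof.
move=> ua ub; congr (_ +i* _); apply: cvg_lim => // B nB; apply: ooU.
  exact: ua.
exact: ub.
Qed.

Lemma ulim_linear (a : R[i]) u v : ubounded u -> ubounded v ->
  ulim (fun n => a * u n + v n) = a * ulim u + ulim v.
Proof.
move=> bu bv; have [uR uI] := (ubounded_Re bu, ubounded_Im bu).
have [vR vI] := (ubounded_Re bv, ubounded_Im bv).
case: a => a b; congr (_ +i* _); apply: cvg_lim => //.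
  rewrite (_ : (fun n => _) = fun n => a * complex.Re (u n) -
    b * complex.Im (u n) + complex.Re (v n)).
    by apply: cvgD vR; apply: cvgB; apply: cvgM => //; exact: cvg_cst.
  by apply/funext => n; case: (u n) (v n) => [? ?] [? ?].
rewrite (_ : (fun n => _) = fun n => a * complex.Im (u n) +
    b * complex.Re (u n) + complex.Im (v n)).
  by apply: cvgD vI; apply: cvgD; apply: cvgM => //; exact: cvg_cst.
by apply/funext => n; case: (u n) (v n) => [? ?] [? ?].
Qed.

Lemma ulim_bound u (M : R) : (forall n, normc (u n) <= M) -> normc (ulim u) <= 2 * M.
Proof.
move=> uM; have bnd (w : nat -> R) : (forall n, `|w n| <= M) -> `|lim (w n @[n --> U])| <= M.
  move=> wM; have cw := ultra_cvg wM; rewrite ler_norml; apply/andP; split.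
    by apply: limr_ge => //; apply: nearW => n; have := wM n; rewrite ler_norml => /andP[].
  by apply: limr_le => //; apply: nearW => n; have := wM n; rewrite ler_norml => /andP[].
rewrite (le_trans (normc_le _))//= mulr_natl mulr2n lerD//; apply: bnd => n.
  exact: le_trans (normc_ge _).1 (uM n).
exact: le_trans (normc_ge _).2 (uM n).
Qed.

Lemma ulim_ge0 u : ubounded u -> (forall n, 0 <= u n) -> 0 <= ulim u.
Proof.
move=> bu u0; rewrite lecE /=; apply/andP; split.
  apply/eqP; rewrite (_ : (fun n => complex.Im (u n)) = cst 0) ?lim_cst//.
  by apply/funext => n; have := u0 n; rewrite lecE => /andP[/eqP].
apply: limr_ge; first exact: ubounded_Re.
by apply: nearW => n; have := u0 n; rewrite lecE => /andP[].
Qed.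

End ultralimit.

(** * Indicators as elements of L_infty *)

Section restriction.
Context (R : realType) (G : topGroupType) (mu : {measure set (borel G) -> \bar R}).
Implicit Types (f g : L1 mu) (A B : set G) (x y : G).
Notation normc := (@Normc.normc R).
Local Notation one := (Linf_one mu).

Definition restr A f : L1 mu := insubd 0 (fun x => (\1_A x)%:C * f x : R[i]^o).

Lemma integrable_restr A (u : borel G -> R) : measurable (A : set (borel G)) ->
  mu.-integrable setT (EFin \o u) ->
  mu.-integrable setT (fun x : borel G => (\1_A x * u x)%:E).
Proof.
move=> mA iu; have mu_ := measurable_int mu iu.
apply: (le_integrable _ _ _ iu) => //.
  apply/measurable_EFinP; apply: measurable_funM; first exact: measurable_indic.
  exact/measurable_EFinP.
move=> x _; rewrite !abse_EFin lee_fin normrM ler_piMl// indicE.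
by case: (x \in A); rewrite ?normr0 ?normr1.
Qed.

Lemma restrE A f x : measurable (A : set (borel G)) ->
  restr A f x = (\1_A x)%:C * f x :> R[i].
Proof.
move=> mA; rewrite /restr L1_insubdE//; apply: integrableCP.
  rewrite (_ : _ \o _ = fun x => (\1_A x * complex.Re (f x))%:E).
    exact: (integrable_restr mA (Re_integrable f)).
  by apply/funext => y /=; case: (L1_fun f y) => a b /=; rewrite mul0r subr0.
rewrite (_ : _ \o _ = fun x => (\1_A x * complex.Im (f x))%:E).
  exact: (integrable_restr mA (Im_integrable f)).
by apply/funext => y /=; case: (L1_fun f y) => a b /=; rewrite mul0r addr0.
Qed.

Lemma restr_linear A (a : R[i]) f g : measurable (A : set (borel G)) ->
  restr A (a *: f + g) = a *: restr A f + restr A g.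
Proof.
move=> mA; apply: val_inj; apply/funext => x.
rewrite [LHS]restrE// [RHS]L1_addE L1_scaleE !restrE// L1_addE L1_scaleE.
by rewrite mulrDr mulrCA.
Qed.

Lemma L1norm_restr A f : measurable (A : set (borel G)) -> L1norm (restr A f) <= L1norm f.
Proof.
move=> mA; apply: le_Rintegral => //; [exact: normc_integrable|exact: normc_integrable|].
move=> x _; rewrite restrE// Normc.normcM normc_real ler_piMl ?normc_ge0//.
by rewrite indicE; case: (x \in A); rewrite ?normr0 ?normr1.
Qed.

(** This functional, the integral over [A], is the indicator of [A] in L_infty(G). Unlike
    [ind mu A], it is meaningful for sets of infinite measure. *)
Lemma Linf_restr_bounded A : measurable (A : set (borel G)) ->
  (fun f => one (restr A f) : R[i]^o) \in bounded_functional (mu := mu).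
Proof.
move=> mA; apply/asboolP; split.
  by move=> a f g; rewrite restr_linear// Linf_linear.
have [M M0 oneM] := Linf_bound one; exists M => f.
by apply: le_trans (oneM _) _; rewrite ler_wpM2l// L1norm_restr.
Qed.

(** Dominated convergence: the indicators tend to 1 at each point, and [f] dominates its
    restrictions. *)
Lemma restr_cvg (A : nat -> set G) f : (forall n, measurable (A n : set (borel G))) ->
  (forall x, \forall n \near \oo, A n x) ->
  complex.Re (one (restr (A n) f)) @[n --> \oo] --> complex.Re (one f : R[i]) /\
  complex.Im (one (restr (A n) f)) @[n --> \oo] --> complex.Im (one f : R[i]).
Proof.
move=> mA Ax.
have cv (u : borel G -> R) : mu.-integrable setT (EFin \o u) ->
    (\int[mu]_x (\1_(A n) x * u x)) @[n --> \oo] --> \int[mu]_x u x.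
  move=> iu; have mu_ := measurable_int mu iu.
  have iAu n := integrable_restr (mA n) iu.
  apply: fine_cvg; rewrite fineK; last exact: (integrable_fin_num measurableT iu).
  have [] // := @dominated_convergence _ _ _ mu setT measurableT
    (fun n (x : borel G) => (\1_(A n) x * u x)%:E) (EFin \o u) (abse \o (EFin \o u)).
  - by move=> n; exact: measurable_int (iAu n).
  - apply: aeW => x _; apply: cvg_near_cst; have := Ax x; apply: filterS => n Anx.
    by rewrite indicE mem_set// mul1r.
  - exact: integrable_abse.
  - apply: aeW => x n _; rewrite /= lee_fin normrM ler_piMl// indicE.
    by case: (x \in A n); rewrite ?normr0 ?normr1.
split.
- rewrite (_ : (fun n => _) = fun n => \int[mu]_x (\1_(A n) x * complex.Re (f x))).
    exact: (cv _ (Re_integrable f)).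
  apply/funext => n; apply: eq_Rintegral => x _; rewrite restrE//.
  by case: (L1_fun f x) => a b /=; rewrite mul0r subr0.
- rewrite (_ : (fun n => _) = fun n => \int[mu]_x (\1_(A n) x * complex.Im (f x))).
    exact: (cv _ (Im_integrable f)).
  apply/funext => n; apply: eq_Rintegral => x _; rewrite restrE//.
  by case: (L1_fun f x) => a b /=; rewrite mul0r addr0.
Qed.

End restriction.

(** * Averaging right translations along an ultrafilter *)

Section limit_operator.
Context (R : realType) (G : topGroupType) (mu : {measure set (borel G) -> \bar R}).
Hypothesis hG : hausdorff_space G.
Hypothesis lG : locally_compact [set: G].
Hypothesis haar : left_haar mu.
Variable D : G -> R.
Hypothesis D0 : forall x, 0 < D x.
Hypothesis DE : forall x (B : set (borel G)), measurable B ->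
  mu ((fun y => (y * x)%g) @^-1` B) = ((D x)%:E * mu B)%E.
Variable U : set_system nat.
Hypothesis UU : UltraFilter U.
Hypothesis ooU : \oo `<=` U.
Variable z : G^nat.
Implicit Types (f g h : L1 mu) (S T : Linf mu) (A B : set G) (x y : G).
Notation normc := (@Normc.normc R).
Local Notation one := (Linf_one mu).

(** The factor makes this an isometry that preserves integrals. Its adjoint on L_infty(G) sends
    [y |-> T y] to [y |-> T (y * x^-1)]. *)
Definition nrtranslate x f : L1 mu := ((D x)^-1%:C : R[i]) *: rtranslate x f.

Lemma nrtranslateE x f y : nrtranslate x f y = (D x)^-1%:C * f (y * x)%g :> R[i].
Proof. by rewrite L1_scaleE (rtranslateE D0 DE). Qed.

Lemma nrtranslate_linear x (a : R[i]) f g :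
  nrtranslate x (a *: f + g) = a *: nrtranslate x f + nrtranslate x g.
Proof.
by rewrite /nrtranslate (rtranslate_linear D0 DE) scalerDr !scalerA mulrC.
Qed.

Lemma L1norm_nrtranslate x f : L1norm (nrtranslate x f) = L1norm f.
Proof.
have -> : L1norm (nrtranslate x f) = (D x)^-1 * L1norm (rtranslate x f).
  rewrite /L1norm -RintegralZl//; last exact: normc_integrable.
  apply: eq_Rintegral => y _; rewrite L1_scaleE Normc.normcM normc_real.
  by rewrite ger0_norm// invr_ge0 ltW.
by rewrite (L1norm_rtranslate D0 DE) mulKf// gt_eqF.
Qed.

Lemma nrtranslate_ge0 x f : L1_ge0 f -> L1_ge0 (nrtranslate x f).
Proof.
move=> [N [mN N0 fN]]; exists ((fun y => (y * x)%g) @^-1` N); split.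
- exact: measurable_preimage_mulr.
- by rewrite DE// N0 mule0.
- move=> y /= nfy; apply: fN => /= fy; apply: nfy.
  by rewrite [X in _ <= X]nrtranslateE mulr_ge0// lecR invr_ge0 ltW.
Qed.

Lemma one_nrtranslate x f : one (nrtranslate x f) = one f :> R[i].
Proof.
rewrite LinfZ (Linf_one_rtranslate D0 DE) mulrA -rmorphM mulVf ?mul1r//.
by rewrite gt_eqF.
Qed.

Lemma convol_nrtranslate T x f g :
  T (convol f (nrtranslate x g)) = T (nrtranslate x (convol f g)) :> R[i].
Proof.
rewrite LinfZ -(convol_rtranslate_r hG lG haar D0 DE).
exact: (LinfZ (MkLinf (convol_bounded_r hG lG haar T f))).
Qed.

Lemma restr_nrtranslate x A f : measurable (A : set (borel G)) ->
  restr A (nrtranslate x f) = nrtranslate x (restr [set y | A (y * x^-1)%g] f).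
Proof.
move=> mA; apply: val_inj; apply/funext => y.
have mA' : measurable ([set y | A (y * x^-1)%g] : set (borel G)).
  exact: measurable_preimage_mulr.
rewrite [LHS](restrE _ _ mA) [RHS]nrtranslateE nrtranslateE restrE//.
rewrite mulrCA !indicE.
suff -> : (y \in A) = ((y * x)%g \in [set y | A (y * x^-1)%g]) by [].
by apply/idP/idP; rewrite !in_setE /= mulgK.
Qed.

Definition limit_functional T f : R[i]^o := ulim U (fun n => T (nrtranslate (z n) f)).

Lemma limit_ubounded T f : ubounded (fun n => T (nrtranslate (z n) f) : R[i]).
Proof.
have [M _ TM] := Linf_bound T; exists (M * L1norm f) => n.
by rewrite -(L1norm_nrtranslate (z n) f).
Qed.

Lemma limit_bounded T : limit_functional T \in bounded_functional (mu := mu).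
Proof.
apply/asboolP; split.
  move=> a f g; rewrite /limit_functional -ulim_linear//; first 1 last.
  - exact: limit_ubounded.
  - exact: limit_ubounded.
  by congr ulim; apply/funext => n; rewrite nrtranslate_linear Linf_linear.
have [M _ TM] := Linf_bound T; exists (2 * M) => f; rewrite -mulrA.
by apply: ulim_bound => // n; rewrite -(L1norm_nrtranslate (z n) f).
Qed.

Definition limit_op T : Linf mu := MkLinf (limit_bounded T).

Lemma limit_opE T f : limit_op T f = ulim U (fun n => T (nrtranslate (z n) f)) :> R[i].
Proof. by []. Qed.

Lemma limit_op_linear (a : R[i]) S T : limit_op (a *: S + T) = a *: limit_op S + limit_op T.
Proof.
apply: Linf_eq => f; rewrite Linf_addE Linf_scaleE !limit_opE -ulim_linear//.
  exact: limit_ubounded.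
exact: limit_ubounded.
Qed.

Lemma limit_op_ge0 T : Linf_ge0 T -> Linf_ge0 (limit_op T).
Proof.
move=> T0 f f0; rewrite limit_opE; apply: ulim_ge0 => //; first exact: limit_ubounded.
by move=> n; apply: T0; exact: nrtranslate_ge0.
Qed.

Lemma limit_op_one : limit_op one = one.
Proof.
apply: Linf_eq => f; rewrite limit_opE.
have -> : (fun n => one (nrtranslate (z n) f) : R[i]) = cst (one f).
  by apply/funext => n; exact: one_nrtranslate.
rewrite (@ulim_cvg _ _ UU ooU (cst (one f)) (complex.Re (one f)) (complex.Im (one f))).
- by case: (Linf_fun one f).
- exact: cvg_cst.
- exact: cvg_cst.
Qed.

(** The two operations already commute at each index, by [convol_nrtranslate]. *)
Lemma limit_op_lact f T : limit_op (lact f T) = lact f (limit_op T).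
Proof.
apply: Linf_eq => g; rewrite (lactE hG lG haar) !limit_opE; congr ulim.
by apply/funext => n; rewrite (lactE hG lG haar) convol_nrtranslate.
Qed.

(** Translating the indicator of [A] amounts to integrating over translates of [A], which eventually
    contain each point. The limit therefore exists along the integers, and the ultrafilter has no
    choice. *)
Lemma limit_op_restr A (mA : measurable (A : set (borel G))) :
  (forall x, \forall n \near \oo, A (x * (z n)^-1)%g) ->
  limit_op (MkLinf (Linf_restr_bounded mu mA)) = one.
Proof.
move=> Az; apply: Linf_eq => f; rewrite limit_opE.
have [cR cI] := restr_cvg f (fun n => measurable_preimage_mulr (z n)^-1%g mA) Az.
rewrite (_ : (fun n => _) = fun n => one (restr ((fun y => (y * (z n)^-1)%g) @^-1` A) f)).
  by rewrite (ulim_cvg UU ooU cR cI); case: (Linf_fun one f).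
by apply/funext => n; rewrite -[RHS](one_nrtranslate (z n)) -restr_nrtranslate.
Qed.

End limit_operator.

(** * Failure of right invariance *)

Section right_invariance.
Context (R : realType) (G : topGroupType) (mu : {measure set (borel G) -> \bar R}).
Hypothesis hG : hausdorff_space G.
Hypothesis lG : locally_compact [set: G].
Hypothesis haar : left_haar mu.
Variable D : G -> R.
Hypothesis D0 : forall x, 0 < D x.
Hypothesis DE : forall x (B : set (borel G)), measurable B ->
  mu ((fun y => (y * x)%g) @^-1` B) = ((D x)%:E * mu B)%E.
Implicit Types (f g h : L1 mu) (S T : Linf mu) (A B : set G) (x y : G).
Local Notation one := (Linf_one mu).

Lemma nrtranslate_P1 x f : P1 f -> P1 (nrtranslate D x f).
Proof.
by move=> [f0 f1]; split; [exact: nrtranslate_ge0|rewrite (L1norm_nrtranslate D0 DE)].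
Qed.

Lemma Linf_restr_disjoint A B (mA : measurable (A : set (borel G)))
  (mB : measurable (B : set (borel G))) : A `&` B = set0 ->
  Linf_ge0 (one - MkLinf (Linf_restr_bounded mu mA) - MkLinf (Linf_restr_bounded mu mB)).
Proof.
move=> AB f f0; rewrite !Linf_subE.
have -> : one f - MkLinf (Linf_restr_bounded mu mA) f -
    MkLinf (Linf_restr_bounded mu mB) f = one (f - restr A f - restr B f) :> R[i].
  by rewrite !LinfB.
apply: Linf_one_pos; apply: filterS f0 => x fx.
rewrite !L1_subE !restrE// -addrA -opprD -mulrDl -{1}[f x : R[i]]mul1r -mulrBl.
rewrite mulr_ge0// -rmorphD -(rmorphB _ 1) lecR subr_ge0 !indicE.
have [xA|] := boolP (x \in A); last by case: (x \in B); rewrite ?add0r ?addr0// ler01.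
have [xB|] := boolP (x \in B); last by rewrite addr0.
by have : (A `&` B) x := conj (set_mem xA) (set_mem xB); rewrite AB.
Qed.

Lemma TRIM_le (m : {scalar Linf mu}) T f f' : TRIM mu m -> P1 f -> P1 f' ->
  Linf_ge0 (one - ract T f - ract T f') -> 2 * m T <= 1.
Proof.
move=> [[m0 m1] mr] Pf Pf' /m0.
have mB S S' : m (S - S') = m S - m S' by exact: linearB.
have -> : m (one - ract T f - ract T f') = 1 - m T - m T.
  by rewrite -{1}(mr f T Pf) -(mr f' T Pf') -m1 -!mB.
by rewrite -addrA -opprD subr_ge0 mulr_natl mulr2n.
Qed.

Lemma sub_ract S T f f' g : (S - ract T f - ract T f') g =
  S g - T (convol g f) - T (convol g f') :> R[i].
Proof. by rewrite 2!Linf_subE 2!(ractE hG lG haar). Qed.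

(** Topological right invariance speaks of averages over P_1(G), not of translates by a point, so
    the translation by [x] is put on [f]. Acting by [f] and by its normalised translate on the
    indicator of [A] amounts to acting by [f] on the indicators of two disjoint sets, whose sum is
    at most 1. *)
Lemma mean_restr_le x A (mA : measurable (A : set (borel G))) (m : {scalar Linf mu}) :
  (forall y, A y -> ~ A (y * x)%g) -> TRIM mu m ->
  2 * m (MkLinf (Linf_restr_bounded mu mA)) <= 1.
Proof.
move=> Ax mR; have [f Pf] := P1_exists hG lG haar.
have [f0 _] := Pf; apply: (TRIM_le mR Pf (nrtranslate_P1 x Pf)).
set T := MkLinf _.
move=> g g0; rewrite sub_ract (convol_nrtranslate hG lG haar D0 DE).
have -> : one g = one (convol g f) :> R[i].
  by rewrite (integral_convol hG lG haar) (P1_one Pf) mulr1.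
have mA' : measurable ([set y | A (y * x^-1)%g] : set (borel G)).
  exact: measurable_preimage_mulr.
have -> : T (nrtranslate D x (convol g f)) =
    MkLinf (Linf_restr_bounded mu mA') (convol g f) :> R[i].
  by rewrite -[RHS](one_nrtranslate D0 DE x) -(restr_nrtranslate D0 DE).
apply: (convol_ge0 hG lG haar (Linf_restr_disjoint mA mA' _) g0 f0).
apply/seteqP; split=> // y [/= Ay Ayx]; apply: (Ax _ Ayx).
by rewrite mulgVK.
Qed.

End right_invariance.

Theorem theorem5p9 (R : realType) (G : topGroupType)
    (mu : {measure set (borel G) -> \bar R}) :
  hausdorff_space G -> locally_compact [set: G] -> left_haar mu ->
  amenable mu ->
  (exists x : G, ~ precompact (conjugacy_class x)) ->
  TLIM mu <> TIM mu.
Proof.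
move=> hG lG haar am [x nx] TT.
have [D [D0 mD DM DE]] := haar_modular hG lG haar.
have [m [[m0 m1] ml]] := TLIM_exists hG lG haar D0 mD DM DE am.
have [A [y [oA Ax Ay]]] := thick_set hG lG nx.
have mA : measurable (A : set (borel G)) := open_bor (oA : open (A : set (pointed_group G))).
have [U [UU ooU]] := ultraFilterLemma (_ : ProperFilter \oo).
(* The operator translates by the inverses of the given points, so the [y n] enter inverted. *)
pose Phi := limit_op D0 DE UU (fun n => (y n)^-1%g).
have lin (a : R[i]) S T : m (Phi (a *: S + T)) = a * m (Phi S) + m (Phi T).
  by rewrite /Phi limit_op_linear linearP.
have [m' m'E] := scalar_exists lin.
have m'L : TLIM mu m'.
  split; first split.
  - by move=> T T0; rewrite m'E; apply: m0; exact: limit_op_ge0.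
  - by rewrite m'E /Phi limit_op_one.
  - by move=> f T Pf; rewrite !m'E /Phi limit_op_lact// ml.
have [_ m'R] : TIM mu m' by rewrite -TT.
have := mean_restr_le hG lG haar D0 DE mA Ax m'R.
(* [Phi] sends the indicator of [A] to 1, and the bound becomes [2 <= 1]. *)
rewrite m'E /Phi limit_op_restr//; last by move=> z; apply: filterS (Ay z) => n; rewrite invgK.
by rewrite m1 mulr1 (ler_nat _ 2 1).
Qed.
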